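(* Let $u_0\in L^2(\Omega)$ and let $u$ be the solution of $$\partial_t u-(1+\gamma\partial_t^\alpha)\Delta u=f(u)\ \text{ in }\Omega\times(0,T],\qquad u=0\ \text{ on }\partial\Omega\times(0,T],\qquad u(\cdot,0)=u_0\ \text{ in }\Omega.$$ Then there is a constant $c$, independent of $t$ and $u_0$, such that for all $t\in(0,T]$ $$\|u(t)\|\le c\,\big(\|u_0\|+t\,\|f(0)\|\big).$$
   Context: $\Omega\subset\mathbb{R}^d$ ($d=1,2,3$) is a bounded convex polygonal domain with boundary $\partial\Omega$; $T>0$, $\gamma>0$ and $\alpha\in(0,1)$ are fixed. $\partial_t^\alpha$ is the Riemann–Liouville derivative in time, $\partial_t^\alpha\varphi(t)=\frac{d}{dt}\int_0^t\frac{(t-s)^{-\alpha}}{\Gamma(1-\alpha)}\varphi(s)\,ds$. The function $f:\mathbb{R}\to\mathbb{R}$ is smooth and satisfies $|f(t)-f(s)|\le L|t-s|$ for all $t,s\in\mathbb{R}$, for some constant $L>0$; $f(u)$ is the pointwise composition. $\|\cdot\|$ is the $L^2(\Omega)$ norm, and $\|f(0)\|$ is the $L^2(\Omega)$ norm of the constant function with value $f(0)$. Let $A=-\Delta$ with homogeneous Dirichlet boundary conditions on $\Omega$. A solution is understood in the integral (mild) sense: $u\in C([0,T];L^2(\Omega))$ with $u(t)=E(t)u_0+\int_0^tE(t-s)f(u(s))\,ds$ for $t\in(0,T]$, $u(0)=u_0$, where $$E(t)=\frac1{2\pi i}\int_{\Gamma_{\theta,\delta}}e^{zt}\frac{g(z)}{z}(g(z)I+A)^{-1}\,dz,\qquad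 g(z)=\frac{z}{1+\gamma z^\alpha},$$ with fixed $\theta\in(\pi/2,\pi)$, $\delta>0$ and $\Gamma_{\theta,\delta}=\{\rho e^{\pm i\theta}:\rho\ge\delta\}\cup\{\delta e^{i\psi}:|\psi|\le\theta\}$ oriented with increasing imaginary part. The constant $c$ may depend on $\Omega,\alpha,\gamma,L,T$. *)

(* Defs.v *)
From HB Require Import structures.
From mathcomp Require Import all_boot all_order all_algebra.
From mathcomp Require Import complex.
From mathcomp Require Import all_classical all_reals all_analysis.

Set Implicit Arguments.
Unset Strict Implicit.
Unset Printing Implicit Defensive.

Import Order.TTheory GRing.Theory Num.Theory.
Import numFieldNormedType.Exports.

Local Open Scope classical_set_scope.
Local Open Scope ring_scope.
Local Open Scope complex_scope.

(* R^n is ['rV[R]_n], with the sigma-algebra generated by the coordinates, i.e.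
   the Borel sigma-algebra. *)
Definition rv_display : measure_display. Proof. exact: default_measure_display. Qed.

Section measurable_rv.
Context {R : realType}.
Variable n : nat.

Let coord (i : 'I_n) (x : 'rV[R]_n) : measurableTypeR R := x ord0 i.

Let rv_set0 : g_sigma_preimage coord set0.
Proof. exact: sigma_algebra0. Qed.

Let rv_setC A : g_sigma_preimage coord A -> g_sigma_preimage coord (~` A).
Proof. exact: sigma_algebraC. Qed.

Let rv_bigcup (F : (set _)^nat) : (forall i, g_sigma_preimage coord (F i)) ->
  g_sigma_preimage coord (\bigcup_i (F i)).
Proof. exact: sigma_algebra_bigcup. Qed.

HB.instance Definition _ := @isMeasurable.Build rv_display
  'rV[R]_n (g_sigma_preimage coord) rv_set0 rv_setC rv_bigcup.

End measurable_rv.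


Section lebesgue_rv.
Context {R : realType}.

Lemma measurable_coord n (i : 'I_n) :
  measurable_fun [set: 'rV[R]_n] (fun x => x ord0 i : measurableTypeR R).
Proof.
move=> _ Y mY; rewrite setTI; apply: sub_sigma_algebra => /=.
rewrite -bigcup_seq/=; exists i => /=; first by rewrite mem_index_enum.
by exists Y => //; rewrite setTI.
Qed.

Lemma measurable_fun_rvP d (T : measurableType d) n (f : T -> 'rV[R]_n) :
  (forall i, measurable_fun setT (fun x => f x ord0 i : measurableTypeR R)) ->
  measurable_fun setT f.
Proof.
move=> mf; apply: (@measurability _ _ _ _ _ _
  (\big[setU/set0]_(i < n) preimage_set_system setT
    (fun x : 'rV[R]_n => x ord0 i : measurableTypeR R) measurable)) => //.
move=> _ [A + <-]; rewrite -bigcup_seq/= => -[i _ [B mB <-]].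
by rewrite !setTI -[X in measurable X]setTI; exact: mf.
Qed.

Definition rv_cons n (p : measurableTypeR R * 'rV[R]_n) : 'rV[R]_n.+1 :=
  \row_i oapp (p.2 ord0) p.1 (unlift ord0 i).

Definition rv_uncons n (x : 'rV[R]_n.+1) : measurableTypeR R * 'rV[R]_n :=
  (x ord0 ord0, \row_i x ord0 (lift ord0 i)).

Lemma rv_consK n : cancel (@rv_cons n) (@rv_uncons n).
Proof.
move=> [a x]; rewrite /rv_uncons /rv_cons !mxE unlift_none /=; congr pair.
by apply/rowP => i; rewrite !mxE liftK.
Qed.

Lemma rv_unconsK n : cancel (@rv_uncons n) (@rv_cons n).
Proof.
move=> x; apply/rowP => i; rewrite !mxE.
by case: unliftP => [j ->|->] //=; rewrite mxE.
Qed.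

Lemma measurable_rv_cons n : measurable_fun setT (@rv_cons n).
Proof.
apply: measurable_fun_rvP => i.
case: (unliftP ord0 i) => [j ->|->].
  rewrite (_ : (fun _ => _) = (fun x : 'rV[R]_n => x ord0 j : measurableTypeR R) \o snd).
    by apply: measurableT_comp => //; exact: measurable_coord.
  by apply/funext => p; rewrite mxE liftK.
rewrite (_ : (fun _ => _) = fst) //.
by apply/funext => p; rewrite mxE unlift_none.
Qed.

Lemma measurable_rv_uncons n : measurable_fun setT (@rv_uncons n).
Proof.
apply/measurable_fun_pairP; split; first exact: measurable_coord.
apply: measurable_fun_rvP => i.
rewrite (_ : (fun _ => _) = fun x : 'rV[R]_n.+1 => x ord0 (lift ord0 i)).
  exact: measurable_coord.
by apply/funext => x; rewrite mxE.
Qed.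

(* Lebesgue measure on R^n: R^0 is a point of mass 1, and the measure on
   R^n.+1 is the product measure transported along R * R^n ~ R^n.+1. *)
Fixpoint lebesgue_rv n : set 'rV[R]_n -> \bar R :=
  match n with
  | 0%N => \d_(0 : 'rV[R]_0)
  | n'.+1 => pushforward (lebesgue_measure \x @lebesgue_rv n')%E (@rv_cons n')
  end.

Lemma sigma_finite_measure_ex d (T : measurableType d) (nu : set T -> \bar R) :
  nu set0 = 0%E -> (forall A, 0 <= nu A)%E -> semi_sigma_additive nu ->
  sigma_finite setT nu ->
  exists m : {sigma_finite_measure set T -> \bar R}, nu = m.
Proof.
move=> nu0 nuge nusa nusf.
pose b1 := isMeasure.Build _ _ _ nu nu0 nuge nusa.
pose m1 : {measure set T -> \bar R} := HB.pack nu b1.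
pose b2 := Measure_isSigmaFinite.Build _ _ _ m1 nusf.
pose m2 : {sigma_finite_measure set T -> \bar R} := HB.pack nu b1 b2.
by exists m2.
Qed.

Lemma lebesgue_rv_subproof n :
  exists mu : {sigma_finite_measure set 'rV[R]_n -> \bar R}, @lebesgue_rv n = mu.
Proof.
elim: n => [|n [mu IH]]; first by exists (\d_(0 : 'rV[R]_0)).
rewrite /= IH; pose nu := pushforward (@lebesgue_measure R \x mu)%E (@rv_cons n).
have nu0 : nu set0 = 0%E by rewrite /nu /pushforward preimage_set0 measure0.
have nuge A : (0 <= nu A)%E by rewrite /nu /pushforward; exact: measure_ge0.
have nusa : semi_sigma_additive nu.
  move=> F mF tF mUF; rewrite /nu /pushforward preimage_bigcup.
  apply: measure_semi_sigma_additive.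
  - move=> k; rewrite -[X in measurable X]setTI; exact: measurable_rv_cons.
  - apply/trivIsetP => /= i j _ _ ij; rewrite -preimage_setI.
    by move/trivIsetP : tF => /(_ _ _ _ _ ij) ->//; rewrite preimage_set0.
  - rewrite -preimage_bigcup -[X in measurable X]setTI.
    exact: measurable_rv_cons.
have nusf : sigma_finite setT nu.
  have [F FT Foo] : sigma_finite setT (@lebesgue_measure R \x mu)%E.
    have /sigma_finiteP[F [TF ndF Foo]] := sigma_finiteT (@lebesgue_measure R).
    have /sigma_finiteP[G [TG ndG Goo]] := sigma_finiteT mu.
    exists (fun k => F k `*` G k).
      rewrite -setXTT TF TG predeqE => -[x y]; split.
        move=> [/= [k _ Fkx] [l _ Gly]]; exists (maxn k l) => //; split.
          by move: x Fkx; exact/subsetPset/ndF/leq_maxl.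
        by move: y Gly; exact/subsetPset/ndG/leq_maxr.
      by move=> [k _ []/= ? ?]; split; exists k.
    move=> k; have [? ?] := Foo k; have [? ?] := Goo k.
    split; first exact: measurableX.
    by rewrite product_measure1E// lte_mul_pinfty// ge0_fin_numE.
  exists (fun k => @rv_uncons n @^-1` F k).
    by rewrite -preimage_bigcup -FT preimage_setT.
  move=> k; have [mFk Fkoo] := Foo k; split.
    by rewrite -[X in measurable X]setTI; exact: measurable_rv_uncons.
  rewrite /nu /pushforward -comp_preimage.
  by rewrite (_ : @rv_uncons n \o @rv_cons n = id) //; apply/funext; exact: rv_consK.
exact: sigma_finite_measure_ex.
Qed.

Section lebesgue_rv_measure.
Variable n : nat.

Let mu0 : @lebesgue_rv n set0 = 0%E.
Proof. by have [mu ->] := lebesgue_rv_subproof n; exact: measure0. Qed.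

Let mu_ge0 A : (0 <= @lebesgue_rv n A)%E.
Proof. by have [mu ->] := lebesgue_rv_subproof n; exact: measure_ge0. Qed.

Let mu_additive : semi_sigma_additive (@lebesgue_rv n).
Proof.
have [mu ->] := lebesgue_rv_subproof n; exact: measure_semi_sigma_additive.
Qed.

HB.instance Definition _ := isMeasure.Build _ _ _ (@lebesgue_rv n)
  mu0 mu_ge0 mu_additive.

Let mu_sigma_finite : sigma_finite setT (@lebesgue_rv n).
Proof. by have [mu ->] := lebesgue_rv_subproof n; exact: sigma_finiteT. Qed.

HB.instance Definition _ := Measure_isSigmaFinite.Build _ _ _ (@lebesgue_rv n)
  mu_sigma_finite.

End lebesgue_rv_measure.

End lebesgue_rv.


Arguments lebesgue_rv {R} n _.

(* Functions on Omega are total functions on R^d of which only the values on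
   Omega matter: [f \_ Omega] extends [f] by zero outside Omega.  Elements of
   L^2(Omega) are represented by functions, equality being [eqL2]. *)
Section L2.
Context {R : realType} {d : nat}.
Implicit Types (Omega : set 'rV[R]_d).

Definition inL2 Omega (f : 'rV[R]_d -> R) : Prop :=
  f \_ Omega \in Lfun (lebesgue_rv d) 2%:E.

Definition normL2 Omega (f : 'rV[R]_d -> R) : R :=
  fine ('N[lebesgue_rv d]_2%:E[EFin \o (f \_ Omega)])%E.

Definition inL2C Omega (v : 'rV[R]_d -> R[i]) : Prop :=
  inL2 Omega (fun x => complex.Re (v x)) /\ inL2 Omega (fun x => complex.Im (v x)).

Definition normL2C Omega (v : 'rV[R]_d -> R[i]) : R :=
  normL2 Omega (fun x => ComplexField.Normc.normc (v x)).

Definition eqL2 (V : Type) Omega (f g : 'rV[R]_d -> V) : Prop :=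
  {ae lebesgue_rv d, forall x, Omega x -> f x = g x}.

End L2.

Section dirichlet_laplacian.
Context {R : realType} {d : nat}.
Implicit Types (Omega : set 'rV[R]_d).

(* A nonempty bounded intersection of finitely many open half-spaces; for d = 1
   this is a bounded open interval. *)
Definition convex_polytopal_domain Omega : Prop :=
  [/\ Omega !=set0, bounded_set Omega &
    exists (m : nat) (a : 'I_m -> 'rV[R]_d) (b : 'I_m -> R),
      Omega = [set x | forall j, \sum_(k < d) a j ord0 k * x ord0 k < b j]].

Definition smooth (phi : 'rV[R]_d -> R) : Prop :=
  forall (s : seq 'rV[R]_d) (x : 'rV[R]_d),
    differentiable (foldr (fun v (h : 'rV[R]_d -> R) => 'D_v h) phi s) x.

Definition partial (k : 'I_d) (phi : 'rV[R]_d -> R) : 'rV[R]_d -> R :=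
  'D_(delta_mx ord0 k) phi.

(* C_c^oo(Omega) *)
Definition test_function Omega (phi : 'rV[R]_d -> R) : Prop :=
  [/\ smooth phi, compact (closure [set x | phi x != 0]) &
      closure [set x | phi x != 0] `<=` Omega].

(* [u] belongs to H^1_0(Omega), the closure of C_c^oo(Omega) in H^1(Omega), and
   [p] is its weak gradient. *)
Definition H10_gradient Omega (u : 'rV[R]_d -> R) (p : 'I_d -> 'rV[R]_d -> R)
    : Prop :=
  [/\ inL2 Omega u, forall k, inL2 Omega (p k) &
    exists phi : nat -> 'rV[R]_d -> R,
      [/\ forall n, test_function Omega (phi n),
          normL2 Omega (fun x => phi n x - u x) @[n --> \oo] --> (0 : R) &
          forall k, normL2 Omega (fun x => partial k (phi n) x - p k x)
            @[n --> \oo] --> (0 : R)]].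

(* Graph of A = - Delta in L^2(Omega), with domain
   {u in H^1_0(Omega) | Delta u in L^2(Omega)}, Delta u being the distributional
   divergence of the gradient. *)
Definition dirichlet_laplacian Omega (u h : 'rV[R]_d -> R) : Prop :=
  inL2 Omega h /\
  exists p, H10_gradient Omega u p /\
    forall psi, test_function Omega psi ->
      \int[lebesgue_rv d]_(x in Omega) (\sum_(k < d) p k x * partial k psi x) =
      \int[lebesgue_rv d]_(x in Omega) (h x * psi x).

Definition dirichlet_laplacianC Omega (u h : 'rV[R]_d -> R[i]) : Prop :=
  dirichlet_laplacian Omega
    (fun x => complex.Re (u x)) (fun x => complex.Re (h x)) /\
  dirichlet_laplacian Omega
    (fun x => complex.Im (u x)) (fun x => complex.Im (h x)).

(* r = (w I + A)^-1 v *)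
Definition is_resolvent Omega (w : R[i]) (v r : 'rV[R]_d -> R[i]) : Prop :=
  inL2C Omega v /\ dirichlet_laplacianC Omega r (fun x => v x - w * r x).

End dirichlet_laplacian.

Section bochner.
Context {R : realType} {d : nat}.
Implicit Types (Omega : set 'rV[R]_d) (D : set R).

Record simpleL2 Omega := SimpleL2 {
  simple_size : nat;
  simple_set : 'I_simple_size -> set (measurableTypeR R);
  simple_val : 'I_simple_size -> 'rV[R]_d -> R[i];
  simple_set_measurable : forall k, measurable (simple_set k);
  simple_set_finite : forall k, (lebesgue_measure (simple_set k) < +oo)%E;
  simple_val_L2 : forall k, inL2C Omega (simple_val k) }.

Definition simple_eval Omega (S : simpleL2 Omega) (r : R) (x : 'rV[R]_d) : R[i] :=
  \sum_k (\1_(simple_set (s := S) k) r)%:C * simple_val (s := S) k x.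

Definition simple_integral Omega D (S : simpleL2 Omega) (x : 'rV[R]_d) : R[i] :=
  \sum_k (fine (lebesgue_measure (simple_set (s := S) k `&` D)))%:C
    * simple_val (s := S) k x.

(* w is the Bochner integral over D, with respect to the Lebesgue measure, of
   the L^2(Omega)-valued function F. *)
Definition is_Bochner_integral Omega D (F : R -> 'rV[R]_d -> R[i])
    (w : 'rV[R]_d -> R[i]) : Prop :=
  [/\ inL2C Omega w, forall r, D r -> inL2C Omega (F r) &
    exists S : nat -> simpleL2 Omega,
      let dist n r := normL2C Omega (fun x => F r x - simple_eval (S n) r x) in
      [/\ forall n, measurable_fun (D : set (measurableTypeR R)) (dist n),
          (\int[lebesgue_measure]_(r in D) (dist n r)%:E)%E @[n --> \oo] --> 0%E &
          normL2C Omega (fun x => simple_integral D (S n) x - w x)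
            @[n --> \oo] --> (0 : R)]].

End bochner.

Section complex_functions.
Context {R : realType}.
Implicit Types (z : R[i]) (rho psi a : R).

Definition polar rho psi : R[i] := (rho * cos psi) +i* (rho * sin psi).

Definition cexp z : R[i] := polar (expR (complex.Re z)) (complex.Im z).

(* the principal argument, in ]-pi, pi] *)
Definition carg z : R :=
  let psi := acos (complex.Re z / ComplexField.Normc.normc z) in
  if 0 <= complex.Im z then psi else - psi.

(* the principal branch of z^a *)
Definition cpow z a : R[i] :=
  polar (ComplexField.Normc.normc z `^ a) (a * carg z).

End complex_functions.

Section mild_solution.
Context {R : realType} {d : nat}.
Implicit Types (Omega : set 'rV[R]_d).

Definition contour (theta delta : R) : set R[i] :=
  [set z | (exists2 rho, delta <= rho &
              z = polar rho theta \/ z = polar rho (- theta)) \/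
           (exists2 psi, `|psi| <= theta & z = polar delta psi)].

(* w is the integral over the contour, oriented with increasing imaginary part,
   of the L^2(Omega)-valued function F: the three pieces are parametrized by
   dz = e^(+-i theta) drho and dz = i delta e^(i psi) dpsi, the lower ray being
   run from infinity to its origin. *)
Definition is_contour_integral Omega (theta delta : R)
    (F : R[i] -> 'rV[R]_d -> R[i]) (w : 'rV[R]_d -> R[i]) : Prop :=
  exists wup wlow warc : 'rV[R]_d -> R[i],
    [/\ is_Bochner_integral Omega `[delta, +oo[
          (fun rho x => polar 1 theta * F (polar rho theta) x) wup,
        is_Bochner_integral Omega `[delta, +oo[
          (fun rho x => polar 1 (- theta) * F (polar rho (- theta)) x) wlow,
        is_Bochner_integral Omega `[- theta, theta]
          (fun psi x => (0 +i* 1) * polar delta psi * F (polar delta psi) x) warc &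
        eqL2 Omega w (fun x => wup x - wlow x + warc x)].

Definition gfun (gamma alpha : R) (z : R[i]) : R[i] :=
  z / (1 + gamma%:C * cpow z alpha).

(* w = E(t) v, where
   E(t) = (2 pi i)^-1 \int_contour e^(zt) g(z)/z (g(z) I + A)^-1 dz *)
Definition is_solution_operator Omega (gamma alpha theta delta t : R)
    (v w : 'rV[R]_d -> R[i]) : Prop :=
  exists (r : R[i] -> 'rV[R]_d -> R[i]) (W : 'rV[R]_d -> R[i]),
    [/\ forall z, contour theta delta z ->
          is_resolvent Omega (gfun gamma alpha z) v (r z),
        is_contour_integral Omega theta delta
          (fun z x => cexp (z * t%:C) * (gfun gamma alpha z / z) * r z x) W &
        eqL2 Omega w (fun x => W x / (0 +i* (2 * pi)))].

(* u in C([0, T]; L^2(Omega)), u(0) = u0 and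
   u(t) = E(t) u0 + \int_0^t E(t - s) f(u(s)) ds for 0 < t <= T *)
Definition mild_solution Omega (gamma alpha theta delta T : R) (f : R -> R)
    (u0 : 'rV[R]_d -> R) (u : R -> 'rV[R]_d -> R) : Prop :=
  [/\ forall t : R, 0 <= t <= T -> inL2 Omega (u t),
      forall t : R, 0 <= t <= T ->
        normL2 Omega (fun x => u s x - u t x)
          @[s --> within `[0, T] (nbhs t)] --> (0 : R),
      eqL2 Omega (u 0) u0 &
      forall t : R, 0 < t <= T ->
        exists (w : 'rV[R]_d -> R[i]) (G : R -> 'rV[R]_d -> R[i])
               (W : 'rV[R]_d -> R[i]),
          [/\ is_solution_operator Omega gamma alpha theta delta t
                (fun x => (u0 x)%:C) w,
              forall s : R, 0 < s < t ->
                is_solution_operator Omega gamma alpha theta delta (t - s)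
                  (fun x => (f (u s x))%:C) (G s),
              is_Bochner_integral Omega `]0, t[ G W &
              eqL2 Omega (fun x => (u t x)%:C) (fun x => w x + W x)]].

End mild_solution.

(* Main.v *)
Require Import Defs.
From HB Require Import structures.
From mathcomp Require Import all_boot all_order all_algebra.
From mathcomp Require Import spectral sesquilinear complex ring lra.
From mathcomp Require Import all_classical all_reals all_analysis measurable_realfun.

Set Implicit Arguments.
Unset Strict Implicit.
Unset Printing Implicit Defensive.

Import Order.TTheory GRing.Theory Num.Theory.
Import numFieldNormedType.Exports.

Local Open Scope classical_set_scope.
Local Open Scope ring_scope.

(** The solution operators [E(t)] are bounded on L2 by a constant that depends
    neither on [t] nor on the contour; the Lipschitz bound on [f] and Gronwall's
    lemma do the rest.  The classical proof of the first fact replaces the contour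
    by one of radius [1 / t], on which the integrand is absolutely integrable with
    a bound independent of [t].  Here the resolvents [(g(z) + A)^-1 v] are given
    on the original contour only, so the deformation is carried out on scalar
    functions, and the passage between scalars and operators is an inequality of
    functional calculus that mentions no other resolvent.

    That inequality is [resolvent_combination]: if [A] is symmetric and
    nonnegative and [r k = (g k + A)^-1 v], then the norm of [\sum_k c k *: r k]
    is at most the norm of [v] times the supremum over [l >= 0] of
    [|\sum_k c k / (g k + l)|].  Indeed, compress [A] to the span of the [r k] and
    diagonalize the resulting Hermitian matrix: the coordinate of [r k] on an
    eigenvector of eigenvalue [l] is that of [v] divided by [g k + l].  The
    hypotheses on [A] follow from Green's formula for the Dirichlet Laplacian
    ([dirichlet_form]), and [resolvent_combination_norm] states the result in L2.

    On the scalar side put [z = exp zeta].  A Riemann sum of the contour integral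
    over a grid [delta * (1 + h) ^ k], [- theta + j * h] then becomes a Riemann sum
    of [contour_kernel], and [discrete_cauchy] is Cauchy's theorem for it: every
    cell of the polar grid contributes [O(h ^ 3)], so the sum over the contour
    agrees, up to [O(h)], with a sum over the arc at a large outer radius.  On that
    arc the kernel is negligible at obtuse angles, so the opening angle can be
    brought between two fixed values ([arc_sum_transfer]); from there the theorem is
    applied backwards down to a radius between [1 / t] and [2 / t], where the
    triangle inequality gives the bound [contour_const] ([contour_sum_scaled]).
    All errors are uniform in [l]: rotating by half the argument of [exp zeta]
    shows that the denominator [1 + l / g(exp zeta)] of the kernel is bounded
    below and grows linearly in [l] ([kernel_denominator]).  The conclusion is
    [contour_sum_bound].

    The three Bochner integrals of the contour, paired with a fixed vector, are
    compared with their Riemann sums ([bochner_riemann_bound], [ray_bound],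
    [arc_bound]); the three sums together form a single linear combination of
    resolvents ([contour_nodes_bound]).  Letting the mesh tend to zero gives
    [solution_operator_bound], that is [|E(t) v| <= contour_const / (2 pi) * |v|].

    Finally, with [C] a bound for the [E(t)], the mild formulation gives
    [|u(t)| <= C * (|u0| + t * |f(0)|) + C * L * \int_0^t |u(s)| ds] in the sense
    that every exponential majorant of [|u(s)|] may be inserted on the right, and
    [gronwall] iterates this. *)

(** * Linear combinations of resolvents of a symmetric nonnegative operator *)

(* The form is only semidefinite: elements of L2 are represented by functions,
   and a function that vanishes almost everywhere is a nonzero null vector. *)
Section semi_inner_product.
Variables (C : numClosedFieldType) (X : lmodType C) (ip : X -> X -> C).
Hypothesis ip_linear : forall a x y z, ip (a *: x + y) z = a * ip x z + ip y z.
Hypothesis ip_conj : forall x y, ip y x = (ip x y)^*.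
Hypothesis ip_ge0 : forall x, 0 <= ip x x.

Let ipDl x y z : ip (x + y) z = ip x z + ip y z.
Proof. by rewrite -[x]scale1r ip_linear mul1r scale1r. Qed.
Let ip0l z : ip 0 z = 0.
Proof. by apply: (addIr (ip 0 z)); rewrite -ipDl addr0 add0r. Qed.
Let ipZl a x z : ip (a *: x) z = a * ip x z.
Proof. by rewrite -[_ *: _]addr0 ip_linear ip0l addr0. Qed.
Let ipNl x z : ip (- x) z = - ip x z.
Proof. by rewrite -scaleN1r ipZl mulN1r. Qed.
Let ipBl x y z : ip (x - y) z = ip x z - ip y z.
Proof. by rewrite ipDl ipNl. Qed.
Let ipDr x y z : ip z (x + y) = ip z x + ip z y.
Proof. by rewrite ip_conj ipDl rmorphD /= -!ip_conj. Qed.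
Let ip0r z : ip z 0 = 0.
Proof. by rewrite ip_conj ip0l rmorph0. Qed.
Let ipZr a x z : ip z (a *: x) = a^* * ip z x.
Proof. by rewrite ip_conj ipZl rmorphM /= -ip_conj. Qed.
Let ipNr x z : ip z (- x) = - ip z x.
Proof. by rewrite ip_conj ipNl rmorphN /= -ip_conj. Qed.
Let ipBr x y z : ip z (x - y) = ip z x - ip z y.
Proof. by rewrite ipDr ipNr. Qed.
Let ip_suml I (r : seq I) (P : pred I) (F : I -> X) z :
  ip (\sum_(i <- r | P i) F i) z = \sum_(i <- r | P i) ip (F i) z.
Proof. exact: (big_morph (ip^~ z) (fun x y => ipDl x y z) (ip0l z)). Qed.
Let ip_sumr I (r : seq I) (P : pred I) (F : I -> X) z :
  ip z (\sum_(i <- r | P i) F i) = \sum_(i <- r | P i) ip z (F i).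
Proof. exact: (big_morph (ip z) (fun x y => ipDr x y z) (ip0r z)). Qed.

(** Where [ip x x] vanishes, positivity of [ip (a *: x + y) (a *: x + y)] for all
    [a] leaves no room for a linear term. *)
Lemma ip_null x y : ip x x = 0 -> ip x y = 0.
Proof.
move=> x0; apply/eqP; apply/negPn/negP => xy0.
pose a := - (ip y y + 1) / ip x y.
have := ip_ge0 (a *: x + y).
rewrite ip_linear !ipDr !ipZr x0 (ip_conj x y) mulr0 add0r -rmorphM.
rewrite /a mulfVK // rmorphN rmorphD rmorph1 /=.
rewrite (CrealP (ger0_real (ip_ge0 y))) => /= ge0.
have : ip y y + 2 <= 0.
  by rewrite -oppr_ge0; apply: le_trans ge0 _; rewrite le_eqVlt; apply/orP; left;
     apply/eqP; ring.
by rewrite lt_geF // (lt_le_trans (ltr0Sn _ 1)) // lerDr.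
Qed.

Definition orthonormal m (e : 'I_m -> X) := forall i j, ip (e i) (e j) = (i == j)%:R.

Definition proj m (e : 'I_m -> X) x := \sum_i ip x (e i) *: e i.

Lemma ip_residual m (e : 'I_m -> X) x : orthonormal e ->
  ip (x - proj e x) (x - proj e x) = ip x x - \sum_i `|ip x (e i)| ^+ 2.
Proof.
move=> eo.
have pe i : ip (proj e x) (e i) = ip x (e i).
  rewrite ip_suml (bigD1 i) //= ipZl eo eqxx mulr1 big1 ?addr0 // => j ji.
  by rewrite ipZl eo (negPf ji) mulr0.
have xp : ip x (proj e x) = \sum_i `|ip x (e i)| ^+ 2.
  by rewrite ip_sumr; apply: eq_bigr => i _; rewrite ipZr normCKC.
have pp : ip (proj e x) (proj e x) = \sum_i `|ip x (e i)| ^+ 2.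
  rewrite {2}/proj ip_sumr; apply: eq_bigr => i _.
  by rewrite ipZr pe normCKC.
rewrite ipBl !ipBr xp pp (ip_conj x (proj e x)) xp.
by rewrite (CrealP _) ?subrr ?subr0 // ger0_real // sumr_ge0.
Qed.

Lemma bessel m (e : 'I_m -> X) x : orthonormal e ->
  \sum_i `|ip x (e i)| ^+ 2 <= ip x x.
Proof. by move=> eo; rewrite -subr_ge0 -ip_residual. Qed.

(** Gram-Schmidt up to null vectors: a vector whose residual is null adds nothing
    to the basis.  The predicate [Q] will be membership in the domain of the
    operator, which has to contain the new vectors. *)
Lemma gram_schmidt (Q : X -> Prop) (s : seq X) :
  (forall a x y, Q x -> Q y -> Q (a *: x + y)) ->
  (forall x, x \in s -> Q x) ->
  exists m (e : 'I_m -> X), [/\ forall i, Q (e i), orthonormal e &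
    forall x, x \in s -> ip x x = \sum_i `|ip x (e i)| ^+ 2].
Proof.
move=> Qlin; elim: s => [|x s IH] Qs.
  by exists 0%N, (fun=> 0); split => //; move=> [].
have [|m [e [Qe eo es]]] := IH; first by move=> y ys; apply: Qs; rewrite inE ys orbT.
pose y := x - proj e x.
have [y0|y0] := eqVneq (ip y y) 0.
  exists m, e; split => // z; rewrite inE => /predU1P[->|/es//].
  by apply/eqP; rewrite -subr_eq0 -ip_residual //; apply/eqP.
have Qx : Q x by apply: Qs; rewrite inE eqxx.
have Q0 : Q 0 by have := Qlin (-1) x x Qx Qx; rewrite scaleN1r addNr.
have Qsum (F : 'I_m -> C) : Q (\sum_i F i *: e i).
  apply: (big_ind Q) => // [a b Qa Qb|i _].
    by rewrite -[a]scale1r; apply: Qlin.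
  by rewrite -[_ *: _]addr0; apply: Qlin.
have Qy : Q y by rewrite /y addrC -scaleN1r; apply: Qlin => //; exact: Qsum.
pose k := sqrtC (ip y y).
have k0 : k != 0 by rewrite sqrtC_eq0.
have kR : k^* = k by apply/CrealP/ger0_real; rewrite sqrtC_ge0.
have kk : k * k = ip y y by rewrite -expr2 sqrtCK.
have ye i : ip y (e i) = 0.
  rewrite /y ipBl /proj ip_suml (bigD1 i) //= ipZl eo eqxx mulr1 big1 ?addr0 ?subrr //.
  by move=> j ji; rewrite ipZl eo (negPf ji) mulr0.
have xy : ip x y = ip y y.
  rewrite -{1}(subrK (proj e x) x) -/y ipDl /proj ip_suml big1 ?addr0 // => i _.
  by rewrite ipZl (ip_conj y) ye conjC0 mulr0.
pose e' (i : 'I_m.+1) := if unlift ord_max i is Some j then e j else k^-1 *: y.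
have e'l j : e' (widen_ord (leqnSn m) j) = e j.
  rewrite /e' (_ : widen_ord _ j = lift ord_max j) ?liftK //.
  by apply/val_inj => /=; rewrite /bump leqNgt ltn_ord.
have e'm : e' ord_max = k^-1 *: y by rewrite /e' unlift_none.
exists m.+1, e'; split.
- move=> i; rewrite /e'; case: unliftP => // _.
  by rewrite -[_ *: _]addr0; apply: Qlin.
- move=> i j; rewrite /e'.
  case: (unliftP ord_max i) => [i' ->|->]; case: (unliftP ord_max j) => [j' ->|->].
  + by rewrite eo (inj_eq lift_inj).
  + by rewrite ipZr (ip_conj y) ye conjC0 mulr0 eq_sym (negPf (neq_lift _ _)).
  + by rewrite ipZl ye mulr0 (negPf (neq_lift _ _)).
  + by rewrite ipZl ipZr eqxx fmorphV /= kR -kk mulKf // mulVf.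
- move=> z; rewrite big_ord_recr /= e'm; under eq_bigr do rewrite e'l.
  rewrite inE => /predU1P[->|zs].
    rewrite ipZr fmorphV /= kR xy -kk mulKf // (_ : `|k| ^+ 2 = ip y y); last first.
      by rewrite ger0_norm ?sqrtC_ge0 // expr2.
    rewrite /y ip_residual // addrC subrK //.
  rewrite -es //; suff -> : ip z (k^-1 *: y) = 0 by rewrite normr0 expr0n addr0.
  rewrite -(subrK (proj e z) z) ipDl ip_null ?add0r.
    by rewrite /proj ip_suml big1 // => i _; rewrite ipZl ipZr (ip_conj y) ye conjC0 !mulr0.
  by rewrite ip_residual // -es // subrr.
Qed.

Section graph.
Variable graph : X -> X -> Prop.
Hypothesis graph_linear : forall a x h y k,
  graph x h -> graph y k -> graph (a *: x + y) (a *: h + k).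
Hypothesis graph_sym : forall x h y k, graph x h -> graph y k -> ip h y = ip x k.
Hypothesis graph_ge0 : forall x h, graph x h -> 0 <= ip h x.

Lemma graph_lincomb n (c : 'I_n -> C) (e h : 'I_n -> X) : (0 < n)%N ->
  (forall i, graph (e i) (h i)) -> graph (\sum_i c i *: e i) (\sum_i c i *: h i).
Proof.
move=> n0 eh.
have g00 : graph 0 0.
  have := graph_linear (-1) (eh (Ordinal n0)) (eh (Ordinal n0)).
  by rewrite !scaleN1r !addNr.
elim/big_ind2: _ => // [x1 x2 y1 y2 g1 g2|i _].
  by rewrite -[x1]scale1r -[x2]scale1r; apply: graph_linear.
by rewrite -[_ *: e i]addr0 -[_ *: h i]addr0; apply: graph_linear.
Qed.

Local Open Scope sesquilinear_scope.

(** The Gram matrix of the images [h i] against an orthonormal basis [e] of the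
    span is Hermitian, because the graph is symmetric; a unitary change of basis
    diagonalizes it, and preserves the norms of the coordinate vectors. *)
Lemma compression (s : seq X) : (forall x, x \in s -> exists h, graph x h) ->
  exists m (e h : 'I_m -> X), [/\ orthonormal e, forall i, graph (e i) (h i),
    forall i j, i != j -> ip (h i) (e j) = 0 &
    forall x, x \in s -> ip x x = \sum_i `|ip x (e i)| ^+ 2].
Proof.
move=> sG.
have [||m [e [Ge eo es]]] := @gram_schmidt (fun x => exists h, graph x h) s.
- by move=> a x y [h xh] [k yk]; exists (a *: h + k); apply: graph_linear.
- exact: sG.
have [m0|m_gt0] := posnP m.
  by exists m, e, e; split => // i; exfalso; move: i; rewrite m0 => -[].
have [h eh] : exists h : 'I_m -> X, forall i, graph (e i) (h i).
  (* a finite choice of images, one index at a time *)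
  suff : forall p, exists h : 'I_m -> X, forall i : 'I_m, (i < p)%N -> graph (e i) (h i).
    by move=> /(_ m) [h hp]; exists h => i; apply: hp.
  elim=> [|p [h hp]]; first by exists (fun=> 0).
  have [mp|pm] := leqP m p.
    by exists h => i _; apply: hp; apply: leq_trans (ltn_ord i) mp.
  have [k ek] := Ge (Ordinal pm).
  exists (fun i => if i == Ordinal pm then k else h i) => i.
  have [-> //|ineq] := eqVneq i (Ordinal pm).
  rewrite ltnS leq_eqVlt => /predU1P[ipE|]; last exact: hp.
  by case/eqP: ineq; apply: val_inj.
pose gram (x y : 'I_m -> X) : 'M[C]_m := \matrix_(i, j) ip (x i) (y j).
pose rot (P : 'M[C]_m) (x : 'I_m -> X) i := \sum_j P i j *: x j.
have gram_rot P x y : gram (rot P x) (rot P y) = P *m gram x y *m P ^t*.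
  apply/matrixP => i k; rewrite !mxE ip_sumr; apply: eq_bigr => j _.
  rewrite ipZr ip_suml !mxE mulrC; congr (_ * _).
  by apply: eq_bigr => l _; rewrite ipZl !mxE.
pose B := gram h e.
have Bh : B \is normalmx.
  apply: hermitian_normalmx; apply/is_hermitianmxP; rewrite expr0 scale1r.
  by apply/matrixP => i j; rewrite !mxE -ip_conj; apply: graph_sym.
pose P := spectralmx B; have Pu : P \is unitarymx := spectral_unitarymx B.
have PP : P *m P ^t* = 1%:M by apply/unitarymxP.
have PP' : P ^t* *m P = 1%:M by apply: mulmx1C.
have PBP : P *m B *m P ^t* = diag_mx (spectral_diag B).
  move/orthomx_spectralP : Bh => {1}->.
  rewrite -/P !mulmxA mulmxV ?spectral_unit // mul1mx -mulmxA PP mulmx1 //.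
exists m, (rot P e), (rot P h); split.
- move=> i j; have /matrixP/(_ i j) := gram_rot P e e.
  rewrite (_ : gram e e = 1%:M) ?mulmx1 ?PP ?mxE //.
  by apply/matrixP => k l; rewrite !mxE eo.
- by move=> i; apply: graph_lincomb.
- move=> i j ij; have /matrixP/(_ i j) := gram_rot P h e.
  by rewrite PBP !mxE (negPf ij) mulr0n.
- move=> x xs; rewrite es //.
  pose u : 'rV[C]_m := \row_i ip x (e i).
  have sq (w : 'rV[C]_m) : \sum_i `|w 0 i| ^+ 2 = (w *m w ^t*) 0 0.
    by rewrite mxE; apply: eq_bigr => i _; rewrite !mxE normCK.
  transitivity (\sum_i `|u 0 i| ^+ 2); first by apply: eq_bigr => i _; rewrite mxE.
  transitivity (\sum_i `|(u *m P ^t*) 0 i| ^+ 2).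
    rewrite !sq; congr (fun_of_matrix _ _ _).
    rewrite trmx_mul map_mxM trmxCK -mulmxA (mulmxA (_ ^t*)) PP' mul1mx //.
  apply: eq_bigr => i _; congr (`|_| ^+ 2).
  rewrite mxE /rot ip_sumr; apply: eq_bigr => j _.
  by rewrite ipZr !mxE mulrC.
Qed.

(** In a basis [e] that diagonalizes the compression of the operator, with
    eigenvalues [l i = ip (h i) (e i)], pairing the equation of [r k] with [e i]
    gives [ip (r k) (e i) = ip v (e i) / (g k + l i)].  The coordinates of the
    combination are therefore those of [v] multiplied by scalars of modulus at
    most [M], and Bessel's inequality concludes. *)
Theorem resolvent_combination (n : nat) (v : X) (r : 'I_n -> X) (g c : 'I_n -> C)
    (M : C) :
  (forall k, graph (r k) (v - g k *: r k)) ->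
  (forall k l, 0 <= l -> g k + l != 0) ->
  (forall l, 0 <= l -> `|\sum_k c k / (g k + l)| <= M) ->
  ip (\sum_k c k *: r k) (\sum_k c k *: r k) <= M ^+ 2 * ip v v.
Proof.
move=> rv g0 cM.
have [|m [e [h [eo eh he es]]]] := @compression [seq r k | k : 'I_n].
  by move=> x /mapP[k _ ->]; exists (v - g k *: r k).
have M0 : 0 <= M by apply: le_trans (cM 0 (lexx 0)).
have rnull k : ip (r k - proj e (r k)) (r k - proj e (r k)) = 0.
  by rewrite ip_residual // -es ?subrr // map_f // mem_enum.
have coef k i : ip (r k) (e i) = ip v (e i) / (g k + ip (h i) (e i)).
  apply/eqP; rewrite -[_ == _](can2_eq (mulfK _) (mulfVK _)) ?g0 ?graph_ge0 //.
  have : ip (v - g k *: r k) (e i) = ip (r k) (h i) by exact: graph_sym (rv k) (eh i).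
  have -> : ip (r k) (h i) = ip (r k) (e i) * ip (e i) (h i).
    rewrite -[in LHS](subrK (proj e (r k)) (r k)) ipDl ip_null // add0r.
    rewrite /proj ip_suml (bigD1 i) //= big1 ?addr0 ?ipZl // => j ji.
    by rewrite ipZl -(graph_sym (eh j) (eh i)) he // mulr0.
  rewrite ipBl !ipZl -(graph_sym (eh i) (eh i)) => /eqP.
  by rewrite subr_eq => /eqP ->; apply/eqP; ring.
set x := \sum_k _.
have xnull : ip (x - proj e x) (x - proj e x) = 0.
  have -> : x - proj e x = \sum_k c k *: (r k - proj e (r k)).
    under eq_bigr do rewrite scalerBr; rewrite sumrB; congr (_ - _).
    rewrite /proj; under [RHS]eq_bigr do rewrite scaler_sumr.
    rewrite exchange_big /=; apply: eq_bigr => i _.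
    rewrite /x ip_suml scaler_suml; apply: eq_bigr => k _.
    by rewrite ipZl scalerA.
  by rewrite ip_suml big1 // => k _; rewrite ipZl ip_null // mulr0.
move: xnull; rewrite ip_residual // => /subr0_eq ->.
apply: le_trans (ler_wpM2l (exprn_ge0 2 M0) (bessel v eo)).
rewrite mulr_sumr; apply: ler_sum => i _.
rewrite -exprMn lerXn2r ?nnegrE ?mulr_ge0 //.
have -> : ip x (e i) = (\sum_k c k / (g k + ip (h i) (e i))) * ip v (e i).
  rewrite /x ip_suml mulr_suml; apply: eq_bigr => k _.
  by rewrite ipZl coef; ring.
by rewrite normrM ler_wpM2r // cM // graph_ge0.
Qed.

End graph.
End semi_inner_product.

(** * The complex exponential *)

Local Open Scope complex_scope.

Notation nrm := ComplexField.Normc.normc.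

Section modulus.
Context {R : realType}.
Implicit Types (z w : R[i]) (x y : R).

Lemma nrmD z w : nrm (z + w) <= nrm z + nrm w.
Proof. exact: le_normcD. Qed.
Lemma nrmN z : nrm (- z) = nrm z.
Proof. exact: normcN. Qed.
Lemma nrmB z w : nrm (z - w) <= nrm z + nrm w.
Proof. by rewrite -(nrmN w); exact: nrmD. Qed.
Lemma nrmM z w : nrm (z * w) = nrm z * nrm w.
Proof. exact: ComplexField.Normc.normcM. Qed.
Lemma nrmV z : nrm z^-1 = (nrm z)^-1.
Proof. exact: ComplexField.Normc.normcV. Qed.
Lemma nrm0 : nrm (0 : R[i]) = 0.
Proof. exact: ComplexField.Normc.normc0. Qed.
Lemma nrm1 : nrm (1 : R[i]) = 1.
Proof. exact: ComplexField.Normc.normc1. Qed.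
Lemma normE z : `|z| = (nrm z)%:C.
Proof. by case: z. Qed.
Lemma nrm_ge0 z : 0 <= nrm z.
Proof. by rewrite -ler0c -normE normr_ge0. Qed.
Lemma nrm_eq0 z : (nrm z == 0) = (z == 0).
Proof. by apply/eqP/eqP => [/ComplexField.Normc.eq0_normc//|->]; exact: nrm0. Qed.
Lemma nrm_gt0 z : (0 < nrm z) = (z != 0).
Proof. by rewrite lt_neqAle nrm_ge0 andbT eq_sym nrm_eq0. Qed.
Lemma nrmBC z w : nrm (z - w) = nrm (w - z).
Proof. by rewrite -nrmN opprB. Qed.

Lemma nrm_real x : nrm x%:C = `|x|.
Proof. by rewrite /= expr0n addr0 sqrtr_sqr. Qed.
Lemma nrm_i : nrm ('i : R[i]) = 1.
Proof. by rewrite /= expr0n add0r expr1n sqrtr1. Qed.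
Lemma Re_le_nrm z : complex.Re z <= nrm z.
Proof.
case: z => a b /=; apply: le_trans (ler_norm a) _.
by rewrite -sqrtr_sqr ler_wsqrtr // lerDl sqr_ge0.
Qed.
Lemma nrm_le z : nrm z <= `|complex.Re z| + `|complex.Im z|.
Proof.
rewrite [z in nrm z]complexE (le_trans (nrmD _ _)) // nrmM nrm_i mul1r.
by rewrite !nrm_real.
Qed.
Lemma Im_le_nrm z : `|complex.Im z| <= nrm z.
Proof.
by case: z => a b /=; rewrite -sqrtr_sqr ler_wsqrtr // lerDr sqr_ge0.
Qed.
Lemma normRe_le_nrm z : `|complex.Re z| <= nrm z.
Proof.
by case: z => a b /=; rewrite -sqrtr_sqr ler_wsqrtr // lerDl sqr_ge0.
Qed.
Lemma nrm_sum I (r : seq I) (P : pred I) (F : I -> R[i]) :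
  nrm (\sum_(i <- r | P i) F i) <= \sum_(i <- r | P i) nrm (F i).
Proof.
elim/big_rec2: _ => [|i y x _ H]; first by rewrite nrm0.
by rewrite (le_trans (nrmD _ _)) // lerD2l.
Qed.
Lemma nrm_polar (rho psi : R) : nrm (polar rho psi) = `|rho|.
Proof. by rewrite /= !exprMn -mulrDr cos2Dsin2 mulr1 sqrtr_sqr. Qed.

Lemma nrm_cexp z : nrm (cexp z) = expR (complex.Re z).
Proof. by rewrite nrm_polar ger0_norm // expR_ge0. Qed.
Lemma cexpD z w : cexp (z + w) = cexp z * cexp w.
Proof.
case: z w => [a b] [c d]; rewrite /cexp /polar /= expRD cosD sinD.
by apply/eqP; rewrite eq_complex /=; apply/andP; split; apply/eqP; ring.
Qed.
Lemma cexp0 : cexp (0 : R[i]) = 1.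
Proof. by rewrite /cexp /polar /= expR0 cos0 sin0 !mul1r. Qed.
Lemma cexpN z : cexp (- z) = (cexp z)^-1.
Proof.
have h : cexp z != 0 by rewrite -nrm_gt0 nrm_cexp expR_gt0.
by apply: (mulIf h); rewrite -cexpD addNr cexp0 mulVf.
Qed.

End modulus.

Section exponential_remainder.
Context {R : realType}.
Implicit Types (x y : R).

Lemma abs_sin_le x : `|sin x| <= `|x|.
Proof.
wlog x0 : x / 0 < x => [H|].
  have [/H//|x0|<-] := ltgtP 0 x; last by rewrite sin0.
  by rewrite -normrN -sinN -[`|x|]normrN; apply: H; rewrite oppr_gt0.
have cs : {within `[0, x], continuous (@sin R)}.
  by apply: continuous_subspaceT => y; exact: continuous_sin.
have [c _] := MVT x0 (fun y _ => is_derive_sin y) cs.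
by rewrite sin0 !subr0 => ->; rewrite normrM ler_piMl ?cos_max.
Qed.

Lemma abs_cos1_le x : `|cos x - 1| <= x ^+ 2.
Proof.
have -> : x = (x / 2) *+ 2 by rewrite -mulr_natr mulfVK.
rewrite cos_mulr2n cos2sin2; set s := sin _.
have -> : (1 - s ^+ 2) *+ 2 - 1 - 1 = - (s ^+ 2 *+ 2) by ring.
rewrite normrN normrMn normrX.
have : `|s| ^+ 2 <= (x / 2) ^+ 2.
  by rewrite -[leRHS]real_normK ?num_real // lerXn2r ?nnegrE // abs_sin_le.
by have := sqr_ge0 x; nra.
Qed.

Lemma abs_cos1_le1 x : `|cos x - 1| <= `|x|.
Proof.
have -> : x = (x / 2) *+ 2 by rewrite -mulr_natr mulfVK.
rewrite cos_mulr2n cos2sin2; set s := sin _.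
have -> : (1 - s ^+ 2) *+ 2 - 1 - 1 = - (s ^+ 2 *+ 2) by ring.
rewrite normrN !normrMn normrX ler_wMn2r // (le_trans _ (abs_sin_le _)) //.
by rewrite expr2 ler_piMl // sin_max.
Qed.

Lemma abs_sinB_le x : `|sin x - x| <= x ^+ 2.
Proof.
wlog x0 : x / 0 < x => [H|].
  have [/H//|x0|<-] := ltgtP 0 x; last by rewrite sin0 subr0 normr0 sqr_ge0.
  by have := H (- x); rewrite oppr_gt0 sinN -opprB normrN sqrrN !opprK addrC; apply.
have cs : {within `[0, x], continuous (fun y : R => sin y - y)}.
  apply: continuous_subspaceT => y; apply: cvgB; first exact: continuous_sin.
  exact: cvg_id.
have ds (y : R) : y \in `]0, x[ -> is_derive y 1 (fun y : R => sin y - y) (cos y - 1).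
  by move=> _; apply: is_deriveB.
have [c] := MVT x0 ds cs.
rewrite in_itv /= => /andP[c0 cx].
rewrite sin0 !subr0 => ->; rewrite normrM expr2 (gtr0_norm x0) ler_wpM2r ?(ltW x0) //.
by rewrite (le_trans (abs_cos1_le1 _)) // gtr0_norm // ltW.
Qed.

Lemma abs_expR1_le x : `|expR x - 1| <= `|x| * expR `|x|.
Proof.
have h1 := expR_ge1Dx x; have h2 := expR_ge1Dx (- x).
have h3 : (1 - x) * expR x <= 1.
  by rewrite -[leRHS](expRxMexpNx_1 x) mulrC ler_wpM2l ?expR_ge0 ?expR_ge1Dx.
have h4 := expR_gt0 x.
have [x0|x0] := leP 0 x.
  by rewrite (ger0_norm x0) ger0_norm ?subr_ge0; lra.
rewrite (ltr0_norm x0) ler0_norm; last by rewrite subr_le0 expR_le1 ltW.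
nra.
Qed.

Lemma abs_expR2_le x : `|expR x - 1 - x| <= x ^+ 2 * expR `|x|.
Proof.
have h1 := expR_ge1Dx x.
have h3 : (1 - x) * expR x <= 1.
  by rewrite -[leRHS](expRxMexpNx_1 x) mulrC ler_wpM2l ?expR_ge0 ?expR_ge1Dx.
have h4 := expR_gt0 x.
have h5 := abs_expR1_le x.
rewrite ger0_norm; last lra.
apply: le_trans (_ : x * (expR x - 1) <= _); first lra.
apply: le_trans (ler_norm _) _; rewrite normrM -(real_normK (num_real x)).
by rewrite expr2 -mulrA ler_wpM2l.
Qed.

(** With [z = x + i y], both components of the remainder split into the
    elementary real remainders of [exp], [cos] and [sin]. *)
Lemma cexp_remainder (z : R[i]) B : nrm z <= B ->
  nrm (cexp z - 1 - z) <= 4 * expR B * nrm z ^+ 2.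
Proof.
case: z => x y zB.
have xB : `|x| <= nrm (x +i* y) := normRe_le_nrm (x +i* y).
have yB : `|y| <= nrm (x +i* y) := Im_le_nrm (x +i* y).
move: xB yB zB; set r := nrm (_ +i* _) => xB yB rB.
have E1 : 1 <= expR B.
  by rewrite -expR0 ler_expR (le_trans _ rB) // (le_trans _ xB).
have ex : expR x <= expR B by rewrite ler_expR; have := ler_norm x; lra.
have exB : expR `|x| <= expR B by rewrite ler_expR; lra.
have x2 : x ^+ 2 <= r ^+ 2.
  by rewrite -real_normK ?num_real // lerXn2r ?nnegrE // (le_trans _ xB).
have y2 : y ^+ 2 <= r ^+ 2.
  by rewrite -real_normK ?num_real // lerXn2r ?nnegrE // (le_trans _ xB).
have r0 : 0 <= r by exact: nrm_ge0.
apply: le_trans (nrm_le _) _ => /=; rewrite oppr0 addr0.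
have -> : expR x * cos y - 1 - x = (expR x - 1 - x) + expR x * (cos y - 1) by ring.
have -> : expR x * sin y - y = expR x * (sin y - y) + (expR x - 1) * y by ring.
have t1 : `|expR x - 1 - x| <= expR B * r ^+ 2.
  apply: le_trans (abs_expR2_le x) _; rewrite mulrC ler_pM ?expR_ge0 ?sqr_ge0 //.
have t2 : `|expR x * (cos y - 1)| <= expR B * r ^+ 2.
  rewrite normrM ger0_norm ?expR_ge0 // ler_pM ?expR_ge0 //.
  exact: le_trans (abs_cos1_le y) _.
have t3 : `|expR x * (sin y - y)| <= expR B * r ^+ 2.
  rewrite normrM ger0_norm ?expR_ge0 // ler_pM ?expR_ge0 //.
  exact: le_trans (abs_sinB_le y) _.
have t4 : `|(expR x - 1) * y| <= expR B * r ^+ 2.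
  rewrite normrM (le_trans (ler_wpM2r _ (abs_expR1_le x))) //.
  rewrite mulrAC mulrC ler_pM ?expR_ge0 ?mulr_ge0 // expr2 ler_pM //.
have := ler_normD (expR x - 1 - x) (expR x * (cos y - 1)).
have := ler_normD (expR x * (sin y - y)) ((expR x - 1) * y).
lra.
Qed.

Lemma ln1D_quadratic (h : R) : 0 <= h <= 1 -> `|ln (1 + h) - h| <= h ^+ 2.
Proof.
move=> /andP[h0 h1].
have l1 : ln (1 + h) <= h by apply: le_ln1Dx; lra.
rewrite ler0_norm ?subr_le0 // opprB lerBlDl -lerBlDr.
rewrite -[leLHS]expRK ler_ln ?posrE ?expR_gt0 //; last lra.
have := expR_ge1Dx (- (h - h ^+ 2)); rewrite expRN => le.
have e0 := expR_gt0 (h - h ^+ 2).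
have d0 : 0 < 1 - h + h ^+ 2 by nra.
have le1 : (1 - h + h ^+ 2) * expR (h - h ^+ 2) <= 1.
  by rewrite -ler_pdivlMr // div1r; lra.
rewrite -(ler_pM2l d0); apply: le_trans le1 _.
have -> : (1 - h + h ^+ 2) * (1 + h) = 1 + h ^+ 3 by ring.
by rewrite lerDl exprn_ge0.
Qed.

End exponential_remainder.

(** * The scalar kernel, uniformly in the spectral parameter *)

Arguments ComplexField.Normc.normc : simpl never.

Section uniform_differentiability.
Context {R : realType}.
Variables (K : set R[i]) (D : R).
Hypothesis KD : forall z w, K z -> K w -> nrm (w - z) <= D.
Hypothesis D0 : 0 <= D.

(** [f'] plays the role of a derivative through this inequality alone, which is
    all that Riemann sums can see. *)
Definition taylor_bound (B : R) (f f' : R[i] -> R[i]) :=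
  forall z w, K z -> K w -> [/\ nrm (f z) <= B, nrm (f' z) <= B &
    nrm (f w - f z - f' z * (w - z)) <= B * nrm (w - z) ^+ 2].

(** The constant is common to all [l >= 0], while the derivative may depend on
    [l]. *)
Definition uniform_C2 (f : R -> R[i] -> R[i]) := exists B : R, [/\ 0 <= B &
  forall l : R, 0 <= l -> exists f', taylor_bound B (f l) f'].

Lemma taylor_lipschitz (B : R) f f' z w : 0 <= B -> taylor_bound B f f' -> K z -> K w ->
  nrm (f w - f z) <= B * (1 + D) * nrm (w - z).
Proof.
move=> B0 tb Kz Kw; have [_ f'z rz] := tb z w Kz Kw.
rewrite -(subrK (f' z * (w - z)) (f w - f z)) (le_trans (nrmD _ _)) //.
rewrite nrmM; have d := KD Kz Kw; have d0 := nrm_ge0 (w - z).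
have : nrm (f' z) * nrm (w - z) <= B * nrm (w - z) by rewrite ler_wpM2r.
have : B * nrm (w - z) ^+ 2 <= B * (D * nrm (w - z)).
  by rewrite ler_wpM2l // expr2 ler_wpM2r.
lra.
Qed.

Lemma taylor_boundW (B B' : R) f f' : B <= B' -> taylor_bound B f f' -> taylor_bound B' f f'.
Proof.
move=> BB tb z w Kz Kw; have [h1 h2 h3] := tb z w Kz Kw.
split; [lra|lra|]; apply: le_trans h3 _; rewrite ler_wpM2r //.
exact: sqr_ge0.
Qed.

Lemma uniform_C2_cst a : uniform_C2 (fun _ _ => a).
Proof.
exists (nrm a); split; first exact: nrm_ge0.
move=> l l0; exists (fun=> 0) => z w Kz Kw; rewrite subrr mul0r subr0 nrm0.
by rewrite lexx nrm_ge0 mulr_ge0 ?nrm_ge0 ?sqr_ge0.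
Qed.

Lemma uniform_C2_id M : (forall z, K z -> nrm z <= M) -> uniform_C2 (fun _ z => z).
Proof.
move=> KM; exists (`|M| + 1); split; first by rewrite addr_ge0.
move=> l l0; exists (fun=> 1) => z w Kz Kw; rewrite mul1r subrr nrm0 nrm1.
have := KM z Kz; have := ler_norm M; have := normr_ge0 M; split; [lra|lra|].
by rewrite mulr_ge0 ?sqr_ge0 // addr_ge0.
Qed.

Lemma uniform_C2D f g : uniform_C2 f -> uniform_C2 g ->
  uniform_C2 (fun l z => f l z + g l z).
Proof.
move=> [Bf [Bf0 Hf]] [Bg [Bg0 Hg]]; exists (Bf + Bg); split; first exact: addr_ge0.
move=> l l0; have [f' tf] := Hf l l0; have [g' tg] := Hg l l0.
exists (fun z => f' z + g' z) => z w Kz Kw.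
have [f1 f2 f3] := tf z w Kz Kw; have [g1 g2 g3] := tg z w Kz Kw.
split; [exact: le_trans (nrmD _ _) (lerD _ _)..|].
have -> : f l w + g l w - (f l z + g l z) - (f' z + g' z) * (w - z) =
  (f l w - f l z - f' z * (w - z)) + (g l w - g l z - g' z * (w - z)) by ring.
by rewrite mulrDl; exact: le_trans (nrmD _ _) (lerD _ _).
Qed.

Lemma uniform_C2M f g : uniform_C2 f -> uniform_C2 g ->
  uniform_C2 (fun l z => f l z * g l z).
Proof.
move=> [Bf [Bf0 Hf]] [Bg [Bg0 Hg]].
pose B := 2 * Bf * Bg + Bf * Bg + Bf * Bg * (1 + D).
have BB : 0 <= Bf * Bg by exact: mulr_ge0.
have BD : 0 <= Bf * Bg * D by exact: mulr_ge0.
exists B; split; first by rewrite /B; lra.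
move=> l l0; have [f' tf] := Hf l l0; have [g' tg] := Hg l l0.
exists (fun z => f' z * g l z + f l z * g' z) => z w Kz Kw.
have [f1 f2 f3] := tf z w Kz Kw; have [g1 g2 g3] := tg z w Kz Kw.
have [gw _ _] := tg w z Kw Kz; have gL := taylor_lipschitz Bg0 tg Kz Kw.
split.
- by rewrite nrmM (le_trans (ler_pM (nrm_ge0 _) (nrm_ge0 _) f1 g1)) // /B; lra.
- have q1 := ler_pM (nrm_ge0 _) (nrm_ge0 _) f2 g1.
  have q2 := ler_pM (nrm_ge0 _) (nrm_ge0 _) f1 g2.
  by apply: le_trans (nrmD _ _) _; rewrite !nrmM /B; lra.
- have -> : f l w * g l w - f l z * g l z - (f' z * g l z + f l z * g' z) * (w - z) =
    (f l w - f l z - f' z * (w - z)) * g l w +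
    f l z * (g l w - g l z - g' z * (w - z)) +
    f' z * (w - z) * (g l w - g l z) by ring.
  have := nrmD ((f l w - f l z - f' z * (w - z)) * g l w +
    f l z * (g l w - g l z - g' z * (w - z))) (f' z * (w - z) * (g l w - g l z)).
  have := nrmD ((f l w - f l z - f' z * (w - z)) * g l w)
    (f l z * (g l w - g l z - g' z * (w - z))).
  rewrite !nrmM => q1 q2; have d0 := nrm_ge0 (w - z).
  have q3 := ler_pM (nrm_ge0 _) (nrm_ge0 _) f3 gw.
  have q4 := ler_pM (nrm_ge0 _) (nrm_ge0 _) f1 g3.
  have f2' : nrm (f' z) * nrm (w - z) <= Bf * nrm (w - z) by rewrite ler_wpM2r.
  have q5 := ler_pM (mulr_ge0 (nrm_ge0 _) (nrm_ge0 _)) (nrm_ge0 _) f2' gL.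
  have q0 : 0 <= Bf * Bg * nrm (w - z) ^+ 2 by rewrite mulr_ge0 // sqr_ge0.
  rewrite /B; lra.
Qed.

Lemma uniform_C2_cexp f : uniform_C2 f -> uniform_C2 (fun l z => cexp (f l z)).
Proof.
move=> [B [B0 Hf]]; pose E := expR B; pose E2 := 4 * expR (B * (1 + D) * D).
have E0 : 0 <= E by exact: expR_ge0.
have E20 : 0 <= E2 by rewrite mulr_ge0 // expR_ge0.
pose L := B * (1 + D); have L0 : 0 <= L by rewrite mulr_ge0 // addr_ge0.
have EB : 0 <= E * B by exact: mulr_ge0.
have EEL : 0 <= E * (E2 * L ^+ 2) by apply: mulr_ge0 => //; apply: mulr_ge0 => //; exact: sqr_ge0.
exists (E + E * B + E * (E2 * L ^+ 2)); split; first by lra.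
move=> l l0; have [f' tf] := Hf l l0.
exists (fun z => f' z * cexp (f l z)) => z w Kz Kw.
have [f1 f2 f3] := tf z w Kz Kw; have fL := taylor_lipschitz B0 tf Kz Kw.
have ez : nrm (cexp (f l z)) <= E.
  by rewrite nrm_cexp ler_expR (le_trans (Re_le_nrm _)).
have d0 := nrm_ge0 (w - z).
split.
- by apply: le_trans ez _; lra.
- by rewrite nrmM mulrC (le_trans (ler_pM (nrm_ge0 _) (nrm_ge0 _) ez f2)) //; lra.
- set d := f l w - f l z in fL f3 *.
  have -> : cexp (f l w) - cexp (f l z) - f' z * cexp (f l z) * (w - z) =
     cexp (f l z) * ((cexp d - 1 - d) + (d - f' z * (w - z))).
    have -> : cexp (f l w) = cexp (f l z) * cexp d.
      by rewrite -cexpD /d addrC subrK.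
    ring.
  have dL : nrm d <= L * D.
    by apply: le_trans fL _; apply: ler_wpM2l => //; exact: KD.
  have := cexp_remainder dL; rewrite -/E2 => rd.
  have d2 : nrm d ^+ 2 <= L ^+ 2 * nrm (w - z) ^+ 2.
    by rewrite -exprMn lerXn2r // nnegrE ?nrm_ge0 //; apply: mulr_ge0.
  have r2 : nrm (cexp d - 1 - d) <= E2 * L ^+ 2 * nrm (w - z) ^+ 2.
    by apply: le_trans rd _; rewrite -mulrA; apply: ler_wpM2l.
  have := ler_pM (nrm_ge0 _) (nrm_ge0 _) ez (le_trans (nrmD _ _) (lerD r2 f3)).
  rewrite -nrmM => h; apply: le_trans h _.
  have : 0 <= E * nrm (w - z) ^+ 2 by rewrite mulr_ge0 // sqr_ge0.
  lra.
Qed.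

(** Differentiating the inverse brings out a factor [l], which is unbounded; it is
    absorbed by one of the denominators, since the lower bound assumed on them
    grows linearly in [l]. *)
Lemma uniform_C2_resolvent (y : R[i] -> R[i]) k m :
  0 < k -> 0 < m -> uniform_C2 (fun=> y) ->
  (forall l z, 0 <= l -> K z -> k * (1 + l * m) <= nrm (1 + l%:C * y z)) ->
  uniform_C2 (fun l z => (1 + l%:C * y z)^-1).
Proof.
move=> k0 m0 [B [B0 Hy]] lb.
pose a := k^-1; pose b := (k * m)^-1.
have a0 : 0 <= a by rewrite invr_ge0 ltW.
have b0 : 0 <= b by rewrite invr_ge0 ltW // mulr_gt0.
have pos l : 0 <= l -> 0 < k * (1 + l * m).
  by move=> l0; rewrite mulr_gt0 // ltr_wpDr // mulr_ge0 // ltW.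
have pb l z : 0 <= l -> K z -> nrm (1 + l%:C * y z)^-1 <= a.
  move=> l0 Kz; rewrite nrmV lef_pV2 ?posrE //.
    by rewrite (le_trans _ (lb l z l0 Kz)) // ler_peMr ?(ltW k0) // lerDl mulr_ge0 // ltW.
  by rewrite (lt_le_trans (pos l l0)) // lb.
have lpb l z : 0 <= l -> K z -> nrm (l%:C * (1 + l%:C * y z)^-1) <= b.
  move=> l0 Kz; rewrite nrmM nrmV nrm_real ger0_norm //.
  have h := lb l z l0 Kz; have p := lt_le_trans (pos l l0) h.
  rewrite ler_pdivrMr // /b mulrC ler_pdivlMr ?mulr_gt0 //.
  by apply: le_trans h; lra.
have pn l z : 0 <= l -> K z -> 1 + l%:C * y z != 0.
  by move=> l0 Kz; rewrite -nrm_gt0 (lt_le_trans (pos l l0)) // lb.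
have [y' ty] := Hy 0 (lexx 0).
have h1 : 0 <= b * B * a by rewrite !mulr_ge0.
have h2 : 0 <= b * B * (a * b * (B * (1 + D))) by rewrite !mulr_ge0 // addr_ge0.
exists (a + b * B * a + b * B * (a * b * (B * (1 + D)))); split; first by lra.
move=> l l0; pose p z := 1 + l%:C * y z.
exists (fun z => - (l%:C * (p z)^-1) * y' z * (p z)^-1) => z w Kz Kw.
have [y1 y2 y3] := ty z w Kz Kw; have yL := taylor_lipschitz B0 ty Kz Kw.
have pz := pb l z l0 Kz; have pw := pb l w l0 Kw; have lz := lpb l z l0 Kz.
have d0 := nrm_ge0 (w - z).
split.
- by apply: le_trans pz _; lra.
- rewrite !nrmM nrmN.
  have := ler_pM (mulr_ge0 (nrm_ge0 _) (nrm_ge0 _)) (nrm_ge0 _)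
    (ler_pM (nrm_ge0 _) (nrm_ge0 _) lz y2) pz.
  by rewrite -!/(p _); lra.
- rewrite -!/(p _) in pz pw lz *.
  have -> : (p w)^-1 - (p z)^-1 - - (l%:C * (p z)^-1) * y' z * (p z)^-1 * (w - z) =
     l%:C * (p z)^-1 * y' z * (w - z) * (l%:C * (p z)^-1 * (p w)^-1 * (y w - y z)) -
     l%:C * (p z)^-1 * (p w)^-1 * (y w - y z - y' z * (w - z)).
    have := pn l z l0 Kz; have := pn l w l0 Kw; rewrite /p => nw nz.
    by field; rewrite nw nz.
  rewrite (le_trans (nrmB _ _)) // !nrmM -[nrm l%:C * nrm (p z)^-1]nrmM.
  have t1 : nrm (l%:C * (p z)^-1) * nrm (p w)^-1 * nrm (y w - y z - y' z * (w - z)) <=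
     b * a * (B * nrm (w - z) ^+ 2).
    by rewrite !ler_pM ?mulr_ge0 ?nrm_ge0.
  have t2 : nrm (l%:C * (p z)^-1) * nrm (y' z) * nrm (w - z) *
     (nrm (l%:C * (p z)^-1) * nrm (p w)^-1 * nrm (y w - y z)) <=
     b * B * nrm (w - z) * (b * a * (B * (1 + D) * nrm (w - z))).
    by rewrite !ler_pM ?mulr_ge0 ?nrm_ge0.
  apply: le_trans (lerD t2 t1) _.
  have : 0 <= a * nrm (w - z) ^+ 2 by rewrite mulr_ge0 // sqr_ge0.
  lra.
Qed.

End uniform_differentiability.

Section kernel.
Context {R : realType}.
Variables (gamma alpha : R).
Hypotheses (hgamma : 0 < gamma) (halpha : 0 < alpha < 1).
Implicit Types (t l : R) (z : R[i]).

(** The function [1 / g] at the point [exp z]. *)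
Definition symbol z : R[i] := cexp (- z) + gamma%:C * cexp ((alpha - 1)%:C * z).

(** The function [exp (t * w) * g(w) / (g(w) + l)] at the point [w = exp z]: what
    the integrand of the solution operator becomes on an eigenvector of eigenvalue
    [l], with [dw / w = dz]. *)
Definition contour_kernel t l z : R[i] := cexp (t%:C * cexp z) * (1 + l%:C * symbol z)^-1.

(** Multiplication by [exp (i * psi / 2)], [psi] being the imaginary part of [z],
    turns the three terms of the denominator into numbers of arguments [psi / 2],
    [- psi / 2] and [(alpha - 1 / 2) * psi].  All of these lie in the right half
    plane, so the real parts add up without cancellation. *)
Lemma kernel_denominator l z : 0 <= l -> `|complex.Im z| <= pi ->
  cos (complex.Im z / 2) * (1 + l * expR (- complex.Re z)) <= nrm (1 + l%:C * symbol z).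
Proof.
case: z => s p /= l0 ppi; have /andP[a0 a1] := halpha.
have h1 : nrm (cexp (0 +i* (p / 2))) = 1 by rewrite nrm_cexp /= expR0.
have -> : nrm (1 + l%:C * symbol (s +i* p)) =
    nrm (cexp (0 +i* (p / 2)) * (1 + l%:C * symbol (s +i* p))) by rewrite nrmM h1 mul1r.
apply: le_trans _ (Re_le_nrm _).
have -> : cexp (0 +i* (p / 2)) * (1 + l%:C * symbol (s +i* p)) =
    cexp (0 +i* (p / 2)) + l%:C * (cexp (0 +i* (p / 2) - (s +i* p)) +
      gamma%:C * cexp (0 +i* (p / 2) + (alpha - 1)%:C * (s +i* p))).
  by rewrite /symbol !cexpD; ring.
rewrite /cexp /polar /=.
rewrite !(add0r, mul0r, subr0, addr0) expR0 mul1r.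
have -> : p / 2 - p = - (p / 2) by field.
rewrite cosN; set c2 := cos (p / 2 + _); set e2 := expR ((alpha - 1) * s).
have : 0 <= l * (gamma * (e2 * c2)).
  rewrite !mulr_ge0 ?(ltW hgamma) ?expR_ge0 // cos_ge0_pihalf //.
  move: ppi; rewrite ler_norml => /andP[p1 p2]; apply/andP; split; nra.
lra.
Qed.

Lemma cos_half_le (th p : R) : `|p| <= th -> th <= pi -> cos (th / 2) <= cos (p / 2).
Proof.
move=> pth thpi; rewrite -(cos_norm (p / 2)) normrM (@ger0_norm _ 2^-1) //.
have p0 := normr_ge0 p.
have pi0 := @pi_gt0 R.
have i1 : `|p| / 2 \in `[0, pi] by rewrite in_itv /=; apply/andP; split; lra.
have i2 : th / 2 \in `[0, pi] by rewrite in_itv /=; apply/andP; split; lra.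
by rewrite leNgt; apply/negP; rewrite (ltr_cos i2 i1); lra.
Qed.

Lemma cos_half_gt0 (th : R) : 0 <= th -> th < pi -> 0 < cos (th / 2).
Proof. by move=> h1 h2; apply: cos_gt0_pihalf; apply/andP; split; lra. Qed.

Lemma kernel_bound t l z (th : R) : 0 <= l -> `|complex.Im z| <= th -> th < pi ->
  nrm (contour_kernel t l z) <= expR (t * (expR (complex.Re z) * cos (complex.Im z))) / cos (th / 2).
Proof.
move=> l0 zth thpi; rewrite nrmM nrm_cexp nrmV.
have th0 : 0 <= th by exact: le_trans zth.
have -> : complex.Re (t%:C * cexp z) = t * (expR (complex.Re z) * cos (complex.Im z)).
  by rewrite /cexp /polar /= mul0r subr0.
rewrite ler_wpM2l ?expR_ge0 //.
have h := kernel_denominator l0 (le_trans zth (ltW thpi)).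
have c0 := cos_half_gt0 th0 thpi.
have c := cos_half_le zth (ltW thpi).
have e0 := mulr_ge0 l0 (expR_ge0 (- complex.Re z)).
have h' : cos (th / 2) <= nrm (1 + l%:C * symbol z).
  apply: le_trans h; apply: (le_trans c).
  by rewrite ler_peMr ?lerDl // (le_trans (ltW c0)).
by rewrite lef_pV2 // posrE (lt_le_trans c0).
Qed.

Definition rectangle (a b th : R) : set R[i] :=
  [set z | a <= complex.Re z <= b /\ `|complex.Im z| <= th].

Lemma rectangle_nrm (a b th : R) z : rectangle a b th z -> nrm z <= `|a| + `|b| + th.
Proof.
move=> [/andP[h1 h2] h3]; apply: le_trans (nrm_le _) _; apply: lerD => //.
have := ler_norm b; have := ler_norm (- a); rewrite normrN => na nb.
have := normr_ge0 a; have := normr_ge0 b.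
by rewrite ler_norml => ? ?; apply/andP; split; lra.
Qed.

(** The kernel is a product of compositions to which the closure properties of
    [uniform_C2] apply. *)
Lemma kernel_C2 (t a b th : R) : th < pi ->
  exists B : R, 0 <= B /\ forall l : R, 0 <= l -> exists2 f',
    taylor_bound (rectangle a b th) B (contour_kernel t l) f' &
    forall z w, rectangle a b th z -> rectangle a b th w ->
      nrm (contour_kernel t l w - contour_kernel t l z) <= B * nrm (w - z).
Proof.
move=> thpi; set K := rectangle a b th.
have [th0|thn] := leP 0 th; last first.
  exists 0; split => // l l0; exists (fun=> 0) => z w [_ zth];
  by have := le_trans (normr_ge0 _) zth; rewrite leNgt thn.
pose M := `|a| + `|b| + th.
have KM z : K z -> nrm z <= M by exact: rectangle_nrm.
have M0 : 0 <= M by rewrite !addr_ge0.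
have D0 : 0 <= M + M by exact: addr_ge0.
have KD z w : K z -> K w -> nrm (w - z) <= M + M.
  by move=> Kz Kw; apply: le_trans (nrmB _ _) (lerD _ _); exact: KM.
have Cid := uniform_C2_id KM.
have Cscale (c : R[i]) : uniform_C2 K (fun _ z => c * z).
  exact: uniform_C2M KD D0 _ _ (uniform_C2_cst K c) Cid.
have Cy : uniform_C2 K (fun=> symbol).
  apply: uniform_C2D.
    apply: (uniform_C2_cexp KD D0 (f := fun _ z => - z)).
    have := Cscale (-1); rewrite (_ : (fun _ z => -1 * z) = (fun (_ : R) z => - z)) //.
    by apply/funext => ?; apply/funext => z; rewrite mulN1r.
  apply: (uniform_C2M KD D0); first exact: uniform_C2_cst.
  exact: (uniform_C2_cexp KD D0).
have C1 : uniform_C2 K (fun l z => (1 + l%:C * symbol z)^-1).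
  apply: (uniform_C2_resolvent KD D0 (k := cos (th / 2)) (m := expR (- b))) => //.
  - exact: cos_half_gt0.
  - exact: expR_gt0.
  move=> l z l0 [/andP[az zb] zth].
  apply: le_trans (kernel_denominator l0 (le_trans zth (ltW thpi))).
  have c0 := cos_half_gt0 th0 thpi.
  have c := cos_half_le zth (ltW thpi).
  have e : expR (- b) <= expR (- complex.Re z) by rewrite ler_expR; lra.
  have e0 := expR_ge0 (- b).
  rewrite ler_pM ?(ltW c0) // ?addr_ge0 ?mulr_ge0 // lerD2l ler_wpM2l //.
have C2 : uniform_C2 K (fun _ z => cexp (t%:C * cexp z)).
  apply: (uniform_C2_cexp KD D0 (f := fun _ z => t%:C * cexp z)).
  apply: (uniform_C2M KD D0); first exact: uniform_C2_cst.
  exact: (uniform_C2_cexp KD D0).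
have [B [B0 HB]] := uniform_C2M KD D0 C2 C1.
exists (B * (1 + (M + M))); split; first by rewrite mulr_ge0 // addr_ge0.
move=> l l0; have [f' tf] := HB l l0; exists f'.
  apply: taylor_boundW tf; rewrite ler_peMr // lerDl //.
by move=> z w Kz Kw; have := taylor_lipschitz KD B0 tf Kz Kw.
Qed.

End kernel.

(** * Cauchy's theorem for Riemann sums *)

Section discrete_contour.
Context {R : realType}.
Implicit Types (F : R[i] -> R[i]) (s th h : R) (n N J : nat).

Definition arc_sum F s th h N : R[i] := \sum_(j < N) F (s +i* (- th + j%:R * h)).

Definition ray_sum F s psi h n : R[i] := \sum_(k < n) F ((s + k%:R * ln (1 + h)) +i* psi).

(** A Riemann sum of the contour integral in the coordinate [ln z]: the rays are
    horizontal, with step [ln (1 + h)], and the arc is vertical with step [h].  The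
    rays have weight [h] too, which is [(rho' - rho) / rho] for consecutive radii
    [rho] and [rho' = rho * (1 + h)]; it differs from the step by [O(h ^ 2)]. *)
Definition contour_sum F s th h n N : R[i] :=
  h%:C * (ray_sum F s th h n - ray_sum F s (- th) h n + 'i * arc_sum F s th h N).

(** The difference of the two sides telescopes into a double sum over the cells of
    the grid.  On a cell the first-order terms of the three values combine to
    [i * F' * (h - ln (1 + h))], which is [O(h ^ 2)] like the Taylor remainders;
    the common weight [h] supplies the third power. *)
Lemma discrete_cauchy (K : set R[i]) (B : R) F F' s th h n N :
  taylor_bound K B F F' -> 0 <= B -> 0 <= h <= 1 -> N%:R * h = 2 * th ->
  (forall k j : nat, (k <= n)%N -> (j <= N)%N ->
    K ((s + k%:R * ln (1 + h)) +i* (- th + j%:R * h))) ->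
  nrm (contour_sum F s th h n N -
       h%:C * ('i * arc_sum F (s + n%:R * ln (1 + h)) th h N)) <=
  n%:R * N%:R * (3 * B * h ^+ 3).
Proof.
move=> tb B0 h01 hN HK; have /andP[h0 h1] := h01; set eta := ln (1 + h).
have eta0 : 0 <= eta by apply: ln_ge0; lra.
have etah : eta <= h by apply: le_ln1Dx; lra.
pose Z k j := (s + k%:R * eta) +i* (- th + j%:R * h).
pose G k j := F (Z k j).
pose cell k j := (G k j.+1 - G k j) - 'i * (G k.+1 j - G k j).
have -> : contour_sum F s th h n N - h%:C * ('i * arc_sum F (s + n%:R * eta) th h N) =
    h%:C * \sum_(k < n) \sum_(j < N) cell k j.
  rewrite -mulrBr; congr (_ * _).
  have eth : - th + N%:R * h = th by rewrite hN; ring.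
  under [RHS]eq_bigr do rewrite sumrB.
  rewrite sumrB.
  have -> : \sum_(k < n) \sum_(j < N) (G k j.+1 - G k j) =
      ray_sum F s th h n - ray_sum F s (- th) h n.
    rewrite /ray_sum -sumrB; apply: eq_bigr => k _.
    rewrite -(big_mkord xpredT (fun j => G k j.+1 - G k j)) telescope_sumr //.
    by rewrite /G /Z eth mul0r addr0.
  have -> : \sum_(k < n) \sum_(j < N) 'i * (G k.+1 j - G k j) =
      'i * arc_sum F (s + n%:R * eta) th h N - 'i * arc_sum F s th h N.
    rewrite exchange_big /= -mulrBr /arc_sum -sumrB mulr_sumr; apply: eq_bigr => j _.
    rewrite -mulr_sumr -(big_mkord xpredT (fun k => G k.+1 j - G k j)) telescope_sumr //.
    by rewrite /G /Z mul0r addr0.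
  ring.
have cellP k j : (k < n)%N -> (j < N)%N -> nrm (cell k j) <= 3 * B * h ^+ 2.
  move=> kn jN.
  have K0 : K (Z k j) by apply: HK; exact: ltnW.
  have K1 : K (Z k j.+1) by apply: HK => //; exact: ltnW.
  have K2 : K (Z k.+1 j) by apply: HK => //; exact: ltnW.
  have [_ fz r1] := tb _ _ K0 K1; have [_ _ r2] := tb _ _ K0 K2.
  have d1 : Z k j.+1 - Z k j = 'i * h%:C.
    apply/eqP; rewrite eq_complex /=; apply/andP; split; apply/eqP; first ring.
    by rewrite -natr1; ring.
  have d2 : Z k.+1 j - Z k j = eta%:C.
    apply/eqP; rewrite eq_complex /=; apply/andP; split; apply/eqP; last ring.
    by rewrite -natr1; ring.
  rewrite d1 -!/(G _ _) nrmM nrm_i mul1r nrm_real ger0_norm // in r1.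
  rewrite d2 -!/(G _ _) nrm_real ger0_norm // in r2.
  have -> : cell k j = (G k j.+1 - G k j - F' (Z k j) * ('i * h%:C)) -
     'i * (G k.+1 j - G k j - F' (Z k j) * eta%:C) + 'i * F' (Z k j) * (h%:C - eta%:C).
    by rewrite /cell; ring.
  apply: le_trans (nrmD _ _) _.
  apply: le_trans (lerD (nrmB _ _) (lexx _)) _.
  rewrite !nrmM nrm_i !mul1r.
  have hq : nrm (h%:C - eta%:C) <= h ^+ 2.
    rewrite -rmorphB /= nrm_real distrC; exact: ln1D_quadratic.
  have q1 := ler_pM (nrm_ge0 _) (nrm_ge0 _) fz hq.
  have eta2 : eta ^+ 2 <= h ^+ 2 by rewrite lerXn2r.
  have q2 := ler_wpM2l B0 eta2.
  lra.
rewrite nrmM nrm_real ger0_norm //.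
have -> : n%:R * N%:R * (3 * B * h ^+ 3) = h * (n%:R * (N%:R * (3 * B * h ^+ 2))) by ring.
apply: ler_wpM2l => //; apply: le_trans (nrm_sum _ _ _) _.
rewrite -[n in leRHS]card_ord -sum1_card natr_sum mulr_suml; apply: ler_sum => k _.
rewrite mul1r; apply: le_trans (nrm_sum _ _ _) _.
rewrite -[N in leRHS]card_ord -sum1_card natr_sum mulr_suml; apply: ler_sum => j _.
by rewrite mul1r cellP.
Qed.

Lemma ler_nrm_sum_const n (a : 'I_n -> R[i]) (c : R) : (forall k, nrm (a k) <= c) ->
  nrm (\sum_(k < n) a k) <= n%:R * c.
Proof.
move=> ac; apply: le_trans (nrm_sum _ _ _) _.
rewrite -[n in leRHS]card_ord -sum1_card natr_sum mulr_suml; apply: ler_sum => k _.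
by rewrite mul1r.
Qed.

Lemma arc_sum_widen F s th h N J (c : R) : 0 <= h -> N%:R * h = 2 * th ->
  (forall psi, th <= `|psi| <= th + J%:R * h -> nrm (F (s +i* psi)) <= c) ->
  nrm (arc_sum F s (th + J%:R * h) h (J + N + J) - arc_sum F s th h N) <= 2 * J%:R * c.
Proof.
move=> h0 hN Fc.
have th0 : 0 <= th by have := mulr_ge0 (ler0n R N) h0; lra.
have -> : arc_sum F s (th + J%:R * h) h (J + N + J) - arc_sum F s th h N =
   \sum_(j < J) F (s +i* (- (th + J%:R * h) + j%:R * h)) +
   \sum_(j < J) F (s +i* (th + j%:R * h)).
  rewrite /arc_sum !big_split_ord /= -!addrA; congr (_ + _).
  rewrite addrCA -[RHS]addr0; congr (_ + _).
    apply: eq_bigr => j _; congr (F (_ +i* _)); rewrite !natrD !mulrDl hN; ring.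
  apply/eqP; rewrite subr_eq0; apply/eqP.
  apply: eq_bigr => j _; congr (F (_ +i* _)); rewrite natrD; ring.
have -> : 2 * J%:R * c = J%:R * c + J%:R * c by ring.
apply: le_trans (nrmD _ _) _; apply: lerD; apply: ler_nrm_sum_const => j; apply: Fc.
  have := ltn_ord j; rewrite -(ltr_nat R) => /ltW jJ.
  have := ler_wpM2r h0 jJ; have := mulr_ge0 (ler0n R j) h0.
  by move=> ? ?; rewrite ler0_norm; [apply/andP; split; lra|lra].
have := ltn_ord j; rewrite -(ltr_nat R) => /ltW jJ.
have := ler_wpM2r h0 jJ; have := mulr_ge0 (ler0n R j) h0.
by move=> ? ?; rewrite ger0_norm; [apply/andP; split; lra|lra].
Qed.

(** A Riemann sum of [exp (- c * rho)] over [rho >= 1], bounded uniformly in the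
    mesh. *)
Lemma geometric_decay (c h : R) n : 0 < c -> 0 < h <= 1 ->
  h * \sum_(k < n) expR (- (c * (1 + k%:R * h))) <= 1 + c^-1.
Proof.
move=> c0 /andP[h0 h1].
have ch : 0 < c * h by rewrite mulr_gt0.
pose q := expR (- (c * h)).
have q1 : q < 1 by rewrite expR_lt1 oppr_lt0.
have q0 : 0 < q by exact: expR_gt0.
have qle : q <= (1 + c * h)^-1.
  by rewrite /q expRN lef_pV2 ?posrE ?expR_gt0 ?expR_ge1Dx //; lra.
have S : \sum_(k < n) expR (- (c * (1 + k%:R * h))) <= (1 - q)^-1.
  apply: (@le_trans _ _ (\sum_(k < n) q ^+ k)).
    apply: ler_sum => k _; rewrite /q -expRM_natl ler_expR.
    by have := mulr_ge0 (ler0n R k) (ltW ch); lra.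
  have E : (1 - q) * (\sum_(k < n) q ^+ k) = 1 - q ^+ n by rewrite -opprB mulNr -subrX1 opprB.
  rewrite -[leRHS]mul1r ler_pdivlMr; last lra.
  by rewrite mulrC E gerBl exprn_ge0 // ltW.
apply: le_trans (ler_wpM2l (ltW h0) S) _.
rewrite ler_pdivrMr; last lra.
have k0 : 0 < 1 + c * h by lra.
have d : c * h / (1 + c * h) <= 1 - q.
  have -> : c * h / (1 + c * h) = 1 - (1 + c * h)^-1 by field; lra.
  lra.
have ci : 0 < 1 + c^-1 by rewrite addr_gt0 // invr_gt0.
apply: le_trans (ler_wpM2l (ltW ci) d).
have -> : (1 + c^-1) * (c * h / (1 + c * h)) = h * ((1 + c) / (1 + c * h)).
  by field; rewrite (gt_eqF c0) gt_eqF.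
rewrite -[leLHS]mulr1 ler_wpM2l ?(ltW h0) // ler_pdivlMr // mul1r.
by have := ler_wpM2l (ltW c0) h1; lra.
Qed.

End discrete_contour.

(** * A bound independent of the contour *)

Section contour_bound.
Context {R : realType}.

Lemma bernoulli_le (h : R) n : 0 <= h -> 1 + n%:R * h <= (1 + h) ^+ n.
Proof.
move=> h0; elim: n => [|n IH]; first by rewrite mul0r addr0 expr0.
rewrite exprS -natr1.
have h1 : 0 <= 1 + h by lra.
by have := ler_wpM2l h1 IH; have := mulr_ge0 (ler0n R n) (sqr_ge0 h); lra.
Qed.

Lemma expR_geometric (s h : R) k : 0 <= h ->
  expR (s + k%:R * ln (1 + h)) = expR s * (1 + h) ^+ k.
Proof.
by move=> h0; rewrite expRD expRM_natl lnK // posrE; lra.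
Qed.

Lemma geometric_bracket (h x : R) : 0 < h -> 1 <= x ->
  exists n, (1 + h) ^+ n <= x < (1 + h) ^+ n.+1.
Proof.
move=> h0 x1.
have ex : exists n, x < (1 + h) ^+ n.
  exists (Num.truncn (x / h)).+1; apply: lt_le_trans (bernoulli_le _ (ltW h0)).
  have := Num.Theory.truncnS_gt (x / h); rewrite ltr_pdivrMr //; lra.
have := ex_minnP ex => -[n xn nmin].
case: n xn nmin => [|n] xn nmin; first by rewrite expr0 in xn; lra.
exists n; rewrite xn andbT leNgt; apply/negP => /nmin; by rewrite ltnn.
Qed.

Lemma nat_bracket (h x : R) : 0 < h -> 0 <= x -> exists J, x < J%:R * h <= x + h.
Proof.
move=> h0 x0; exists (Num.truncn (x / h)).+1.
have := Num.Theory.truncnS_gt (x / h); rewrite ltr_pdivrMr // => ->.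
have : (Num.truncn (x / h))%:R <= x / h by rewrite Num.Theory.truncn_le divr_ge0 // ltW.
by rewrite ler_pdivlMr // -natr1 mulrDl mul1r /=; lra.
Qed.

(** The reference contours have opening angles between these two: on a grid
    of step [h] no single angle can be prescribed, but an interval of length
    [pi / 4] always contains one. *)
Definition angle_lo : R := 5 * pi / 8.
Definition angle_hi : R := 7 * pi / 8.

(** Two rays and an arc of a contour of radius between [1 / t] and [2 / t], over
    the lower bound of the denominator of the kernel. *)
Definition contour_const : R :=
  (2 * (1 + (- cos angle_lo)^-1) + 2 * pi * expR 2) / cos (angle_hi / 2).

Lemma cos_angle_lo : 0 < - cos angle_lo.
Proof.
rewrite /angle_lo; have p := @pi_gt0 R.
have -> : 5 * pi / 8 = pi / 8 + pi / 2 :> R by field.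
by rewrite cosDpihalf opprK; apply: sin_gt0_pi; apply/andP; split; lra.
Qed.

Lemma cos_lt0_obtuse (th : R) : pi / 2 < th < pi -> 0 < - cos th.
Proof.
move=> /andP[h1 h2]; have -> : th = (th - pi / 2) + pi / 2 by ring.
by rewrite cosDpihalf opprK; apply: sin_gt0_pi; apply/andP; split; lra.
Qed.

Lemma cos_le_obtuse (a b : R) : 0 <= a -> a <= `|b| -> `|b| <= pi -> cos b <= cos a.
Proof.
move=> a0 ab bpi; rewrite -(cos_norm b).
have i1 : a \in `[0, pi] by rewrite in_itv /= a0 (le_trans ab).
have i2 : `|b| \in `[0, pi] by rewrite in_itv /= bpi normr_ge0.
by rewrite leNgt; apply/negP; rewrite (ltr_cos i2 i1); lra.
Qed.

Variables (gamma alpha : R).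
Hypotheses (hgamma : 0 < gamma) (halpha : 0 < alpha < 1).
Local Notation contour_kernel := (contour_kernel gamma alpha).

Lemma contour_const_ge0 : 0 <= contour_const.
Proof.
have p := @pi_gt0 R; have c1 := cos_angle_lo.
have k1 : 0 < cos (angle_hi / 2) by apply: cos_half_gt0; rewrite /angle_hi; lra.
rewrite /contour_const divr_ge0 ?(ltW k1) // addr_ge0 //.
  by rewrite mulr_ge0 // addr_ge0 // invr_ge0 ltW.
by rewrite !mulr_ge0 ?expR_ge0 // ltW.
Qed.

(** On a contour of radius comparable to [1 / t] the exponential decays along the
    rays at a rate that depends on the angle only, and it is at most [exp 2] on the
    arc. *)
Lemma contour_sum_scaled (t l s th h : R) n N :
  0 <= l -> 0 < h <= 1 -> 1 <= t * expR s <= 2 -> angle_lo <= th <= angle_hi ->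
  0 < t -> N%:R * h = 2 * th ->
  nrm (contour_sum (contour_kernel t l) s th h n N) <= contour_const.
Proof.
move=> l0 h01 /andP[ts1 ts2] /andP[th1 th2] t0 hN; have /andP[h0 h1] := h01.
have p := @pi_gt0 R; have c1 := cos_angle_lo; set c := - cos _ in c1 *.
have hipi : angle_hi < pi by rewrite /angle_hi; lra.
have lo0 : 0 < angle_lo by rewrite /angle_lo; lra.
have k1 : 0 < cos (angle_hi / 2) by apply: cos_half_gt0; rewrite /angle_hi; lra.
set k := cos (angle_hi / 2) in k1 *.
have cth : cos th <= - c.
  rewrite opprK; apply: cos_le_obtuse; [lra| |]; rewrite ger0_norm; lra.
have ray psi : `|psi| = th ->
    nrm (h%:C * ray_sum (contour_kernel t l) s psi h n) <= (1 + c^-1) / k.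
  move=> psith; rewrite nrmM nrm_real ger0_norm ?(ltW h0) //.
  apply: le_trans (ler_wpM2l (ltW h0) (nrm_sum _ _ _)) _.
  apply: le_trans (_ : (h * \sum_(j < n) expR (- (c * (1 + j%:R * h)))) / k <= _); last first.
    by rewrite ler_wpM2r ?invr_ge0 ?(ltW k1) // geometric_decay.
  rewrite -mulrA ler_wpM2l ?(ltW h0) // mulr_suml; apply: ler_sum => j _.
  apply: le_trans (kernel_bound hgamma halpha t l0 (_ : _ <= angle_hi) hipi) _ => /=;
    first by rewrite psith.
  rewrite ler_wpM2r ?invr_ge0 ?(ltW k1) // ler_expR expR_geometric ?(ltW h0) //.
  have -> : cos psi = cos th by rewrite -cos_norm psith.
  have b := bernoulli_le j (ltW h0); have jh := mulr_ge0 (ler0n R j) (ltW h0).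
  (* the radii grow geometrically, hence at least linearly *)
  have q1 : 1 + j%:R * h <= t * (expR s * (1 + h) ^+ j).
    rewrite mulrA; apply: le_trans b _; rewrite ler_peMl // exprn_ge0 //; lra.
  have q2 := ler_wpM2l (ltW c1) q1.
  have q3 : t * (expR s * (1 + h) ^+ j) * cos th <= t * (expR s * (1 + h) ^+ j) * (- c).
    by rewrite ler_wpM2l //; lra.
  lra.
have arc : nrm (h%:C * ('i * arc_sum (contour_kernel t l) s th h N)) <= 2 * pi * expR 2 / k.
  rewrite !nrmM nrm_i mul1r nrm_real ger0_norm ?(ltW h0) //.
  apply: le_trans (ler_wpM2l (ltW h0) (_ : _ <= N%:R * (expR 2 / k))) _.
    apply: ler_nrm_sum_const => j.
    apply: le_trans (kernel_bound hgamma halpha t l0 (_ : _ <= angle_hi) hipi) _ => /=.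
      have := ltn_ord j; rewrite -(ltr_nat R) => /ltW jN.
      have := ler_wpM2r (ltW h0) jN; have := mulr_ge0 (ler0n R j) (ltW h0).
      by move=> ? ?; rewrite ler_norml; apply/andP; split; lra.
    rewrite ler_wpM2r ?invr_ge0 ?(ltW k1) // ler_expR mulrA.
    apply: le_trans _ ts2; rewrite ler_piMr ?cos_le1 //; lra.
  have -> : h * (N%:R * (expR 2 / k)) = N%:R * h * (expR 2 / k) by ring.
  rewrite hN -[leRHS]mulrA ler_wpM2r ?divr_ge0 ?expR_ge0 ?(ltW k1) //; lra.
rewrite /contour_sum mulrDr mulrBr.
apply: le_trans (nrmD _ _) _; apply: le_trans (lerD (nrmB _ _) arc) _.
have th0 : 0 <= th by lra.
have r1 := ray th (ger0_norm th0).
have r2 := ray (- th) (etrans (normrN th) (ger0_norm th0)).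
apply: le_trans (lerD (lerD r1 r2) (lexx _)) _.
rewrite /contour_const -/c -/k; by rewrite le_eqVlt; apply/orP; left; apply/eqP; field; rewrite !gt_eqF.
Qed.

(** The two arcs differ by angles at least [Num.min th angle_lo], which are obtuse,
    so that there the kernel is at most [exp (- x) <= 1 / x] up to a constant, with
    [x] proportional to [t * expR s]; the hypothesis on [e] makes the total at most
    [e].  The angle moves by a multiple of [h] to keep the grid. *)
Lemma arc_sum_transfer (t l s th h : R) N (e : R) :
  0 <= l -> 0 < h <= 2^-1 -> 0 < t -> pi / 2 < th < pi -> N%:R * h = 2 * th ->
  2 * pi / cos (Num.max th angle_hi / 2) <=
    e * (- cos (Num.min th angle_lo) * (t * expR s)) ->
  exists th' N', [/\ angle_lo <= th' <= angle_hi, N'%:R * h = 2 * th' &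
    nrm (h%:C * ('i * arc_sum (contour_kernel t l) s th h N) -
         h%:C * ('i * arc_sum (contour_kernel t l) s th' h N')) <= e].
Proof.
move=> l0 /andP[h0 h1] t0 /andP[thl thu] hN.
have p := @pi_gt0 R; have p2 := @pi_ge2 R.
have lohi : angle_lo + h <= angle_hi by rewrite /angle_lo /angle_hi; lra.
have hipi : angle_hi < pi by rewrite /angle_hi; lra.
have lop : pi / 2 < angle_lo by rewrite /angle_lo; lra.
set m := Num.min th angle_lo; set M := Num.max th angle_hi.
set c2 := - cos m; set k2 := cos (M / 2) => He.
have mth : m <= th by rewrite ge_min lexx.
have mlo : m <= angle_lo by rewrite ge_min lexx orbT.
have thM : th <= M by rewrite le_max lexx.
have hiM : angle_hi <= M by rewrite le_max lexx orbT.
have mp : pi / 2 < m by rewrite lt_min thl lop.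
have Mp : M < pi by rewrite gt_max thu hipi.
have c20 : 0 < c2 by apply: cos_lt0_obtuse; rewrite mp; lra.
have k20 : 0 < k2 by apply: cos_half_gt0; lra.
pose x := c2 * (t * expR s).
have x0 : 0 < x by rewrite !mulr_gt0 // expR_gt0.
pose C := expR (- x) / k2.
have FC psi : m <= `|psi| <= M -> nrm (contour_kernel t l (s +i* psi)) <= C.
  move=> /andP[mpsi psiM].
  apply: le_trans (kernel_bound hgamma halpha t l0 (z := s +i* psi) psiM Mp) _ => /=.
  rewrite ler_wpM2r ?invr_ge0 ?(ltW k20) // ler_expR /x /c2 -mulNr opprK mulrA mulrC.
  rewrite ler_wpM2r ?mulr_ge0 ?expR_ge0 ?(ltW t0) //.
  by apply: cos_le_obtuse => //; lra.
have e0 : 2 * pi * C <= e.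
  have ex := expR_ge1Dx x.
  have : expR (- x) <= x^-1 by rewrite expRN lef_pV2 ?posrE ?expR_gt0 //; lra.
  move=> exx; rewrite /C mulrA [2 * pi * _]mulrC -mulrA.
  have pk : 0 <= 2 * pi / k2 by rewrite divr_ge0 ?(ltW k20) //; lra.
  apply: le_trans (ler_wpM2r pk exx) _.
  by rewrite mulrC ler_pdivrMr.
have C0 : 0 <= C by rewrite divr_ge0 ?expR_ge0 // ltW.
have fin J (z w : R[i]) : J%:R * h <= pi -> nrm (z - w) <= 2 * J%:R * C ->
    nrm (h%:C * ('i * z) - h%:C * ('i * w)) <= e.
  move=> Jpi zw; rewrite -!mulrBr !nrmM nrm_i mul1r nrm_real ger0_norm ?(ltW h0) //.
  apply: le_trans (ler_wpM2l (ltW h0) zw) _; apply: le_trans _ e0.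
  by have := ler_wpM2r C0 Jpi; lra.
have [th5|th5] := ltP th angle_lo.
  have [|J /andP[J1 J2]] := @nat_bracket h (angle_lo - th) h0; first lra.
  exists (th + J%:R * h), (J + N + J)%N; split.
  - by apply/andP; split; lra.
  - by rewrite !natrD !mulrDl hN; ring.
  apply: (fin J); first lra.
  rewrite nrmBC; apply: arc_sum_widen => //; first exact: ltW.
  by move=> psi /andP[? ?]; apply: FC; apply/andP; split; lra.
have [th7|th7] := leP th angle_hi.
  exists th, N; split => //; first by rewrite th5.
  rewrite subrr nrm0; apply: le_trans _ e0.
  by rewrite mulr_ge0 //; lra.
have [|J /andP[J1 J2]] := @nat_bracket h (th - angle_hi) h0; first lra.
have JN : (J + J <= N)%N.
  rewrite -(ler_nat R) natrD -(ler_pM2r h0) hN mulrDl.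
  by rewrite /angle_hi in J2; lra.
exists (th - J%:R * h), (N - (J + J))%N.
have hN' : (N - (J + J))%:R * h = 2 * (th - J%:R * h).
  by rewrite natrB // natrD mulrBl hN; ring.
split => //; first by apply/andP; split; lra.
apply: (fin J).
  by rewrite /angle_hi in J2; lra.
have -> : arc_sum (contour_kernel t l) s th h N =
    arc_sum (contour_kernel t l) s (th - J%:R * h + J%:R * h) h (J + (N - (J + J)) + J).
  by rewrite subrK addnAC subnKC.
apply: arc_sum_widen => //; first exact: ltW.
by move=> psi /andP[? ?]; apply: FC; apply/andP; split; lra.
Qed.

(** Up to three errors below [eps / 3], the sum over the given contour is the sum
    over its outer arc, then over the outer arc of angle [th'], then over the contour
    of angle [th'] and radius [exp s'] close to [1 / t].  The outer radius is fixed
    first, for the second error, and the mesh next, for the other two. *)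
Theorem contour_sum_bound (t th delta eps : R) :
  0 < t -> pi / 2 < th < pi -> 0 < delta -> 0 < eps ->
  exists2 M0 : R, 0 < M0 & forall M1 : R, M0 <= M1 ->
  exists2 h0 : R, 0 < h0 & forall (h : R) N n, 0 < h <= h0 -> N%:R * h = 2 * th ->
    M1 <= delta * (1 + h) ^+ n <= 2 * M1 -> forall l : R, 0 <= l ->
    nrm (contour_sum (contour_kernel t l) (ln delta) th h n N) <= contour_const + eps.
Proof.
move=> t0 th12 d0 e0; have /andP[thl thu] := th12.
have p := @pi_gt0 R; have p2 := @pi_ge2 R.
have hipi : angle_hi < pi by rewrite /angle_hi; lra.
have lop : pi / 2 < angle_lo by rewrite /angle_lo; lra.
have lopi : angle_lo < pi by rewrite /angle_lo; lra.
pose c2 := - cos (Num.min th angle_lo); pose Th := Num.max th angle_hi.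
have Thp : Th < pi by rewrite gt_max thu hipi.
have thTh : th <= Th by rewrite le_max lexx.
have hiTh : angle_hi <= Th by rewrite le_max lexx orbT.
have c20 : 0 < c2.
  by apply: cos_lt0_obtuse; rewrite lt_min thl lop gt_min thu.
have k20 : 0 < cos (Th / 2) by apply: cos_half_gt0; lra.
pose Mt := 2 * pi / cos (Th / 2) / (eps / 3 * (c2 * t)).
have Mt0 : 0 < Mt by rewrite !divr_gt0 ?mulr_gt0 //; lra.
exists (2 / t + Mt); first by rewrite addr_gt0 // divr_gt0.
move=> M1 M0M1.
have t20 : 0 < 2 / t by rewrite divr_gt0.
have M10 : 0 < M1 by lra.
pose a := Num.min (ln delta) (- ln t); pose b := ln (2 * M1).
have [B [B0 HB]] := kernel_C2 hgamma halpha t a b Thp.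
pose Q := (2 * M1 / delta + 2 * M1 * t) * (2 * pi) * (3 * B).
have M1d : 0 <= 2 * M1 / delta by rewrite divr_ge0 ?(ltW d0) //; lra.
have M1t : 0 <= 2 * M1 * t by rewrite mulr_ge0 ?(ltW t0) //; lra.
have Q0 : 0 <= Q.
  apply: mulr_ge0; last by rewrite mulr_ge0.
  by apply: mulr_ge0; lra.
have Q1 : 0 < Q + 1 by lra.
exists (Num.min 2^-1 (eps / 3 / (Q + 1))).
  by rewrite lt_min invr_gt0 ltr0n /= !divr_gt0.
move=> h N n /andP[h0]; rewrite le_min => /andP[h12 hQ] hN /andP[M1M MM1] l l0.
set M := delta * _ in M1M MM1.
have M_gt0 : 0 < M by lra.
have eta0 : 0 <= ln (1 + h) by apply: ln_ge0; lra.
have lnM : ln delta + n%:R * ln (1 + h) = ln M.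
  by rewrite -[LHS]expRK expR_geometric ?(ltW h0) // lnK.
have [f' tf _] := HB l l0.
have nh : n%:R * h <= 2 * M1 / delta.
  have := bernoulli_le n (ltW h0); rewrite ler_pdivlMr //.
  move=> /(ler_wpM2l (ltW d0)); rewrite -/M; lra.
have Kpt s psi m k : (k <= m)%N -> s + m%:R * ln (1 + h) = ln M -> a <= s ->
    `|psi| <= Th -> rectangle a b Th ((s + k%:R * ln (1 + h)) +i* psi).
  move=> km sm as_ psiT; split => //=.
  have k0 : 0 <= k%:R * ln (1 + h) by rewrite mulr_ge0.
  have kl : k%:R * ln (1 + h) <= m%:R * ln (1 + h) by rewrite ler_wpM2r // ler_nat.
  have lb : ln M <= b by rewrite ler_ln ?posrE //; lra.
  by apply/andP; split; lra.
have arcpt psi N' j : (j <= N')%N -> N'%:R * h = 2 * psi -> psi <= Th ->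
    `|- psi + j%:R * h| <= Th.
  move=> jN hN' psiT; have j0 := mulr_ge0 (ler0n R j) (ltW h0).
  have jN2 : j%:R * h <= N'%:R * h by rewrite ler_wpM2r ?ler_nat // ltW.
  by rewrite ler_norml; apply/andP; split; lra.
have h01 : 0 <= h <= 1 by apply/andP; split; lra.
have adelta : a <= ln delta by rewrite ge_min lexx.
have E1 := discrete_cauchy tf B0 h01 hN
  (fun k j kn jN => Kpt _ _ _ _ kn lnM adelta (arcpt _ _ _ jN hN thTh)).
have h01' : 0 < h <= 2^-1 by rewrite h0.
have [|th' [N' [th'b hN' E2]]] := @arc_sum_transfer t l (ln M) th h N (eps / 3) l0 h01' t0 th12 hN.
  rewrite -/c2 -/Th lnK //.
  have Y0 : 0 < eps / 3 * (c2 * t) by rewrite !mulr_gt0 //; lra.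
  have : Mt <= M by lra.
  by rewrite /Mt ler_pdivrMr // => X; apply: le_trans X _; lra.
have Mtge1 : 1 <= M * t.
  by have : 2 / t <= M; [lra|rewrite ler_pdivrMr //; lra].
have [n' /andP[n'1 n'2]] := geometric_bracket h0 Mtge1.
(* the outer radius is shared, so that the second grid ends on the same arc *)
pose s' := ln M - n'%:R * ln (1 + h).
have s'M : s' + n'%:R * ln (1 + h) = ln M by rewrite subrK.
have q0 : 0 < (1 + h) ^+ n' by rewrite exprn_gt0 //; lra.
have es' : expR s' * (1 + h) ^+ n' = M.
  by rewrite -expR_geometric ?(ltW h0) // s'M lnK.
have es'E : expR s' = M / (1 + h) ^+ n' by rewrite -es' mulfK // gt_eqF.
have ts' : 1 <= t * expR s' <= 2.
  rewrite es'E mulrA ler_pdivlMr // ler_pdivrMr // [t * M]mulrC mul1r n'1 /=.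
  by move: n'2; rewrite exprS => /ltW /le_trans; apply; rewrite ler_pM2r //; lra.
have as' : a <= s'.
  rewrite ge_min; apply/orP; right.
  rewrite -ler_expR expRN lnK // -[_^-1]mul1r ler_pdivrMr // mulrC.
  by case/andP: ts'.
have n'h : n'%:R * h <= 2 * M1 * t.
  have bn := bernoulli_le n' (ltW h0).
  have := ler_wpM2r (ltW t0) MM1; lra.
have /andP[th'1 th'2] := th'b.
have E3 := discrete_cauchy tf B0 h01 hN'
  (fun k j kn jN => Kpt _ _ _ _ kn s'M as' (arcpt _ _ _ jN hN' (le_trans th'2 hiTh))).
have h01s : 0 < h <= 1 by rewrite h0 /=; lra.
have E4 := @contour_sum_scaled t l s' th' h n' N' l0 h01s ts' th'b t0 hN'.
rewrite lnM in E1; rewrite s'M in E3.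
have hh : 0 <= 3 * B * h by rewrite !mulr_ge0 // ltW.
have err m N1 (x psi : R) : 0 <= x -> N1%:R * h = 2 * psi -> psi <= pi -> m%:R * h <= x ->
    m%:R * N1%:R * (3 * B * h ^+ 3) <= x * (2 * pi) * (3 * B) * h.
  move=> x0 hN1 psipi mx.
  have -> : m%:R * N1%:R * (3 * B * h ^+ 3) = (m%:R * h) * (N1%:R * h) * (3 * B * h) by ring.
  have -> : x * (2 * pi) * (3 * B) * h = x * (2 * pi) * (3 * B * h) by ring.
  rewrite ler_wpM2r // ler_pM ?mulr_ge0 ?(ltW h0) // hN1; lra.
have F1 := le_trans E1 (err n N _ _ M1d
  hN (ltW thu) nh).
have F3 := le_trans E3 (err n' N' _ _ M1t
  hN' (le_trans th'2 (ltW hipi)) n'h).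
have Qh : Q * h <= eps / 3.
  move: hQ; rewrite ler_pdivlMr //; have := mulr_ge0 Q0 (ltW h0); lra.
set c := contour_sum _ _ th _ _ _ in F1 *.
set c' := contour_sum _ _ th' _ _ _ in F3 E4.
set v := h%:C * ('i * arc_sum _ _ th _ _) in F1 E2.
set v' := h%:C * ('i * arc_sum _ _ th' _ _) in F3 E2.
have -> : c = (c - v) + (v - v') - (c' - v') + c' by ring.
apply: le_trans (nrmD _ _) _; apply: le_trans (lerD (nrmB _ _) E4) _.
apply: le_trans (lerD (lerD (nrmD _ _) (lexx _)) (lexx _)) _.
move: Qh; rewrite /Q; lra.
Qed.

End contour_bound.

(** * The inner product of L2 *)

Section real_L2.
Context {R : realType} {d : nat}.
Variable Omega : set 'rV[R]_d.
Implicit Types (f g h k : 'rV[R]_d -> R).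
Local Notation mu := (lebesgue_rv d).
Local Notation L2 := (inL2 Omega).

Definition L2inner f g : R := \int[mu]_x ((f \_ Omega) x * (g \_ Omega) x).
Local Notation inner := L2inner.

Lemma inL2_linear p f g : L2 f -> L2 g -> L2 (fun x => p * f x + g x).
Proof.
move=> fL gL; rewrite /inL2.
have -> : (fun x => p * f x + g x) \_ Omega = p *: (f \_ Omega) + (g \_ Omega).
  apply/funext => x; rewrite /patch /=; case: ifPn => xO.
    by rewrite !fctE xO.
  by rewrite !fctE (negPf xO) /= scaler0 addr0.
exact: (Lfun_submod_closed mu (lee1n 2)).2.
Qed.

Lemma inL2_0 : L2 (fun=> 0).
Proof.
rewrite /inL2 (_ : _ \_ _ = 0); first exact: (Lfun_submod_closed mu (lee1n 2)).1.
by apply/funext => x; rewrite /patch; case: ifP.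
Qed.

Lemma inL2Z p f : L2 f -> L2 (fun x => p * f x).
Proof.
move=> fL; have := inL2_linear p fL inL2_0.
by congr (L2 _); apply/funext => x; rewrite addr0.
Qed.

Lemma inL2B f g : L2 f -> L2 g -> L2 (fun x => f x - g x).
Proof.
move=> fL gL; have := inL2_linear (-1) gL fL.
by congr (L2 _); apply/funext => x; rewrite mulN1r addrC.
Qed.

Lemma inner_integrable f g : L2 f -> L2 g ->
  mu.-integrable setT (EFin \o (fun x => (f \_ Omega) x * (g \_ Omega) x)).
Proof. by move=> fL gL; apply/Lfun1_integrable; exact: Lfun2_mul_Lfun1. Qed.

Lemma innerC f g : inner f g = inner g f.
Proof. by apply: eq_Rintegral => x _; rewrite mulrC. Qed.

Lemma inner_linear p f g k : L2 f -> L2 g -> L2 k ->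
  inner (fun x => p * f x + g x) k = p * inner f k + inner g k.
Proof.
move=> fL gL kL; rewrite /L2inner.
transitivity (\int[mu]_x (p * ((f \_ Omega) x * (k \_ Omega) x) +
                          (g \_ Omega) x * (k \_ Omega) x)).
  apply: eq_Rintegral => x _; rewrite /patch; case: ifPn => _ /=; first ring.
  by rewrite (_ : point = 0 :> R) // !mulr0 addr0.
rewrite RintegralD //; last exact: inner_integrable.
- by rewrite RintegralZl //; exact: inner_integrable.
- have := integrableZl measurableT p (inner_integrable fL kL).
  by apply: eq_integrable.
Qed.

Lemma inner_ge0 f : 0 <= inner f f.
Proof. by apply: Rintegral_ge0 => x _; rewrite -expr2 sqr_ge0. Qed.

Lemma inner0 k : inner (fun=> 0) k = 0.
Proof.
transitivity (\int[mu]_x (0 : R)); last by rewrite /Rintegral integral0.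
by apply: eq_Rintegral => x _; rewrite /patch; case: ifPn => _; rewrite mul0r.
Qed.

Lemma innerZ p f k : L2 f -> L2 k -> inner (fun x => p * f x) k = p * inner f k.
Proof.
move=> fL kL; have := inner_linear p fL inL2_0 kL; rewrite inner0 addr0 => <-.
by congr inner; apply/funext => x; rewrite addr0.
Qed.

Lemma normL2_sqrt h (F : 'rV[R]_d -> R) :
  (forall x, (h \_ Omega) x ^+ 2 = F x) -> mu.-integrable setT (EFin \o F) ->
  normL2 Omega h = Num.sqrt (\int[mu]_x F x).
Proof.
move=> hF iF; rewrite /normL2 unlock /=.
have -> : (\int[mu]_x (`|((h \_ Omega) x)%:E| `^ 2) = \int[mu]_x (F x)%:E)%E.
  apply: eq_integral => x _; rewrite /= powR_mulrn // -hF.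
  by rewrite real_normK ?num_real.
rewrite fine_poweR powR12_sqrt //; apply: fine_ge0; apply: integral_ge0 => x _.
by rewrite lee_fin -hF sqr_ge0.
Qed.

Lemma normL2E f : L2 f -> normL2 Omega f = Num.sqrt (inner f f).
Proof.
by move=> fL; apply: normL2_sqrt => [x|]; [rewrite expr2|exact: inner_integrable].
Qed.

Lemma normL2_ge0 f : 0 <= normL2 Omega f.
Proof. by apply: fine_ge0; exact: Lnorm_ge0. Qed.

Lemma normL2_sq f : L2 f -> normL2 Omega f ^+ 2 = inner f f.
Proof. by move=> fL; rewrite normL2E // sqr_sqrtr // inner_ge0. Qed.

Lemma inner_eq f f' g : {ae mu, forall x, Omega x -> f x = f' x} ->
  L2 f -> L2 f' -> L2 g -> inner f g = inner f' g.
Proof.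
move=> ff fL fL' gL; congr fine; apply: ae_eq_integral => //.
- by case/integrableP: (inner_integrable fL gL).
- by case/integrableP: (inner_integrable fL' gL).
- move: ff; apply: filterS => x ffx _ /=; rewrite /patch.
  by case: ifPn => // /set_mem/ffx ->.
Qed.

End real_L2.

(** Applied to [A = inner f f], [B = inner f g] and [C = inner g g], and again to
    complex-valued functions. *)
Lemma quadratic_cauchy_schwarz (R : realType) (A B C : R) :
  (forall a b, 0 <= a ^+ 2 * A + 2 * a * b * B + b ^+ 2 * C) ->
  `|B| <= Num.sqrt A * Num.sqrt C.
Proof.
move=> H; have A0 := H 1 0; have C0 := H 0 1.
have {}A0 : 0 <= A by lra.
have {}C0 : 0 <= C by lra.
have BB : B ^+ 2 <= A * C.
  have [A00|An0] := eqVneq A 0; last first.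
    have A1 : 0 < A by rewrite lt_neqAle eq_sym An0.
    by rewrite -(ler_pM2l A1); have := H (- B) A; lra.
  have [->|Bn0] := eqVneq B 0; first by rewrite A00 mul0r expr0n.
  have := H (- (C + 1) / (2 * B)) 1.
  have -> : 2 * (- (C + 1) / (2 * B)) * 1 * B = - (C + 1) by field.
  by rewrite A00; lra.
rewrite -sqrtrM // -sqrtr_sqr; exact: ler_wsqrtr.
Qed.

Section real_L2_norm.
Context {R : realType} {d : nat}.
Variable Omega : set 'rV[R]_d.
Local Notation L2 := (inL2 Omega).
Local Notation inner := (L2inner Omega).
Local Notation norm := (normL2 Omega).
Implicit Types (f g : 'rV[R]_d -> R).

Lemma inner_cauchy_schwarz f g : L2 f -> L2 g -> `|inner f g| <= norm f * norm g.
Proof.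
move=> fL gL; rewrite !normL2E //; apply: quadratic_cauchy_schwarz => a b.
have L := inL2_linear a fL (inL2Z b gL).
have := inner_ge0 Omega (fun x => a * f x + b * g x).
rewrite inner_linear //; last exact: inL2Z.
rewrite ![inner _ (fun x => a * f x + b * g x)]innerC !inner_linear //; [|exact: inL2Z..].
rewrite (innerC _ f (fun x => b * g x)) !innerZ //; last exact: inL2Z.
rewrite (innerC _ g (fun x => b * g x)) !innerZ // (innerC _ g f).
lra.
Qed.

Lemma normL2_linear p f g : L2 f -> L2 g ->
  norm (fun x => p * f x + g x) <= `|p| * norm f + norm g.
Proof.
move=> fL gL.
have L := inL2_linear p fL gL.
rewrite -(ler_pXn2r (n := 2)) ?nnegrE ?addr_ge0 ?mulr_ge0 ?normL2_ge0 //.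
rewrite normL2_sq // inner_linear // ![inner _ (fun x => p * f x + g x)]innerC.
rewrite !inner_linear // -!normL2_sq // (innerC _ g f).
have cs := inner_cauchy_schwarz fL gL.
have : p * inner f g <= `|p| * (norm f * norm g).
  by rewrite (le_trans (ler_norm _)) // normrM ler_wpM2l.
have := real_normK (num_real p).
nra.
Qed.

Lemma normL2Z p f : L2 f -> norm (fun x => p * f x) <= `|p| * norm f.
Proof.
move=> fL; have := normL2_linear p fL (inL2_0 Omega).
have -> : norm (fun=> 0) = 0.
  rewrite (normL2_sqrt (F := fun=> 0)) ?Rintegral0 ?sqrtr0 //.
  - by rewrite /Rintegral integral0 sqrtr0.
  - by move=> x; rewrite /patch; case: ifP => _; rewrite expr0n.
  - exact: integrable0.
by rewrite addr0; congr (norm _ <= _); apply/funext => x; rewrite addr0.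
Qed.

Lemma normL2D f g : L2 f -> L2 g -> norm (fun x => f x + g x) <= norm f + norm g.
Proof.
move=> fL gL; have := normL2_linear 1 fL gL; rewrite normr1 mul1r.
by congr (norm _ <= _); apply/funext => x; rewrite mul1r.
Qed.

End real_L2_norm.

(** * Open sets, continuous functions and the measure of a polytope *)

Section borel_rv.
Context {R : realType} {d : nat}.
Implicit Types (A : set 'rV[R]_d).

Lemma measurable_box (I : 'I_d -> set (measurableTypeR R)) :
  (forall i, measurable (I i)) -> measurable [set x : 'rV[R]_d | forall i, I i (x ord0 i)].
Proof.
move=> mI; have -> : [set x : 'rV[R]_d | forall i, I i (x ord0 i)] =
    \bigcap_(i in [set: 'I_d]) ((fun x : 'rV[R]_d => x ord0 i : measurableTypeR R) @^-1` I i).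
  by apply/seteqP; split => x /= H i; [move=> _; exact: H|exact: H].
apply: fin_bigcap_measurable => // i _.
by rewrite -[X in measurable X]setTI; exact: measurable_coord.
Qed.

Lemma coord_le_norm (x : 'rV[R]_d) i : `|x ord0 i| <= `|x|.
Proof.
rewrite [leRHS]/Num.norm /= mx_normrE; apply/bigmax_geP; right => /=.
by exists (ord0, i).
Qed.

(** An open set is the union of the half-open grid cubes of side [1 / n] that it
    contains, and there are countably many of these. *)
Lemma open_measurable_rv A : open A -> measurable A.
Proof.
move=> oA.
pose cube (p : nat * 'rV[int]_d) := [set x : 'rV[R]_d | forall i,
  (`[(p.2 ord0 i)%:~R / p.1.+1%:R, ((p.2 ord0 i)%:~R + 1) / p.1.+1%:R[%classic : set R) (x ord0 i)].
have -> : A = \bigcup_(p in [set: nat * 'rV[int]_d])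
    (if `[<cube p `<=` A>] then cube p else set0).
  apply/seteqP; split => [x Ax|x [p _]]; last by case: ifPn => // /asboolP sub /sub.
  have /nbhs_ballP[e /= e0 eA] : nbhs x A by apply: open_nbhs_nbhs.
  pose n := Num.truncn e^-1.
  have ne : n.+1%:R^-1 < e.
    rewrite -[ltRHS]invrK ltf_pV2 ?posrE ?invr_gt0 //.
    exact: Num.Theory.truncnS_gt.
  have n0 : 0 < n.+1%:R :> R by [].
  exists (n, \row_i Num.floor (n.+1%:R * x ord0 i)) => //.
  have xc : cube (n, \row_i Num.floor (n.+1%:R * x ord0 i)) x.
    move=> i /=; rewrite in_itv /= mxE ler_pdivrMr // ltr_pdivlMr //.
    rewrite [x ord0 i * _]mulrC; have := real_floor_itv (num_real (n.+1%:R * x ord0 i)).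
    by rewrite intrD.
  rewrite ifT //; apply/asboolP => y yc; apply: eA.
  rewrite -ball_normE /= /ball_ /=.
  have : `|x - y| <= n.+1%:R^-1.
    rewrite [leLHS]/Num.norm /= mx_normrE; apply/bigmax_leP; split; first by rewrite invr_ge0.
    move=> [i j] _ /=; have -> : i = ord0 by rewrite (ord1 i); exact: val_inj.
    rewrite !mxE.
    have := xc j; have := yc j; rewrite /= !in_itv /= !mulrDl mul1r.
    move: (_^-1 : R) (x ord0 j : R) (y ord0 j : R) (_ / _ : R) => b xj yj a.
    move=> /andP[ay yab] /andP[ax xab].
    by rewrite ler_norml; apply/andP; split; lra.
  by move=> h; apply: le_lt_trans h ne.
apply: countable_bigcupT_measurable; first exact: countableP.
move=> p; case: ifP => _ //; apply: (measurable_box (I := fun i =>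
  `[(p.2 ord0 i)%:~R / p.1.+1%:R, ((p.2 ord0 i)%:~R + 1) / p.1.+1%:R[%classic)) => i.
exact: measurable_itv.
Qed.

Lemma continuous_measurable_rv (f : 'rV[R]_d -> R) :
  continuous f -> measurable_fun setT (f : 'rV[R]_d -> measurableTypeR R).
Proof.
move=> cf; apply: (measurability _ (RGenOInfty.measurableE R)).
move=> _ [_ [a ->] <-]; rewrite setTI; apply: open_measurable_rv.
by apply: open_comp; [move=> x _; exact: cf|exact: interval_open].
Qed.

(** The closed ball that contains the set is compact. *)
Lemma compact_image_bounded (f : 'rV[R]_d -> R) A :
  continuous f -> bounded_set A -> exists M, forall x, A x -> `|f x| <= M.
Proof.
move=> cf [M0 [_ M0A]]; pose M := `|M0| + 1.
have AM x : A x -> `|x| <= M.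
  by apply: M0A; rewrite /M; have := ler_norm M0; lra.
pose B := [set x : 'rV[R]_d | `|x| <= M].
have cB : compact B.
  apply: bounded_closed_compact.
    exists M; split; first exact: num_real.
    by move=> N MN x /= xM; exact: le_trans xM (ltW MN).
  have -> : B = (fun x : 'rV[R]_d => `|x|) @^-1` [set r | r <= M] by [].
  apply: closed_comp; last exact: closed_le.
  by move=> x _; exact: norm_continuous.
have /compact_bounded[N [_ NB]] :=
  continuous_compact (continuous_subspaceT cf) cB.
exists (`|N| + 1) => x Ax; apply: (NB (`|N| + 1)); first by have := ler_norm N; lra.
by exists x => //; exact: AM.
Qed.

End borel_rv.

Section cube_measure.
Context {R : realType}.

Definition cube n (M : R) : set 'rV[R]_n :=
  [set x | forall i, (`[- M, M]%classic : set R) (x ord0 i)].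

Lemma measurable_cube n (M : R) : measurable (@cube n M).
Proof.
by apply: (measurable_box (I := fun=> `[- M, M]%classic)) => i; exact: measurable_itv.
Qed.

Lemma lebesgue_rv_cube n (M : R) : (lebesgue_rv n (cube M) < +oo)%E.
Proof.
elim: n => [|n IH]; first by rewrite /= diracE; case: (_ \in _); rewrite ltry.
have mI : measurable (`[- M, M]%classic : set (measurableTypeR R)) by exact: measurable_itv.
have -> : lebesgue_rv n.+1 (@cube n.+1 M) =
    (@lebesgue_measure R \x lebesgue_rv n)%E ((`[- M, M]%classic : set R) `*` cube M).
  rewrite /= /pushforward; congr (_ _).
  apply/seteqP; split => [[a x] /= H|[a x] /= [Ha Hx] i].
    split; first by have := H ord0; rewrite mxE unlift_none.
    by move=> i /=; have := H (lift ord0 i); rewrite mxE liftK.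
  by rewrite mxE; case: unliftP => [j|] _ //=; exact: Hx.
rewrite product_measure1E //; last exact: measurable_cube.
have fI : (@lebesgue_measure R (`[- M, M]%classic : set R)%R < +oo)%E.
  by rewrite lebesgue_measure_itv /=; case: ifP => _; rewrite ltry.
by rewrite lte_mul_pinfty ?measure_ge0 // ge0_fin_numE ?measure_ge0.
Qed.

End cube_measure.

Section polytope.
Context {R : realType} {d : nat}.
Variable Omega : set 'rV[R]_d.
Hypothesis hOmega : convex_polytopal_domain Omega.

Lemma domain_measurable : measurable Omega.
Proof.
have [_ _ [m [a [b OE]]]] := hOmega.
pose l j (x : 'rV[R]_d) := \sum_(k < d) a j ord0 k * x ord0 k.
have -> : Omega = \bigcap_(j in [set: 'I_m]) (l j @^-1` `]-oo, b j[%classic).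
  rewrite OE; apply/seteqP; split => x /= H j; [move=> _|].
    by rewrite /= in_itv /=; exact: H.
  by have := H j I; rewrite /= in_itv.
apply: fin_bigcap_measurable => // j _.
have ml : measurable_fun setT (l j : 'rV[R]_d -> measurableTypeR R).
  apply: measurable_sum => k; apply: measurable_funM => //.
  exact: measurable_coord.
by rewrite -[X in measurable X]setTI; apply: ml => //; exact: measurable_itv.
Qed.

Lemma domain_subset_cube : exists M : R, Omega `<=` cube M.
Proof.
have [_ [M0 [_ OM]] _] := hOmega; exists (`|M0| + 1) => x Ox i /=.
rewrite in_itv /= -ler_norml (le_trans (coord_le_norm x i)) // (OM (`|M0| + 1)) //.
by have := ler_norm M0; lra.
Qed.

Lemma domain_finite : (lebesgue_rv d Omega < +oo)%E.
Proof.
have [M OM] := domain_subset_cube; apply: le_lt_trans (lebesgue_rv_cube d M).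
by apply: le_measure => //; rewrite inE; [exact: domain_measurable|exact: measurable_cube].
Qed.

Lemma bounded_inL2 (f : 'rV[R]_d -> R) (M : R) :
  measurable_fun setT (f : 'rV[R]_d -> measurableTypeR R) ->
  (forall x, Omega x -> `|f x| <= M) -> inL2 Omega f.
Proof.
move=> mf fM; have mO := domain_measurable.
have mfO : measurable_fun setT (f \_ Omega : 'rV[R]_d -> measurableTypeR R).
  apply/(measurable_restrictT _ _).1 => //; exact: measurable_funS mf.
rewrite /inL2 inE; apply/andP; split; rewrite inE //=.
rewrite /finite_norm unlock poweR_lty //.
apply: (@le_lt_trans _ _ (\int[lebesgue_rv d]_x (((fun=> (M ^+ 2)%:E) \_ Omega) x))%E).
  apply: ge0_le_integral => //.
  - by move=> x _; exact: poweR_ge0.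
  - apply/measurable_EFinP/(@measurableT_comp _ _ _ _ _ _ (fun x : R => x `^ 2)%R) => //.
    exact: measurableT_comp.
  - by apply/(measurable_restrictT _ _).1 => //; exact: measurable_cst.
  - move=> x _ /=; rewrite /patch; case: ifPn => [xO|_].
      rewrite powR_mulrn // lee_fin.
      have := fM x (set_mem xO) => fxM.
      by rewrite lerXn2r ?nnegrE // (le_trans _ fxM).
    by rewrite (_ : point = 0 :> R) // normr0 powR_mulrn // expr0n.
rewrite -integral_mkcond integral_cst // lte_mul_pinfty // ?lee_fin ?sqr_ge0 //.
exact: domain_finite.
Qed.

End polytope.

(** * Symmetry and positivity of the Dirichlet Laplacian *)

Section dirichlet_form.
Context {R : realType} {d : nat}.
Variable Omega : set 'rV[R]_d.
Hypothesis hOmega : convex_polytopal_domain Omega.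
Local Notation mu := (lebesgue_rv d).
Local Notation L2 := (inL2 Omega).
Local Notation inner := (L2inner Omega).
Local Notation norm := (normL2 Omega).
Implicit Types (f g h u phi psi : 'rV[R]_d -> R).

(** Test functions and their partial derivatives are continuous, hence bounded on
    the domain, which has finite measure. *)
Lemma test_function_inL2 phi : test_function Omega phi ->
  L2 phi /\ forall k, L2 (partial k phi).
Proof.
move=> [sphi _ _]; have [_ bO _] := hOmega.
have cont_L2 (f : 'rV[R]_d -> R) : continuous f -> L2 f.
  move=> cf; have [M fM] := compact_image_bounded cf bO.
  exact: (bounded_inL2 hOmega (continuous_measurable_rv cf) fM).
split; first by apply: cont_L2 => x; apply: differentiable_continuous; exact: (sphi [::]).
move=> k; apply: cont_L2 => x; apply: differentiable_continuous.
exact: (sphi [:: delta_mx ord0 k]).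
Qed.

Lemma smooth_linear (p : R) phi psi : smooth phi -> smooth psi ->
  smooth (fun x => p * phi x + psi x) /\
  forall s, foldr (fun v (h : 'rV[R]_d -> R) => 'D_v h) (fun x => p * phi x + psi x) s =
    (fun x => p * foldr (fun v (h : 'rV[R]_d -> R) => 'D_v h) phi s x +
              foldr (fun v (h : 'rV[R]_d -> R) => 'D_v h) psi s x).
Proof.
move=> sphi spsi.
have E : forall s, foldr (fun v (h : 'rV[R]_d -> R) => 'D_v h) (fun x => p * phi x + psi x) s =
    (fun x => p * foldr (fun v (h : 'rV[R]_d -> R) => 'D_v h) phi s x +
              foldr (fun v (h : 'rV[R]_d -> R) => 'D_v h) psi s x).
  elim=> [//|v s /= ->]; apply/funext => x.
  have d1 : derivable (foldr (fun v (h : 'rV[R]_d -> R) => 'D_v h) phi s) x v.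
    by apply: diff_derivable; exact: sphi.
  have d2 : derivable (foldr (fun v (h : 'rV[R]_d -> R) => 'D_v h) psi s) x v.
    by apply: diff_derivable; exact: spsi.
  have := deriveD (derivableZ (k := p) d1) d2.
  by rewrite deriveZ.
split=> // s x; rewrite E.
apply: (@differentiableD _ _ _
  (fun x => p * foldr (fun v (h : 'rV[R]_d -> R) => 'D_v h) phi s x)
  (foldr (fun v (h : 'rV[R]_d -> R) => 'D_v h) psi s)).
  apply: (@differentiableZ _ _ _ (foldr (fun v (h : 'rV[R]_d -> R) => 'D_v h) phi s)).
  exact: sphi.
exact: spsi.
Qed.

Lemma test_function_linear (p : R) phi psi :
  test_function Omega phi -> test_function Omega psi ->
  test_function Omega (fun x => p * phi x + psi x) /\
  forall k, partial k (fun x => p * phi x + psi x) =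
    (fun x => p * partial k phi x + partial k psi x).
Proof.
move=> [s1 c1 o1] [s2 c2 o2]; have [s12 E] := smooth_linear p s1 s2.
have sub : closure [set x | p * phi x + psi x != 0] `<=`
    closure [set x | phi x != 0] `|` closure [set x | psi x != 0].
  rewrite -closureU; apply: closure_subset => x /=.
  apply: contra_neqP => /not_orP[/negP/negPn/eqP -> /negP/negPn/eqP ->].
  by rewrite mulr0 addr0.
split; last by move=> k; exact: (E [:: delta_mx ord0 k]).
split => //.
- apply: subclosed_compact sub; first exact: closed_closure.
  exact: compactU.
- by move=> x /sub[/o1|/o2].
Qed.

Lemma H10_gradient_linear (p : R) u u' q q' :
  H10_gradient Omega u q -> H10_gradient Omega u' q' ->
  H10_gradient Omega (fun x => p * u x + u' x) (fun k x => p * q k x + q' k x).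
Proof.
move=> [uL qL [phi [tphi cu cq]]] [uL' qL' [phi' [tphi' cu' cq']]].
split; [exact: inL2_linear|by move=> k; exact: inL2_linear|].
exists (fun n x => p * phi n x + phi' n x).
have lim (F F' : nat -> 'rV[R]_d -> R) f f' :
    (forall n, L2 (F n)) -> (forall n, L2 (F' n)) -> L2 f -> L2 f' ->
    norm (fun x => F n x - f x) @[n --> \oo] --> (0 : R) ->
    norm (fun x => F' n x - f' x) @[n --> \oo] --> (0 : R) ->
    norm (fun x => (p * F n x + F' n x) - (p * f x + f' x)) @[n --> \oo] --> (0 : R).
  move=> FL FL' fL fL' cF cF'.
  have c0 : `|p| * norm (fun x => F n x - f x) + norm (fun x => F' n x - f' x)
      @[n --> \oo] --> (0 : R).
    by rewrite -[0]addr0 -[X in X + _](mulr0 `|p|); apply: cvgD => //; apply: cvgMr.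
  apply: (squeeze_cvgr _ (cvg_cst 0) c0); apply: nearW => n.
  rewrite normL2_ge0 /=.
  have -> : (fun x => p * F n x + F' n x - (p * f x + f' x)) =
     (fun x => p * (F n x - f x) + (F' n x - f' x)) by apply/funext => x; ring.
  by apply: normL2_linear; exact: inL2B.
have tL n := test_function_inL2 (tphi n); have tL' n := test_function_inL2 (tphi' n).
split.
- by move=> n; exact: (test_function_linear p (tphi n) (tphi' n)).1.
- by apply: lim => // n; [exact: (tL n).1|exact: (tL' n).1].
- move=> k; under eq_fun do rewrite (test_function_linear p (tphi _) (tphi' _)).2.
  by apply: lim => // n; [exact: (tL n).2|exact: (tL' n).2].
Qed.

Lemma patch_integral n (F G : 'I_n -> 'rV[R]_d -> R) :
  (forall k, L2 (F k)) -> (forall k, L2 (G k)) ->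
  \int[mu]_(x in Omega) (\sum_k F k x * G k x) = \sum_k inner (F k) (G k).
Proof.
move=> FL GL; rewrite Rintegral_mkcond.
transitivity (\int[mu]_x (\sum_k ((F k) \_ Omega) x * ((G k) \_ Omega) x)).
  apply: eq_Rintegral => x _; rewrite /patch; case: ifPn => // _.
  by rewrite big1 // => k _; rewrite (_ : point = 0 :> R) // mulr0.
rewrite {1}/Rintegral.
under eq_integral do rewrite -sumEFin.
rewrite (@integral_sum _ _ _ _ _ measurableT _
  (fun k x => (((F k) \_ Omega) x * ((G k) \_ Omega) x)%:E)); last first.
  by move=> k; exact: inner_integrable.
rewrite -sum_fine // => k _; apply: integrable_fin_num => //.
exact: inner_integrable.
Qed.

Lemma inner_cvg (F : nat -> 'rV[R]_d -> R) f g :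
  (forall n, L2 (F n)) -> L2 f -> L2 g ->
  norm (fun x => F n x - f x) @[n --> \oo] --> (0 : R) ->
  inner g (F n) @[n --> \oo] --> inner g f.
Proof.
move=> FL fL gL cF.
have c0 : norm g * norm (fun x => F n x - f x) @[n --> \oo] --> (0 : R).
  by rewrite -[0](mulr0 (norm g)); apply: cvgMr.
have lo : inner g f - norm g * norm (fun x => F n x - f x) @[n --> \oo] --> inner g f.
  by rewrite -[X in _ --> X]subr0; apply: cvgB => //; exact: cvg_cst.
have hi : inner g f + norm g * norm (fun x => F n x - f x) @[n --> \oo] --> inner g f.
  by rewrite -[X in _ --> X]addr0; apply: cvgD => //; exact: cvg_cst.
apply: (squeeze_cvgr _ lo hi); apply: nearW => n.
have := inner_cauchy_schwarz gL (inL2B (FL n) fL).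
have -> : inner g (fun x => F n x - f x) = inner g (F n) - inner g f.
  rewrite innerC (_ : (fun x => F n x - f x) = (fun x => -1 * f x + F n x)).
    by rewrite inner_linear // mulN1r addrC innerC (innerC _ f).
  by apply/funext => x; rewrite mulN1r addrC.
by rewrite ler_norml => /andP[? ?]; apply/andP; split; lra.
Qed.

(** The gradient [p] is an argument, so that the Dirichlet form can be written. *)
Definition weak_laplacian u h (p : 'I_d -> 'rV[R]_d -> R) :=
  [/\ L2 h, H10_gradient Omega u p & forall psi, test_function Omega psi ->
    \int[mu]_(x in Omega) (\sum_(k < d) p k x * partial k psi x) =
    \int[mu]_(x in Omega) (h x * psi x)].

Lemma weak_laplacianP u h :
  dirichlet_laplacian Omega u h <-> exists p, weak_laplacian u h p.
Proof.
split; first by move=> [hL [p [up H]]]; exists p; split.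
by move=> [p [hL up H]]; split=> //; exists p; split.
Qed.

Lemma weak_laplacian_form u h p : weak_laplacian u h p ->
  forall psi, test_function Omega psi -> \sum_k inner (p k) (partial k psi) = inner h psi.
Proof.
move=> [hL [uL pL _] H] psi tpsi; have [psiL dpsiL] := test_function_inL2 tpsi.
rewrite -patch_integral // H // Rintegral_mkcond; apply: eq_Rintegral => x _.
by rewrite /patch; case: ifPn => // _; rewrite (_ : point = 0 :> R) // mulr0.
Qed.

(** Green's formula.  The weak equation of [u] holds against the test functions that
    approximate [u'] in H1, and both sides pass to the limit. *)
Lemma dirichlet_form u h p u' h' p' :
  weak_laplacian u h p -> weak_laplacian u' h' p' ->
  inner h u' = \sum_k inner (p k) (p' k).
Proof.
move=> wu [hL' [uL' pL' [phi [tphi cu cp]]] _]; have [hL [uL pL _] _] := wu.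
have tL n := test_function_inL2 (tphi n).
have c1 : inner h (phi n) @[n --> \oo] --> inner h u'.
  by apply: inner_cvg => // n; exact: (tL n).1.
have c2 : \sum_k inner (p k) (partial k (phi n)) @[n --> \oo] -->
    \sum_k inner (p k) (p' k).
  by apply: cvg_big => [|k _]; [exact: add_continuous|apply: inner_cvg => // n; exact: (tL n).2].
have E : (fun n => \sum_k inner (p k) (partial k (phi n))) = (fun n => inner h (phi n)).
  by apply/funext => n; exact: (weak_laplacian_form wu (tphi n)).
rewrite E in c2; exact: (cvg_unique _ c1 c2).
Qed.

Lemma dirichlet_laplacian_sym u h u' h' :
  dirichlet_laplacian Omega u h -> dirichlet_laplacian Omega u' h' ->
  inner h u' = inner u h'.
Proof.
move=> /weak_laplacianP[p w] /weak_laplacianP[p' w'].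
rewrite (dirichlet_form w w') innerC (dirichlet_form w' w).
by apply: eq_bigr => k _; rewrite innerC.
Qed.

Lemma dirichlet_laplacian_ge0 u h : dirichlet_laplacian Omega u h -> 0 <= inner h u.
Proof.
move=> /weak_laplacianP[p w]; rewrite (dirichlet_form w w).
by apply: sumr_ge0 => k _; exact: inner_ge0.
Qed.

Lemma dirichlet_laplacian_inL2 u h : dirichlet_laplacian Omega u h -> L2 u /\ L2 h.
Proof. by move=> [hL [p [[uL _ _] _]]]. Qed.

Lemma dirichlet_laplacian_linear (a : R) u h u' h' :
  dirichlet_laplacian Omega u h -> dirichlet_laplacian Omega u' h' ->
  dirichlet_laplacian Omega (fun x => a * u x + u' x) (fun x => a * h x + h' x).
Proof.
move=> /weak_laplacianP[p w] /weak_laplacianP[p' w']; apply/weak_laplacianP.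
have [hL gu _] := w; have [hL' gu' _] := w'.
have [uL pL _] := gu; have [uL' pL' _] := gu'.
exists (fun k x => a * p k x + p' k x); split.
- exact: inL2_linear.
- exact: H10_gradient_linear.
move=> psi tpsi; have [psiL dpsiL] := test_function_inL2 tpsi.
rewrite patch_integral //; last by move=> k; exact: inL2_linear.
transitivity (inner (fun x => a * h x + h' x) psi); last first.
  rewrite Rintegral_mkcond; apply: eq_Rintegral => x _.
  by rewrite /patch; case: ifPn => // _; rewrite (_ : point = 0 :> R) // mulr0.
rewrite inner_linear // -(weak_laplacian_form w tpsi) -(weak_laplacian_form w' tpsi).
rewrite mulr_sumr -big_split /=; apply: eq_bigr => k _.
by rewrite inner_linear.
Qed.

End dirichlet_form.

(** * Complex-valued functions and resolvents *)

Section complex_L2.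
Context {R : realType} {d : nat}.
Variable Omega : set 'rV[R]_d.
Local Notation mu := (lebesgue_rv d).
Local Notation inner := (L2inner Omega).
Implicit Types (v w : 'rV[R]_d -> R[i]).

Definition reL2 v : 'rV[R]_d -> R := fun x => complex.Re (v x).
Definition imL2 v : 'rV[R]_d -> R := fun x => complex.Im (v x).

Definition innerC_re v w : R := inner (reL2 v) (reL2 w) + inner (imL2 v) (imL2 w).

Definition cinner v w : R[i] :=
  innerC_re v w +i* (inner (imL2 v) (reL2 w) - inner (reL2 v) (imL2 w)).

Lemma inL2C_linear (a : R[i]) v w : inL2C Omega v -> inL2C Omega w ->
  inL2C Omega (fun x => a * v x + w x).
Proof.
case: a => a b [v1 v2] [w1 w2]; split => /=.
  rewrite (_ : (fun _ => _) = (fun x => a * reL2 v x + (- b * imL2 v x + reL2 w x))).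
    by apply: inL2_linear => //; exact: inL2_linear.
  by apply/funext => x; rewrite /reL2 /imL2; case: (v x) (w x) => [? ?] [? ?] /=; ring.
rewrite (_ : (fun _ => _) = (fun x => a * imL2 v x + (b * reL2 v x + imL2 w x))).
  by apply: inL2_linear => //; exact: inL2_linear.
by apply/funext => x; rewrite /reL2 /imL2; case: (v x) (w x) => [? ?] [? ?] /=; ring.
Qed.

Lemma inL2C_0 : inL2C Omega (fun=> 0).
Proof. by split; exact: inL2_0. Qed.

Lemma inL2CZ (a : R[i]) v : inL2C Omega v -> inL2C Omega (fun x => a * v x).
Proof.
move=> vL; have := inL2C_linear a vL inL2C_0; congr (inL2C _ _).
by apply/funext => x; rewrite addr0.
Qed.

Lemma inL2CD v w : inL2C Omega v -> inL2C Omega w -> inL2C Omega (fun x => v x + w x).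
Proof.
move=> vL wL; have := inL2C_linear 1 vL wL; congr (inL2C _ _).
by apply/funext => x; rewrite mul1r.
Qed.

Lemma inL2CB v w : inL2C Omega v -> inL2C Omega w -> inL2C Omega (fun x => v x - w x).
Proof.
move=> vL wL; have := inL2C_linear (-1) wL vL; congr (inL2C _ _).
by apply/funext => x; rewrite mulN1r addrC.
Qed.

Lemma inL2C_sum n (F : 'I_n -> 'rV[R]_d -> R[i]) : (forall k, inL2C Omega (F k)) ->
  inL2C Omega (fun x => \sum_k F k x).
Proof.
elim: n F => [|n IH] F FL.
  rewrite (_ : (fun _ => _) = (fun=> 0)); first exact: inL2C_0.
  by apply/funext => x; rewrite big_ord0.
rewrite (_ : (fun _ => _) =
  (fun x => \sum_(k < n) F (widen_ord (leqnSn n) k) x + F ord_max x)).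
  by apply: inL2CD => //; exact: IH.
by apply/funext => x; rewrite big_ord_recr.
Qed.

Lemma inner_combine (a b : R) (f1 f2 f3 g : 'rV[R]_d -> R) :
  inL2 Omega f1 -> inL2 Omega f2 -> inL2 Omega f3 -> inL2 Omega g ->
  inner (fun x => a * f1 x + (b * f2 x + f3 x)) g =
  a * inner f1 g + b * inner f2 g + inner f3 g.
Proof.
move=> h1 h2 h3 hg; rewrite inner_linear // ?inner_linear ?addrA //.
exact: inL2_linear.
Qed.

Lemma cinner_linear (a : R[i]) v w z : inL2C Omega v -> inL2C Omega w -> inL2C Omega z ->
  cinner (fun x => a * v x + w x) z = a * cinner v z + cinner w z.
Proof.
case: a => a b [v1 v2] [w1 w2] [z1 z2].
have E1 : reL2 (fun x => (a +i* b) * v x + w x) =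
    (fun x => a * reL2 v x + (- b * imL2 v x + reL2 w x)).
  by apply/funext => x; rewrite /reL2 /imL2; case: (v x) (w x) => [? ?] [? ?] /=; ring.
have E2 : imL2 (fun x => (a +i* b) * v x + w x) =
    (fun x => a * imL2 v x + (b * reL2 v x + imL2 w x)).
  by apply/funext => x; rewrite /reL2 /imL2; case: (v x) (w x) => [? ?] [? ?] /=; ring.
rewrite /cinner /innerC_re E1 E2 !inner_combine //.
by apply/eqP; rewrite eq_complex /=; apply/andP; split; apply/eqP; ring.
Qed.

Lemma cinner_conj v w : cinner w v = (cinner v w)^*.
Proof.
rewrite /cinner /innerC_re /=; apply/eqP; rewrite eq_complex /=; apply/andP.
rewrite (innerC _ (reL2 w) (reL2 v)) (innerC _ (imL2 w) (imL2 v)).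
rewrite (innerC _ (imL2 w) (reL2 v)) (innerC _ (reL2 w) (imL2 v)).
by split; apply/eqP; ring.
Qed.

Lemma cinner_ge0 v : 0 <= cinner v v.
Proof.
rewrite /cinner lecE /= (innerC _ (imL2 v)) subrr eqxx /=.
by rewrite addr_ge0 // inner_ge0.
Qed.

Lemma normL2C_sqrt v : inL2C Omega v -> normL2C Omega v = Num.sqrt (innerC_re v v).
Proof.
move=> [v1 v2]; have i1 := inner_integrable v1 v1; have i2 := inner_integrable v2 v2.
rewrite /innerC_re /L2inner -RintegralD //; apply: normL2_sqrt.
  move=> x; rewrite /patch; case: ifPn => _; last first.
    by rewrite (_ : point = 0 :> R) // expr0n mulr0 addr0.
  rewrite /reL2 /imL2; case: (v x) => a b.
  rewrite /ComplexField.Normc.normc /= sqr_sqrtr ?addr_ge0 ?sqr_ge0 //.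
exact: (integrableD measurableT i1 i2).
Qed.

Lemma innerC_re_ge0 v : 0 <= innerC_re v v.
Proof. by rewrite addr_ge0 // inner_ge0. Qed.

Lemma normL2C_sq v : inL2C Omega v -> normL2C Omega v ^+ 2 = innerC_re v v.
Proof. by move=> vL; rewrite normL2C_sqrt // sqr_sqrtr // innerC_re_ge0. Qed.

Lemma normL2C_ge0 v : 0 <= normL2C Omega v.
Proof. exact: normL2_ge0. Qed.

Lemma cinner_sq v : inL2C Omega v -> cinner v v = (normL2C Omega v ^+ 2)%:C.
Proof.
move=> vL; rewrite normL2C_sq // /cinner (innerC _ (imL2 v)) subrr //.
Qed.

Lemma innerC_re_linear (p : R) v w z : inL2C Omega v -> inL2C Omega w -> inL2C Omega z ->
  innerC_re (fun x => p%:C * v x + w x) z = p * innerC_re v z + innerC_re w z.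
Proof.
move=> vL wL zL; have := congr1 (@complex.Re R) (cinner_linear p%:C vL wL zL).
by rewrite /= mul0r subr0.
Qed.

Lemma innerC_reC v w : innerC_re v w = innerC_re w v.
Proof. by rewrite /innerC_re innerC (innerC _ (imL2 v)). Qed.

Lemma innerC_re_cauchy_schwarz v w : inL2C Omega v -> inL2C Omega w ->
  `|innerC_re v w| <= normL2C Omega v * normL2C Omega w.
Proof.
move=> vL wL; rewrite !normL2C_sqrt //; apply: quadratic_cauchy_schwarz => a b.
have w0 := inL2CZ b%:C wL; have L := inL2C_linear a%:C vL w0.
have := innerC_re_ge0 (fun x => a%:C * v x + b%:C * w x).
have Z z : inL2C Omega z -> innerC_re (fun x => b%:C * w x) z = b * innerC_re w z.
  move=> zL; have z00 : innerC_re (fun=> 0) z = 0.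
    by rewrite /innerC_re /reL2 /imL2 /= !inner0 addr0.
  have := innerC_re_linear b wL inL2C_0 zL; rewrite z00 addr0 => <-.
  by congr innerC_re; apply/funext => x; rewrite addr0.
rewrite innerC_re_linear // Z // (innerC_reC v) (innerC_reC w (fun x => a%:C * v x + _)).
by rewrite !innerC_re_linear // !Z // (innerC_reC w v); lra.
Qed.

Lemma normL2C_eq v w : eqL2 Omega v w -> inL2C Omega v -> inL2C Omega w ->
  normL2C Omega v = normL2C Omega w.
Proof.
move=> vw vL wL; rewrite !normL2C_sqrt //; congr Num.sqrt.
have [v1 v2] := vL; have [w1 w2] := wL.
have e1 : {ae mu, forall x, Omega x -> reL2 v x = reL2 w x}.
  by move: vw; apply: filterS => x /[apply]; rewrite /reL2 => ->.
have e2 : {ae mu, forall x, Omega x -> imL2 v x = imL2 w x}.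
  by move: vw; apply: filterS => x /[apply]; rewrite /imL2 => ->.
rewrite /innerC_re (inner_eq e1) // (inner_eq e2) //.
by rewrite (innerC _ (reL2 w)) (innerC _ (imL2 w)) (inner_eq e1) // (inner_eq e2).
Qed.

Lemma normL2CZ (a : R[i]) v : inL2C Omega v ->
  normL2C Omega (fun x => a * v x) = nrm a * normL2C Omega v.
Proof.
move=> vL; have aL := inL2CZ a vL; apply/eqP.
rewrite -(eqrXn2 (n := 2)) ?mulr_ge0 ?nrm_ge0 ?normL2C_ge0 //.
have Z (w z : 'rV[R]_d -> R[i]) : inL2C Omega w -> inL2C Omega z ->
    cinner (fun x => a * w x) z = a * cinner w z.
  move=> wL zL; have z00 : cinner (fun=> 0) z = 0.
    by rewrite /cinner /innerC_re /reL2 /imL2 /= !inner0 addr0 subr0.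
  have := cinner_linear a wL inL2C_0 zL; rewrite z00 addr0 => <-.
  by congr cinner; apply/funext => x; rewrite addr0.
have : cinner (fun x => a * v x) (fun x => a * v x) = a * a^* * cinner v v.
  rewrite Z // cinner_conj Z // (cinner_sq vL) -mulrA; congr (_ * _).
  by case: (a) => a1 a2; apply/eqP; rewrite eq_complex /=; apply/andP; split; apply/eqP; ring.
rewrite !cinner_sq // -sqr_normc normE -rmorphXn -rmorphM => /complexI ->.
by rewrite exprMn.
Qed.

Lemma normL2CD v w : inL2C Omega v -> inL2C Omega w ->
  normL2C Omega (fun x => v x + w x) <= normL2C Omega v + normL2C Omega w.
Proof.
move=> vL wL; have L := inL2CD vL wL.
rewrite -(ler_pXn2r (n := 2)) ?nnegrE ?addr_ge0 ?normL2C_ge0 //.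
rewrite normL2C_sq //.
have E z : inL2C Omega z -> innerC_re (fun x => v x + w x) z = innerC_re v z + innerC_re w z.
  move=> zL; have := innerC_re_linear 1 vL wL zL; rewrite mul1r => <-.
  by congr innerC_re; apply/funext => x; rewrite mul1r.
rewrite E // (innerC_reC v) (innerC_reC w) !E // -!normL2C_sq // (innerC_reC w).
have := innerC_re_cauchy_schwarz vL wL; have := ler_norm (innerC_re v w).
lra.
Qed.

End complex_L2.

Section L2_space.
Context {R : realType} {d : nat}.
Variable Omega : set 'rV[R]_d.

Definition L2pred : {pred 'rV[R]_d -> R[i]^o} := [pred v | `[< inL2C Omega v >]].

Lemma L2pred_submod : submod_closed L2pred.
Proof.
split; first by apply/asboolP; exact: inL2C_0.
by move=> a v w /asboolP vL /asboolP wL; apply/asboolP; exact: inL2C_linear.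
Qed.

HB.instance Definition _ := GRing.isSubmodClosed.Build _ _ L2pred L2pred_submod.

(** Functions rather than classes modulo null sets: [cinner] is a semidefinite form
    on this vector space. *)
Record L2space := L2Space { L2val :> 'rV[R]_d -> R[i]^o; _ : L2val \in L2pred }.

HB.instance Definition _ := [isSub for L2val].
HB.instance Definition _ := [Choice of L2space by <:].
HB.instance Definition _ := [SubChoice_isSubLmodule of L2space by <:].

Lemma L2valP (v : L2space) : inL2C Omega v.
Proof. by have /asboolP := valP v. Qed.

Definition toL2 (v : 'rV[R]_d -> R[i]) (vL : inL2C Omega v) : L2space :=
  L2Space (introT (asboolP _) vL : (v : 'rV[R]_d -> R[i]^o) \in L2pred).

Lemma L2val_sum n (c : 'I_n -> R[i]) (F : 'I_n -> L2space) :
  (\sum_k c k *: F k : L2space) = (fun x => \sum_k c k * F k x) :> ('rV[R]_d -> R[i]).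
Proof.
elim: n c F => [|n IH] c F.
  by rewrite big_ord0; apply/funext => x; rewrite big_ord0.
rewrite big_ord_recr /=; apply/funext => x; rewrite big_ord_recr /=.
have /(congr1 (@^~ x)) := IH (c \o widen_ord (leqnSn n)) (F \o widen_ord (leqnSn n)).
by rewrite /= => <-.
Qed.

Hypothesis hOmega : convex_polytopal_domain Omega.

Lemma laplacianC_linear (a : R[i]) u h u' h' :
  dirichlet_laplacianC Omega u h -> dirichlet_laplacianC Omega u' h' ->
  dirichlet_laplacianC Omega (fun x => a * u x + u' x) (fun x => a * h x + h' x).
Proof.
case: a => a b [u1 u2] [u1' u2'].
have E1 (v w : 'rV[R]_d -> R[i]) : (fun x => complex.Re ((a +i* b) * v x + w x)) =
    (fun x => a * complex.Re (v x) + (- b * complex.Im (v x) + complex.Re (w x))).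
  by apply/funext => x; case: (v x) (w x) => [? ?] [? ?] /=; ring.
have E2 (v w : 'rV[R]_d -> R[i]) : (fun x => complex.Im ((a +i* b) * v x + w x)) =
    (fun x => a * complex.Im (v x) + (b * complex.Re (v x) + complex.Im (w x))).
  by apply/funext => x; case: (v x) (w x) => [? ?] [? ?] /=; ring.
split; rewrite ?E1 ?E2.
  by apply: dirichlet_laplacian_linear => //; exact: dirichlet_laplacian_linear.
by apply: dirichlet_laplacian_linear => //; exact: dirichlet_laplacian_linear.
Qed.

Lemma laplacianC_sym u h u' h' :
  dirichlet_laplacianC Omega u h -> dirichlet_laplacianC Omega u' h' ->
  cinner Omega h u' = cinner Omega u h'.
Proof.
move=> [u1 u2] [u1' u2']; rewrite /cinner /innerC_re /reL2 /imL2.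
rewrite (dirichlet_laplacian_sym hOmega u1 u1') (dirichlet_laplacian_sym hOmega u1 u2').
by rewrite (dirichlet_laplacian_sym hOmega u2 u1') (dirichlet_laplacian_sym hOmega u2 u2').
Qed.

Lemma laplacianC_ge0 u h : dirichlet_laplacianC Omega u h -> 0 <= cinner Omega h u.
Proof.
move=> [u1 u2]; rewrite /cinner /innerC_re /reL2 /imL2 lecE /=.
rewrite (dirichlet_laplacian_sym hOmega u2 u1) innerC subrr eqxx /=.
by rewrite addr_ge0 // dirichlet_laplacian_ge0.
Qed.

Lemma laplacianC_inL2 u h : dirichlet_laplacianC Omega u h ->
  inL2C Omega u /\ inL2C Omega h.
Proof.
by move=> [/dirichlet_laplacian_inL2[? ?] /dirichlet_laplacian_inL2[? ?]].
Qed.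

(** [resolvent_combination] for the graph of the Dirichlet Laplacian in
    [L2space]. *)
Theorem resolvent_combination_norm n (v : 'rV[R]_d -> R[i])
    (r : 'I_n -> 'rV[R]_d -> R[i]) (g c : 'I_n -> R[i]) (M : R) :
  inL2C Omega v ->
  (forall k, is_resolvent Omega (g k) v (r k)) ->
  (forall k (l : R), 0 <= l -> g k + l%:C != 0) ->
  (forall l : R, 0 <= l -> nrm (\sum_k c k / (g k + l%:C)) <= M) ->
  normL2C Omega (fun x => \sum_k c k * r k x) <= M * normL2C Omega v.
Proof.
move=> vL rv g0 cM.
have rL k : inL2C Omega (r k) by have [_ /laplacianC_inL2[]] := rv k.
pose X := L2space; pose V : X := toL2 vL; pose r' k : X := toL2 (rL k).
pose ip (x y : X) := cinner Omega x y.
have ipl a x y z : ip (a *: x + y) z = a * ip x z + ip y z.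
  exact: cinner_linear (L2valP x) (L2valP y) (L2valP z).
have ipc x y : ip y x = Num.conj (ip x y) by exact: cinner_conj.
have ip0 x : 0 <= ip x x by exact: cinner_ge0.
pose graph (x y : X) := dirichlet_laplacianC Omega x y.
have M0 : 0 <= M by apply: le_trans (nrm_ge0 _) (cM 0 (lexx 0)).
have := @resolvent_combination _ X ip ipl ipc ip0 graph _ _ _ n V r' g c M%:C _ _ _.
rewrite /ip cinner_sq; last exact: L2valP.
rewrite cinner_sq // L2val_sum -rmorphXn -rmorphM lecR /= => H.
rewrite -(ler_pXn2r (n := 2)) ?nnegrE ?mulr_ge0 ?normL2C_ge0 // exprMn.
apply: H.
- by move=> a x h y k; exact: laplacianC_linear.
- by move=> x h y k; exact: laplacianC_sym.
- by move=> x h; exact: laplacianC_ge0.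
- by move=> k; have [_] := rv k.
- move=> k l l0; have lE : l = (complex.Re l)%:C.
    by rewrite RRe_real // ger0_real.
  by rewrite lE g0 // -ler0c -lE.
- move=> l l0; have lE : l = (complex.Re l)%:C.
    by rewrite RRe_real // ger0_real.
  by rewrite normE lecR lE cM // -ler0c -lE.
Qed.

End L2_space.

(** * Upper bounds for Bochner integrals *)

Section bochner_bounds.
Context {R : realType} {d : nat}.
Variable Omega : set 'rV[R]_d.
Local Notation leb := (@lebesgue_measure R).
Local Notation ire := (innerC_re Omega).
Local Notation norm := (normL2C Omega).

Lemma innerC_re_sum n (c : 'I_n -> R) (v : 'I_n -> 'rV[R]_d -> R[i]) phi :
  (forall k, inL2C Omega (v k)) -> inL2C Omega phi ->
  ire (fun x => \sum_k (c k)%:C * v k x) phi = \sum_k c k * ire (v k) phi.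
Proof.
elim: n c v => [|n IH] c v vL phiL.
  rewrite big_ord0 (_ : (fun _ => _) = (fun=> 0)).
    by rewrite /innerC_re /reL2 /imL2 /= !inner0 addr0.
  by apply/funext => x; rewrite big_ord0.
rewrite big_ord_recr /= -IH //.
rewrite (_ : (fun _ => _) = (fun x => (c ord_max)%:C * v ord_max x +
   \sum_(k < n) (c (widen_ord (leqnSn n) k))%:C * v (widen_ord (leqnSn n) k) x)).
  rewrite innerC_re_linear // 1?addrC //.
  by apply: inL2C_sum => k; exact: inL2CZ.
by apply/funext => x; rewrite big_ord_recr /= addrC.
Qed.

Lemma innerC_re_cvg (F : nat -> 'rV[R]_d -> R[i]) w phi :
  (forall n, inL2C Omega (F n)) -> inL2C Omega w -> inL2C Omega phi ->
  norm (fun x => F n x - w x) @[n --> \oo] --> (0 : R) ->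
  ire (F n) phi @[n --> \oo] --> ire w phi.
Proof.
move=> FL wL pL cF.
pose e n := norm (fun x => F n x - w x) * norm phi.
have e0 : e n @[n --> \oo] --> (0 : R).
  by rewrite -[0](mul0r (norm phi)); apply: cvgM => //; exact: cvg_cst.
have lo : ire w phi - e n @[n --> \oo] --> ire w phi.
  by rewrite -[X in _ --> X]subr0; apply: cvgB => //; exact: cvg_cst.
have hi : ire w phi + e n @[n --> \oo] --> ire w phi.
  by rewrite -[X in _ --> X]addr0; apply: cvgD => //; exact: cvg_cst.
apply: (squeeze_cvgr _ lo hi); apply: nearW => n.
have := innerC_re_cauchy_schwarz (inL2CB (FL n) wL) pL.
have -> : ire (fun x => F n x - w x) phi = ire (F n) phi - ire w phi.
  have := innerC_re_linear (-1) wL (FL n) pL; rewrite mulN1r addrC => <-.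
  by congr (ire _ phi); apply/funext => x; rewrite rmorphN1 mulN1r addrC.
by rewrite -/(e n) ler_norml => /andP[? ?]; apply/andP; split; lra.
Qed.

Lemma indic_integrable (A D : set (measurableTypeR R)) (a : R) :
  measurable A -> measurable D -> (leb A < +oo)%E ->
  leb.-integrable D (EFin \o (fun r => \1_A r * a)).
Proof.
move=> mA mD fA.
have : leb.-integrable D (EFin \o \1_A).
  apply/integrableP; split; first exact/measurable_EFinP.
  under eq_integral do rewrite /= ger0_norm //.
  rewrite integral_indic //; apply: le_lt_trans fA; apply: le_measure => //; rewrite inE //.
  exact: measurableI.
move=> /(integrableZr mD a); exact: eq_integrable.
Qed.

Lemma indic_Rintegral (A D : set (measurableTypeR R)) (a : R) :
  measurable A -> measurable D -> (leb A < +oo)%E ->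
  \int[leb]_(r in D) (\1_A r * a) = fine (leb (A `&` D)) * a.
Proof.
move=> mA mD fA; have := indic_integrable 1 mA mD fA => i1.
rewrite RintegralZr //; last first.
  by move: i1; apply: eq_integrable => // r _ /=; rewrite mulr1.
by rewrite {1}/Rintegral integral_indic.
Qed.

Lemma indic_sum n (A : 'I_n -> set (measurableTypeR R)) (D : set (measurableTypeR R))
    (a : 'I_n -> R) :
  measurable D -> (forall k, measurable (A k)) -> (forall k, (leb (A k) < +oo)%E) ->
  leb.-integrable D (EFin \o (fun r => \sum_k \1_(A k) r * a k)) /\
  \int[leb]_(r in D) (\sum_k \1_(A k) r * a k) = \sum_k fine (leb (A k `&` D)) * a k.
Proof.
move=> mD; elim: n A a => [|n IH] A a mA fA.
  have E : (fun r => \sum_(k < 0) \1_(A k) r * a k) = (fun=> 0).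
    by apply/funext => r; rewrite big_ord0.
  rewrite E big_ord0; split; first exact: integrable0.
  by rewrite /Rintegral integral0.
have [i1 E1] := IH (fun k => A (widen_ord (leqnSn n) k))
  (fun k => a (widen_ord (leqnSn n) k)) (fun k => mA _) (fun k => fA _).
have i2 := indic_integrable (a ord_max) (mA ord_max) mD (fA ord_max).
have E : (fun r => \sum_(k < n.+1) \1_(A k) r * a k) =
  (fun r => \sum_(k < n) \1_(A (widen_ord (leqnSn n) k)) r * a (widen_ord (leqnSn n) k) +
     \1_(A ord_max) r * a ord_max).
  by apply/funext => r; rewrite big_ord_recr.
rewrite E; split; first exact: (integrableD mD i1 i2).
by rewrite RintegralD // E1 indic_Rintegral // big_ord_recr.
Qed.

(** The comparison is made on the approximating simple functions [S n], whose
    integral paired with [phi] is the Lebesgue integral of a step function at most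
    [p + norm phi * dist n]; the integral of the second term tends to zero. *)
Lemma bochner_upper_bound (D : set (measurableTypeR R)) F w phi (p : R -> R) :
  is_Bochner_integral Omega D F w -> measurable D -> inL2C Omega phi ->
  leb.-integrable D (EFin \o p) -> (forall r, D r -> ire (F r) phi <= p r) ->
  ire w phi <= \int[leb]_(r in D) p r.
Proof.
move=> [wL FL [S /= [md id cw]]] mD pL ip Fp.
pose e n r := norm (fun x => F r x - simple_eval (S n) r x).
have {}md n : measurable_fun D (e n) by exact: md.
have {}id : (\int[leb]_(r in D) (e n r)%:E)%E @[n --> \oo] --> 0%E by exact: id.
have vL n := @simple_val_L2 _ _ _ (S n).
have SL n : inL2C Omega (simple_integral D (S n)).
  by apply: inL2C_sum => k; exact: inL2CZ.
have SeL n r : inL2C Omega (simple_eval (S n) r).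
  by apply: inL2C_sum => k; exact: inL2CZ.
have lhs := innerC_re_cvg SL wL pL cw.
pose E n := fine (\int[leb]_(r in D) (e n r)%:E)%E.
have cE : E n @[n --> \oo] --> (0 : R) by exact: (fine_cvg id).
have rhs : \int[leb]_(r in D) p r + norm phi * E n @[n --> \oo] -->
    \int[leb]_(r in D) p r.
  rewrite -[X in _ --> X]addr0 -[X in _ --> _ + X](mulr0 (norm phi)).
  by apply: cvgD; [exact: cvg_cst|apply: cvgMr].
apply: ler_cvg_to lhs rhs _.
have fin : \forall n \near \oo, (\int[leb]_(r in D) (e n r)%:E)%E \is a fin_num.
  by have /fine_cvgP[] := id.
near=> n.
have en0 r : 0 <= e n r by exact: normL2C_ge0.
have ie : leb.-integrable D (EFin \o e n).
  apply/integrableP; split; first exact/measurable_EFinP.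
  under eq_integral do rewrite /= ger0_norm //.
  have : (\int[leb]_(r in D) (e n r)%:E)%E \is a fin_num by near: n.
  by rewrite fin_numElt => /andP[].
have [iS ES] := indic_sum (fun k => ire (simple_val (s := S n) k) phi) mD
  (@simple_set_measurable _ _ _ (S n)) (@simple_set_finite _ _ _ (S n)).
rewrite /simple_integral innerC_re_sum // -ES.
have iep : leb.-integrable D (EFin \o (fun r => norm phi * e n r)).
  have := integrableZl mD (norm phi) ie; exact: eq_integrable.
rewrite -[X in _ + X]RintegralZl // -RintegralD //.
apply: le_Rintegral => //; first exact: (integrableD mD ip iep).
move=> r Dr.
have -> : \sum_k \1_(simple_set (s := S n) k) r * ire (simple_val (s := S n) k) phi =
    ire (simple_eval (S n) r) phi by rewrite /simple_eval innerC_re_sum.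
have := innerC_re_cauchy_schwarz (inL2CB (FL r Dr) (SeL n r)) pL.
have -> : ire (fun x => F r x - simple_eval (S n) r x) phi =
    ire (F r) phi - ire (simple_eval (S n) r) phi.
  have := innerC_re_linear (-1) (SeL n r) (FL r Dr) pL; rewrite mulN1r addrC => <-.
  by congr (ire _ phi); apply/funext => x; rewrite rmorphN1 mulN1r addrC.
rewrite -/(e n r) ler_norml => /andP[? _]; have := Fp r Dr; lra.
Unshelve. all: by end_near.
Qed.

(** The majorant is the step function with the value at the left end of each
    interval, increased by the oscillation [eps], and [q] outside the grid. *)
Lemma bochner_riemann_bound (D : set (measurableTypeR R)) F w phi (x : nat -> R) n
    (eps : R) (q : R -> R) :
  is_Bochner_integral Omega D F w -> measurable D -> inL2C Omega phi ->
  (forall k, (k < n)%N -> x k < x k.+1) ->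
  (forall k r, (k < n)%N -> x k <= r < x k.+1 -> D r) ->
  (forall k r, (k < n)%N -> x k <= r < x k.+1 ->
    norm (fun y => F r y - F (x k) y) <= eps) ->
  leb.-integrable D (EFin \o q) -> (forall r, 0 <= q r) ->
  (forall r, D r -> ~~ (x 0%N <= r < x n) -> ire (F r) phi <= q r) ->
  ire w phi <= \sum_(k < n) (x k.+1 - x k) * ire (F (x k)) phi +
    (x n - x 0%N) * (eps * norm phi) + \int[leb]_(r in D) q r.
Proof.
move=> BI mD pL xlt xD Feps iq q0 Fq.
have FL : forall r, D r -> inL2C Omega (F r) by case: BI.
pose c (k : 'I_n) := ire (F (x k)) phi + eps * norm phi.
pose A (k : 'I_n) : set (measurableTypeR R) := `[x k, x k.+1[%classic.
have mA k : measurable (A k) by exact: measurable_itv.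
have lA k : leb (A k) = (x k.+1 - x k)%:E.
  by rewrite /A lebesgue_measure_itv /= lte_fin xlt // EFinN.
have fA k : (leb (A k) < +oo)%E by rewrite lA ltry.
have [i1 E1] := indic_sum c mD mA fA.
apply: le_trans (bochner_upper_bound BI mD pL
  (p := fun r => \sum_k \1_(A k) r * c k + q r) (integrableD mD i1 iq) _) _.
  move=> r Dr; have [x0n|x0n] := boolP (x 0%N <= r < x n); last first.
    rewrite big1 ?add0r; first exact: Fq.
    move=> k _; rewrite indicE memNset ?mul0r // /A /= in_itv /= => xr.
    case/negP: x0n; move: xr => /andP[xr rx].
    have mono i j : (i <= j <= n)%N -> x i <= x j.
      move=> /andP[]; elim: j => [|j IH]; first by rewrite leqn0 => /eqP ->.
      rewrite leq_eqVlt => /predU1P[->//|ij jn].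
      by apply: le_trans (IH ij (ltnW jn)) (ltW (xlt _ jn)).
    rewrite (le_trans (mono 0%N k _)) //=; last exact: ltnW.
    by apply: lt_le_trans rx _; apply: mono; rewrite leqnn ltn_ord.
  have [k [kn kr]] : exists k, (k < n)%N /\ x k <= r < x k.+1.
    have /andP[x0 xn] := x0n.
    elim: n {xlt xD Feps Fq c A mA lA fA i1 E1 x0n} xn => [|m IH] xn; first by lra.
    have [rm|mr] := ltP r (x m).
      by have [k [km kr]] := IH rm; exists k; split=> //; exact: ltnW.
    by exists m; rewrite ltnSn mr xn.
  have c1 : ire (F r) phi <= c (Ordinal kn).
    have Dk : D (x k) by apply: (xD k) => //; rewrite lexx xlt.
    have := innerC_re_cauchy_schwarz (inL2CB (FL r Dr) (FL _ Dk)) pL.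
    have -> : ire (fun y => F r y - F (x k) y) phi = ire (F r) phi - ire (F (x k)) phi.
      have := innerC_re_linear (-1) (FL _ Dk) (FL r Dr) pL; rewrite mulN1r addrC => <-.
      by congr (ire _ phi); apply/funext => y; rewrite rmorphN1 mulN1r addrC.
    have := ler_wpM2r (normL2C_ge0 Omega phi) (Feps k r kn kr).
    by rewrite ler_norml /c /= => ? /andP[? ?]; lra.
  apply: le_trans c1 _; rewrite (bigD1 (Ordinal kn)) //= big1 ?addr0.
    rewrite indicE mem_set ?mul1r ?lerDl // /A /= in_itv /=; exact: kr.
  move=> j jk; rewrite indicE memNset ?mul0r // /A /= in_itv /= => jr.
  have mono i l : (i <= l <= n)%N -> x i <= x l.
    move=> /andP[]; elim: l => [|l IH]; first by rewrite leqn0 => /eqP ->.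
    rewrite leq_eqVlt => /predU1P[->//|il ln].
    by apply: le_trans (IH il (ltnW ln)) (ltW (xlt _ ln)).
  move: jk; rewrite -val_eqE /= neq_ltn => /orP[jk|kj].
    have := mono j.+1 k; rewrite jk ltnW // => /(_ isT).
    by move: jr kr => /andP[? ?] /andP[? ?]; lra.
  have := mono k.+1 j; rewrite kj ltnW ?ltn_ord // => /(_ isT).
  by move: jr kr => /andP[? ?] /andP[? ?]; lra.
rewrite RintegralD // E1 lerD2r.
have AD k : A k `&` D = A k.
  apply/setIidPl => r; rewrite /A /= in_itv /=; exact: (xD k r (ltn_ord k)).
under eq_bigr do rewrite AD lA /= /c mulrDr.
rewrite big_split /= lerD2l -mulr_suml.
rewrite -(big_mkord xpredT (fun k => x k.+1 - x k)) telescope_sumr //.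
Qed.

End bochner_bounds.

(** * The contour integral *)

Section polar_coordinates.
Context {R : realType}.

Lemma polar_cexp (rho psi : R) : 0 < rho -> polar rho psi = cexp (ln rho +i* psi).
Proof. by move=> rho0; rewrite /cexp /= lnK. Qed.

Lemma carg_polar (rho psi : R) : 0 < rho -> `|psi| < pi -> carg (polar rho psi) = psi.
Proof.
move=> rho0; rewrite ltr_norml => /andP[p1 p2].
rewrite /carg nrm_polar gtr0_norm // /polar /=.
have -> : rho * cos psi / rho = cos psi by field; rewrite gt_eqF.
have [psi0|psi0] := leP 0 psi.
  rewrite mulr_ge0 ?(ltW rho0) ?sin_ge0_pi ?psi0 ?(ltW p2) //.
  by rewrite cosK // in_itv /= psi0 ltW.
rewrite leNgt pmulr_rlt0 //.
have -> : sin psi < 0.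
  rewrite -oppr_gt0 -sinN; apply: sin_gt0_pi; apply/andP; split; lra.
by rewrite /= cosKN ?opprK // ltW //= ltW.
Qed.

Lemma cpow_cexp (z : R[i]) a : `|complex.Im z| < pi -> cpow (cexp z) a = cexp (a%:C * z).
Proof.
case: z => s p /= pp; rewrite /cpow {1 2}/cexp /= carg_polar ?expR_gt0 //.
rewrite nrm_polar ger0_norm ?expR_ge0 // -expRM /cexp /= !mul0r subr0 addr0.
by rewrite [s * a]mulrC.
Qed.

Variables (gamma alpha : R).
Hypotheses (hgamma : 0 < gamma) (halpha : 0 < alpha < 1).

Lemma cexp_neq0 (z : R[i]) : cexp z != 0.
Proof. by rewrite -nrm_gt0 nrm_cexp expR_gt0. Qed.

Lemma gfun_cexp (z : R[i]) : `|complex.Im z| < pi ->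
  gfun gamma alpha (cexp z) = (symbol gamma alpha z)^-1.
Proof.
move=> zp; rewrite /gfun cpow_cexp //.
have -> : symbol gamma alpha z = cexp (- z) * (1 + gamma%:C * cexp (alpha%:C * z)).
  rewrite /symbol mulrDr mulr1 mulrCA -cexpD; congr (_ + _ * cexp _).
  by rewrite rmorphB /=; ring.
by rewrite invfM cexpN invrK.
Qed.

Lemma one_symbol_neq0 (z : R[i]) (l : R) : 0 <= l -> `|complex.Im z| < pi ->
  1 + l%:C * symbol gamma alpha z != 0.
Proof.
move=> l0 zp; rewrite -nrm_gt0.
apply: lt_le_trans (kernel_denominator hgamma halpha l0 (ltW zp)).
have c0 : 0 < cos (complex.Im z / 2).
  by move: zp; rewrite ltr_norml => /andP[? ?]; apply: cos_gt0_pihalf; apply/andP; split; lra.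
by rewrite mulr_gt0 // ltr_wpDr // mulr_ge0 // expR_ge0.
Qed.

(** If the symbol vanished, [kernel_denominator] would bound
    [cos (psi / 2) * (1 + l * exp (- s))] by 1 for every [l >= 0]. *)
Lemma symbol_neq0 (z : R[i]) : `|complex.Im z| < pi -> symbol gamma alpha z != 0.
Proof.
move=> zp; apply/negP => /eqP y0.
have c0 : 0 < cos (complex.Im z / 2).
  by move: zp; rewrite ltr_norml => /andP[? ?]; apply: cos_gt0_pihalf; apply/andP; split; lra.
pose l := expR (complex.Re z) / cos (complex.Im z / 2).
have l0 : 0 <= l by rewrite divr_ge0 ?expR_ge0 // ltW.
have := kernel_denominator hgamma halpha l0 (ltW zp).
rewrite y0 mulr0 addr0 nrm1 /l expRN mulrDr mulr1.
have -> : cos (complex.Im z / 2) *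
   (expR (complex.Re z) / cos (complex.Im z / 2) * (expR (complex.Re z))^-1) = 1.
  by field; rewrite !gt_eqF ?expR_gt0.
by lra.
Qed.

End polar_coordinates.

Section solution_operator.
Context {R : realType} {d : nat}.
Variables (Omega : set 'rV[R]_d) (gamma alpha theta delta t : R).
Hypotheses (hOmega : convex_polytopal_domain Omega).
Hypotheses (hgamma : 0 < gamma) (halpha : 0 < alpha < 1).
Hypotheses (htheta : pi / 2 < theta < pi) (hdelta : 0 < delta) (ht : 0 < t).
Local Notation norm := (normL2C Omega).
Variables (v : 'rV[R]_d -> R[i]) (r : R[i] -> 'rV[R]_d -> R[i]).
Hypothesis vL : inL2C Omega v.
Hypothesis rP : forall z, contour theta delta z ->
  is_resolvent Omega (gfun gamma alpha z) v (r z).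

Let thpi : theta < pi. Proof. by case/andP: htheta. Qed.
Let th0 : 0 < theta.
Proof. by case/andP: htheta => h _; have := @pi_gt0 R; lra. Qed.

(** The integrand of the solution operator in the coordinate [ln z], where [dz / z]
    becomes the differential of the coordinate. *)
Definition contour_node (z : R[i]) (x : 'rV[R]_d) : R[i] :=
  cexp (t%:C * cexp z) * (symbol gamma alpha z)^-1 * r (cexp z) x.
Local Notation node := contour_node.

Definition on_contour (z : R[i]) := contour theta delta (cexp z) /\ `|complex.Im z| <= theta.

Lemma on_contour_up (rho : R) : delta <= rho -> on_contour (ln rho +i* theta).
Proof.
move=> dr; have r0 := lt_le_trans hdelta dr; split; last by rewrite /= gtr0_norm.
by left; exists rho => //; left; rewrite polar_cexp.
Qed.

Lemma on_contour_low (rho : R) : delta <= rho -> on_contour (ln rho +i* (- theta)).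
Proof.
move=> dr; have r0 := lt_le_trans hdelta dr; split; last by rewrite /= normrN gtr0_norm.
by left; exists rho => //; right; rewrite polar_cexp.
Qed.

Lemma on_contour_arc (psi : R) : `|psi| <= theta -> on_contour (ln delta +i* psi).
Proof.
by move=> pt; split => //; right; exists psi => //; rewrite polar_cexp.
Qed.

Lemma resolvent_inL2 z : contour theta delta z -> inL2C Omega (r z).
Proof. by move=> /rP[_ /laplacianC_inL2[]]. Qed.

Lemma node_inL2 z : on_contour z -> inL2C Omega (node z).
Proof. by move=> [cz _]; apply: inL2CZ; exact: resolvent_inL2. Qed.

(** [contour_kernel] at [l] is the factor by which a node acts on an eigenvector of
    eigenvalue [l].  The index type is arbitrary so that the rays and the arc can be
    treated as one family. *)
Lemma node_combination (I : finType) (c : I -> R[i]) (z : I -> R[i]) (M : R) :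
  (forall i, on_contour (z i)) ->
  (forall l : R, 0 <= l -> nrm (\sum_i c i * contour_kernel gamma alpha t l (z i)) <= M) ->
  norm (fun x => \sum_i c i * node (z i) x) <= M * norm v.
Proof.
move=> zc cM.
have zp i : `|complex.Im (z i)| < pi by have [_ h] := zc i; exact: le_lt_trans h thpi.
pose e := @enum_val I predT.
have -> : (fun x => \sum_i c i * node (z i) x) = (fun x => \sum_(k < #|I|)
   (c (e k) * (cexp (t%:C * cexp (z (e k))) * (symbol gamma alpha (z (e k)))^-1))
     * r (cexp (z (e k))) x).
  apply/funext => x; rewrite (big_enum_val (A := predT) (fun i => c i * node (z i) x)).
  by apply: eq_bigr => k _; rewrite /contour_node mulrA.
apply: (resolvent_combination_norm hOmega (g := fun k => (symbol gamma alpha (z (e k)))^-1)) => //.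
- by move=> k; rewrite -gfun_cexp //; apply: rP; have [] := zc (e k).
- move=> k l l0.
  have y0 := symbol_neq0 hgamma halpha (zp (e k)).
  have -> : (symbol gamma alpha (z (e k)))^-1 + l%:C =
     (1 + l%:C * symbol gamma alpha (z (e k))) / symbol gamma alpha (z (e k)) by field.
  by rewrite mulf_neq0 ?invr_neq0 // one_symbol_neq0.
- move=> l l0; apply: le_trans _ (cM l l0); rewrite le_eqVlt; apply/orP; left; apply/eqP.
  congr (nrm _); rewrite (big_enum_val (A := predT) (fun i => c i * contour_kernel gamma alpha t l (z i))).
  apply: eq_bigr => k _; rewrite /contour_kernel -/(e k).
  have y0 := symbol_neq0 hgamma halpha (zp (e k)).
  have p0 := one_symbol_neq0 hgamma halpha l0 (zp (e k)).
  have -> : (symbol gamma alpha (z (e k)))^-1 + l%:C =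
     (1 + l%:C * symbol gamma alpha (z (e k))) / symbol gamma alpha (z (e k)) by field.
  by rewrite invfM invrK; field; rewrite p0 y0.
Qed.

Lemma node_scaled_difference z w (a b M : R) : on_contour z -> on_contour w ->
  (forall l : R, 0 <= l -> nrm (a%:C * contour_kernel gamma alpha t l z -
                            b%:C * contour_kernel gamma alpha t l w) <= M) ->
  norm (fun x => a%:C * node z x - b%:C * node w x) <= M * norm v.
Proof.
move=> zc wc H.
have := @node_combination bool (fun i => if i then a%:C else - b%:C)
  (fun i => if i then z else w) M _ _.
have -> : (fun x => \sum_i (if i then a%:C else - b%:C) * node (if i then z else w) x) =
   (fun x => a%:C * node z x - b%:C * node w x).
  by apply/funext => x; rewrite big_bool /= mulNr.
apply; first by case.
by move=> l l0; rewrite big_bool /= mulNr; exact: H.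
Qed.

Lemma node_scaled_bound z (a M : R) : on_contour z ->
  (forall l : R, 0 <= l -> nrm (a%:C * contour_kernel gamma alpha t l z) <= M) ->
  norm (fun x => a%:C * node z x) <= M * norm v.
Proof.
move=> zc H; have := @node_combination unit (fun=> a%:C) (fun=> z) M _ _.
have -> : (fun x => \sum_(i : unit) a%:C * node z x) = (fun x => a%:C * node z x).
  by apply/funext => x; rewrite big_const card_unit /= addr0.
apply=> // l l0; rewrite big_const card_unit /= addr0; exact: H.
Qed.

End solution_operator.

Section contour_pieces.
Context {R : realType} {d : nat}.
Variables (Omega : set 'rV[R]_d) (gamma alpha theta delta t : R).
Hypotheses (hOmega : convex_polytopal_domain Omega).
Hypotheses (hgamma : 0 < gamma) (halpha : 0 < alpha < 1).
Hypotheses (htheta : pi / 2 < theta < pi) (hdelta : 0 < delta) (ht : 0 < t).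
Local Notation norm := (normL2C Omega).
Local Notation ire := (innerC_re Omega).
Local Notation leb := (@lebesgue_measure R).
Local Notation K := (contour_kernel gamma alpha t).
Variables (v : 'rV[R]_d -> R[i]) (r : R[i] -> 'rV[R]_d -> R[i]).
Hypothesis vL : inL2C Omega v.
Hypothesis rP : forall z, contour theta delta z ->
  is_resolvent Omega (gfun gamma alpha z) v (r z).
Local Notation node := (contour_node gamma alpha t r).

Let thpi : theta < pi. Proof. by case/andP: htheta. Qed.
Let th0 : 0 < theta.
Proof. by case/andP: htheta => h _; have := @pi_gt0 R; lra. Qed.

Let F (z : R[i]) (x : 'rV[R]_d) : R[i] :=
  cexp (z * t%:C) * (gfun gamma alpha z / z) * r z x.

(** The factor [1 / rho] comes from [drho = rho * d(ln rho)]. *)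
Lemma integrand_ray (rho psi : R) : 0 < rho -> `|psi| < pi ->
  (fun x => polar 1 psi * F (polar rho psi) x) =
  (fun x => (rho^-1)%:C * node (ln rho +i* psi) x).
Proof.
move=> rho0 pp; apply/funext => x; rewrite /F /contour_node (polar_cexp _ rho0) gfun_cexp //.
have -> : polar 1 psi = (rho^-1)%:C * cexp (ln rho +i* psi).
  rewrite -polar_cexp // /polar; apply/eqP; rewrite eq_complex /=.
  by apply/andP; split; apply/eqP; field; rewrite gt_eqF.
have := cexp_neq0 (ln rho +i* psi); rewrite [cexp _ * t%:C]mulrC => c0.
have := symbol_neq0 hgamma halpha (z := ln rho +i* psi) pp => y0.
have r0 : rho%:C != 0 by rewrite -nrm_gt0 nrm_real gtr0_norm.
by field; apply/and3P; split.
Qed.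

Lemma integrand_arc (psi : R) : `|psi| < pi ->
  (fun x => 'i * polar delta psi * F (polar delta psi) x) =
  (fun x => 'i * node (ln delta +i* psi) x).
Proof.
move=> pp; apply/funext => x; rewrite /F /contour_node (polar_cexp _ hdelta) gfun_cexp //.
have := cexp_neq0 (ln delta +i* psi); rewrite [cexp _ * t%:C]mulrC => c0.
have := symbol_neq0 hgamma halpha (z := ln delta +i* psi) pp => y0.
by field; rewrite c0 y0.
Qed.

(** The modulus of [exp (z * t)] on the rays is [exp (- decay * rho)]. *)
Definition decay := - (t * cos theta).

Lemma decay_gt0 : 0 < decay.
Proof. by rewrite /decay -mulrN mulr_gt0 // cos_lt0_obtuse. Qed.

(** Half of the decay pays for smallness beyond [M1] and the other half for
    integrability: [tail M1] times the exponential density of rate [decay / 2]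
    dominates the norm of the integrand at every [rho >= M1]. *)
Definition tail (M1 : R) :=
  (2 / decay) * (delta^-1 / cos (theta / 2)) * expR (- (decay / 2 * M1)).

Lemma tail_ge0 M1 : 0 <= tail M1.
Proof.
have c0 := decay_gt0; have k0 : 0 < cos (theta / 2) by apply: cos_half_gt0 => //; exact: ltW.
rewrite /tail !mulr_ge0 ?expR_ge0 ?divr_ge0 ?invr_ge0 ?(ltW hdelta) ?(ltW k0) //.
exact: ltW.
Qed.

Lemma exponential_pdf_bound (D : set (measurableTypeR R)) (c Q : R) :
  measurable D -> 0 < c -> 0 <= Q ->
  leb.-integrable D (EFin \o (fun s => Q * exponential_pdf c s)) /\
  \int[leb]_(s in D) (Q * exponential_pdf c s) <= Q.
Proof.
move=> mD c0 Q0.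
have iD : leb.-integrable D (EFin \o exponential_pdf c).
  have := integrable_exponential_pdf c0; apply: integrableS => //; exact: measurableT.
have i2 : leb.-integrable D (EFin \o (fun s => Q * exponential_pdf c s)).
  have := integrableZl mD Q iD; exact: eq_integrable.
split=> //; rewrite RintegralZl // ler_piMr //.
rewrite -lee_fin /Rintegral fineK; last exact: integrable_fin_num.
rewrite -(integral_exponential_pdf c0); apply: ge0_subset_integral => //.
- by apply/measurable_EFinP; exact: measurable_exponential_pdf.
- by move=> x _; rewrite lee_fin; apply: exponential_pdf_ge0; exact: ltW.
Qed.

(** Left Riemann sums on the grid [x k = delta * (1 + h) ^ k], where
    [x k.+1 - x k = h * x k] cancels the factor [1 / x k] of the integrand, and the
    exponential tail beyond [x n].  The oscillation of the integrand on a cell is a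
    combination of two resolvents and is estimated by [node_combination]. *)
Lemma ray_bound (psi : R) w phi (h B M1 : R) n :
  `|psi| = theta ->
  is_Bochner_integral Omega `[delta, +oo[
    (fun rho x => polar 1 psi * F (polar rho psi) x) w ->
  inL2C Omega phi -> 0 < h -> 0 <= B -> M1 <= delta * (1 + h) ^+ n ->
  (forall rho, delta <= rho -> on_contour theta delta (ln rho +i* psi)) ->
  (forall l rho rho', 0 <= l -> delta <= rho <= delta * (1 + h) ^+ n ->
     delta <= rho' <= delta * (1 + h) ^+ n ->
     nrm (K l (ln rho +i* psi)) <= B /\
     nrm (K l (ln rho' +i* psi) - K l (ln rho +i* psi)) <= B * `|ln rho' - ln rho|) ->
  ire w phi <= h * \sum_(k < n) ire (node ((ln delta + k%:R * ln (1 + h)) +i* psi)) phi +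
    (delta * (1 + h) ^+ n * (2 * B * h / delta) + tail M1) * (norm v * norm phi).
Proof.
move=> psith BI pL h0 B0 M1x onc HB.
have psipi : `|psi| < pi by rewrite psith.
have h10 : 0 < 1 + h by lra.
pose x k := delta * (1 + h) ^+ k.
have x0 k : 0 < x k by rewrite mulr_gt0 // exprn_gt0.
have xS k : x k.+1 = x k + h * x k by rewrite /x exprS; ring.
have dx k : delta <= x k.
  by rewrite /x ler_peMr ?(ltW hdelta) // exprn_ege1 //; lra.
have xmono k : (k <= n)%N -> x k <= x n.
  by move=> kn; rewrite /x ler_wpM2l ?(ltW hdelta) // ler_weXn2l //; lra.
have lnx k : ln (x k) = ln delta + k%:R * ln (1 + h).
  by rewrite lnM ?posrE ?exprn_gt0 // lnXn // mulr_natl.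
have c0 := decay_gt0.
have k0 : 0 < cos (theta / 2) by apply: cos_half_gt0 => //; exact: ltW.
have mD : measurable (`[delta, +oo[%classic : set (measurableTypeR R)).
  exact: measurable_itv.
have np0 : 0 <= norm v * norm phi by rewrite mulr_ge0 // normL2C_ge0.
(* [Q] times the exponential density is the majorant outside the grid *)
pose Q := tail M1 * (norm v * norm phi).
have Q0 : 0 <= Q by rewrite mulr_ge0 // tail_ge0.
have d20 : 0 < decay / 2 by lra.
have [iq Eq] := exponential_pdf_bound mD d20 Q0.
have BI' := BI.
have intE rho : delta <= rho -> (fun x => polar 1 psi * F (polar rho psi) x) =
   (fun x => (rho^-1)%:C * node (ln rho +i* psi) x).
  by move=> dr; rewrite integrand_ray //; exact: lt_le_trans hdelta dr.
have nL k : inL2C Omega (node (ln (x k) +i* psi)).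
  exact: (node_inL2 t rP (onc _ (dx k))).
have := @bochner_riemann_bound _ _ Omega _ _ w phi x n (2 * B * h / delta * norm v)
  (fun s => Q * exponential_pdf (decay / 2) s) BI' mD pL.
move=> H; apply: le_trans (H _ _ _ iq _ _) _.
- by move=> k kn; rewrite xS ltrDl mulr_gt0.
- move=> k rho kn /andP[xr _]; rewrite /= in_itv /= andbT; exact: le_trans xr.
- move=> k rho kn /andP[xr rx].
  have dr : delta <= rho by exact: le_trans xr.
  have rho0 : 0 < rho by exact: lt_le_trans hdelta dr.
  have rn : rho <= x n by apply: le_trans (ltW rx) _; exact: xmono.
  have -> : (fun y => polar 1 psi * F (polar rho psi) y - polar 1 psi * F (polar (x k) psi) y) =
      (fun y => (rho^-1)%:C * node (ln rho +i* psi) y - ((x k)^-1)%:C * node (ln (x k) +i* psi) y).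
    apply/funext => y; congr (_ - _); first exact: (congr1 (@^~ y) (intE rho dr)).
    exact: (congr1 (@^~ y) (intE _ (dx k))).
  apply: (node_scaled_difference hOmega hgamma halpha htheta vL rP).
  - exact: onc.
  - exact: onc.
  move=> l l0.
  have [b1 _] := HB l (x k) (x k) l0 (introT andP (conj (dx k) (xmono k (ltnW kn))))
    (introT andP (conj (dx k) (xmono k (ltnW kn)))).
  have [_ b2] := HB l (x k) rho l0 (introT andP (conj (dx k) (xmono k (ltnW kn))))
    (introT andP (conj dr rn)).
  have lnr : `|ln rho - ln (x k)| <= h.
    rewrite ger0_norm ?subr_ge0 ?ler_ln ?posrE // -ln_div ?posrE //.
    apply: le_trans (_ : ln (1 + h) <= _); last by apply: le_ln1Dx; lra.
    rewrite ler_ln ?posrE ?divr_gt0 // ler_pdivrMr //.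
    by move: (ltW rx); rewrite xS; lra.
  have b3 : B * `|ln rho - ln (x k)| <= B * h by rewrite ler_wpM2l.
  have -> : (rho^-1)%:C * K l (ln rho +i* psi) - ((x k)^-1)%:C * K l (ln (x k) +i* psi) =
    (rho^-1)%:C * (K l (ln rho +i* psi) - K l (ln (x k) +i* psi)) +
    ((rho^-1 - (x k)^-1)%:C) * K l (ln (x k) +i* psi) by rewrite rmorphB /=; ring.
  apply: le_trans (nrmD _ _) _.
  rewrite (nrmM (rho^-1)%:C) (nrmM (rho^-1 - (x k)^-1)%:C) !nrm_real.
  have rd : rho^-1 <= delta^-1 by rewrite lef_pV2 ?posrE.
  have q1 : `|rho^-1| * nrm (K l (ln rho +i* psi) - K l (ln (x k) +i* psi)) <= delta^-1 * (B * h).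
    rewrite ger0_norm ?invr_ge0 ?(ltW rho0) //.
    have b23 := le_trans b2 b3.
    by apply: ler_pM; [rewrite invr_ge0 ltW|exact: nrm_ge0|exact: rd|exact: b23].
  have q2 : `|rho^-1 - (x k)^-1| * nrm (K l (ln (x k) +i* psi)) <= (delta^-1 * h) * B.
    apply: ler_pM => //; first exact: nrm_ge0.
    rewrite distrC ger0_norm ?subr_ge0 ?lef_pV2 ?posrE //.
    have -> : (x k)^-1 - rho^-1 = ((rho - x k) / x k) / rho by field; rewrite !gt_eqF.
    rewrite mulrC ler_pM ?invr_ge0 ?(ltW rho0) // ?divr_ge0 ?subr_ge0 ?(ltW (x0 k)) //.
    by rewrite ler_pdivrMr //; move: (ltW rx); rewrite xS; lra.
  by apply: le_trans (lerD q1 q2) _; lra.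
- by move=> s; rewrite mulr_ge0 // exponential_pdf_ge0 // ltW.
- move=> rho /=; rewrite in_itv /= andbT => dr.
  rewrite {1}/x expr0 mulr1 dr /= -leNgt => xr.
  have rho0 : 0 < rho by exact: lt_le_trans hdelta dr.
  rewrite intE //.
  have FL : inL2C Omega (fun y => (rho^-1)%:C * node (ln rho +i* psi) y).
    by apply: inL2CZ; exact: (node_inL2 t rP (onc _ dr)).
  apply: le_trans (ler_norm _) _; apply: le_trans (innerC_re_cauchy_schwarz FL pL) _.
  pose A := delta^-1 / cos (theta / 2) * expR (- (decay * rho)).
  have nb : norm (fun y => (rho^-1)%:C * node (ln rho +i* psi) y) <= A * norm v.
    apply: (node_scaled_bound hOmega hgamma halpha htheta vL rP); first exact: onc.
    move=> l l0; rewrite nrmM nrm_real ger0_norm ?invr_ge0 ?(ltW rho0) //.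
    have psile : `|psi| <= theta by rewrite psith.
    have kb := kernel_bound hgamma halpha t l0 (z := ln rho +i* psi) psile thpi.
    have cE : cos psi = cos theta by rewrite -cos_norm psith.
    have eE : t * (expR (ln rho) * cos psi) = - (decay * rho).
      by rewrite lnK // cE /decay; ring.
    rewrite /= eE in kb.
    rewrite /A -mulrA; apply: ler_pM; rewrite ?invr_ge0 ?nrm_ge0 ?(ltW rho0) //.
      by rewrite lef_pV2 ?posrE.
    by rewrite mulrC.
  apply: le_trans (ler_wpM2r (normL2C_ge0 Omega phi) nb) _.
  rewrite exponential_pdfE ?(ltW rho0) // /Q -[leLHS]mulrA.
  have -> : tail M1 * (norm v * norm phi) * (decay / 2 * expR (- (decay / 2) * rho)) =
    (tail M1 * (decay / 2 * expR (- (decay / 2) * rho))) * (norm v * norm phi) by ring.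
  apply: ler_wpM2r => //.
  have -> : tail M1 * (decay / 2 * expR (- (decay / 2) * rho)) =
     delta^-1 / cos (theta / 2) * (expR (- (decay / 2 * M1)) * expR (- (decay / 2) * rho)).
    by rewrite /tail; field; rewrite !gt_eqF.
  rewrite /A ler_wpM2l ?divr_ge0 ?invr_ge0 ?(ltW k0) ?(ltW hdelta) //.
  rewrite -expRD ler_expR.
  have : decay / 2 * M1 <= decay / 2 * rho.
    by rewrite ler_wpM2l ?(ltW d20) //; exact: le_trans xr.
  lra.
- have sumE : \sum_(k < n) (x k.+1 - x k) * ire (fun y => polar 1 psi * F (polar (x k) psi) y) phi =
     h * \sum_(k < n) ire (node ((ln delta + k%:R * ln (1 + h)) +i* psi)) phi.
    rewrite mulr_sumr; apply: eq_bigr => k _; rewrite intE // xS -lnx.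
    have := innerC_re_linear ((x k)^-1) (nL k) (inL2C_0 Omega) pL.
    have -> : ire (fun=> 0) phi = 0 by rewrite /innerC_re /reL2 /imL2 /= !inner0 addr0.
    have -> : (fun y => ((x k)^-1)%:C * node (ln (x k) +i* psi) y + 0) =
        (fun y => ((x k)^-1)%:C * node (ln (x k) +i* psi) y).
      by apply/funext => y; rewrite addr0.
    by move=> ->; field; rewrite gt_eqF.
  rewrite sumE -addrA lerD2l [leRHS]mulrDl; apply: lerD; last exact: Eq.
  have e0 : 0 <= 2 * B * h / delta by rewrite !mulr_ge0 ?invr_ge0 ?(ltW h0) // ltW.
  have d0 : 0 <= x 0%N by exact: ltW.
  have : 0 <= x 0%N * (2 * B * h / delta * (norm v * norm phi)).
    by apply: mulr_ge0 => //; exact: mulr_ge0.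
  rewrite -/(x n); lra.
Qed.

(** The grid consists of half-open intervals and misses the endpoint [theta], which
    is a null set and is covered by an indicator function. *)
Lemma arc_bound w phi (h B : R) N :
  is_Bochner_integral Omega `[- theta, theta]
    (fun psi x => 'i * polar delta psi * F (polar delta psi) x) w ->
  inL2C Omega phi -> 0 < h -> N%:R * h = 2 * theta -> 0 <= B ->
  (forall l psi psi', 0 <= l -> `|psi| <= theta -> `|psi'| <= theta ->
     nrm (K l (ln delta +i* psi') - K l (ln delta +i* psi)) <= B * `|psi' - psi|) ->
  ire w phi <= h * \sum_(j < N) ire (fun x => 'i * node (ln delta +i* (- theta + j%:R * h)) x) phi +
    2 * theta * (B * h) * (norm v * norm phi).
Proof.
move=> BI pL h0 hN B0 HB.
pose x (j : nat) := - theta + j%:R * h.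
have xS j : x j.+1 = x j + h by rewrite /x -natr1; ring.
have x0 : x 0%N = - theta by rewrite /x mul0r addr0.
have xN : x N = theta by rewrite /x hN; ring.
have xb j : (j <= N)%N -> `|x j| <= theta.
  move=> jN; have j0 := mulr_ge0 (ler0n R j) (ltW h0).
  have jN2 : j%:R * h <= N%:R * h by rewrite ler_wpM2r ?ler_nat // ltW.
  by rewrite ler_norml /x; apply/andP; split; lra.
have mD : measurable (`[- theta, theta]%classic : set (measurableTypeR R)).
  exact: measurable_itv.
have intE psi : `|psi| <= theta -> (fun x => 'i * polar delta psi * F (polar delta psi) x) =
   (fun x => 'i * node (ln delta +i* psi) x).
  by move=> pt; rewrite integrand_arc //; exact: le_lt_trans pt thpi.
pose G psi := ire (fun x => 'i * polar delta psi * F (polar delta psi) x) phi.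
have m1 : measurable ([set theta] : set (measurableTypeR R)) by exact: measurable_set1.
have l1 : (leb ([set theta] : set (measurableTypeR R)) < +oo)%E.
  by rewrite lebesgue_measure_set1 ltry.
have iq := indic_integrable `|G theta| m1 mD l1.
have Eq := indic_Rintegral `|G theta| m1 mD l1.
have Eq0 : \int[leb]_(s in (`[- theta, theta]%classic : set R)) (\1_[set theta] s * `|G theta|) = 0.
  rewrite Eq (_ : leb _ = 0%E) ?mul0r //.
  apply/eqP; rewrite -measure_le0 -(lebesgue_measure_set1 theta); apply: le_measure => //;
    by rewrite inE //; exact: measurableI.
have := @bochner_riemann_bound _ _ Omega _ _ w phi x N (B * h * norm v)
  (fun s => \1_[set theta] s * `|G theta|) BI mD pL.
move=> H; apply: le_trans (H _ _ _ iq _ _) _.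
- by move=> j jN; rewrite xS ltrDl.
- move=> j psi jN /andP[xp px]; rewrite /= in_itv /= -ler_norml.
  have := xb j (ltnW jN); have := xb j.+1 jN; rewrite !ler_norml.
  by move=> /andP[? ?] /andP[? ?]; apply/andP; split; lra.
- move=> j psi jN /andP[xp px].
  have pt : `|psi| <= theta.
    have := xb j (ltnW jN); have := xb j.+1 jN; rewrite !ler_norml.
    by move=> /andP[? ?] /andP[? ?]; apply/andP; split; lra.
  have xt := xb j (ltnW jN).
  have -> : (fun y => 'i * polar delta psi * F (polar delta psi) y -
        'i * polar delta (x j) * F (polar delta (x j)) y) =
      (fun y => 'i * node (ln delta +i* psi) y - 'i * node (ln delta +i* x j) y).
    apply/funext => y; congr (_ - _); first exact: (congr1 (@^~ y) (intE psi pt)).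
    exact: (congr1 (@^~ y) (intE _ xt)).
  have n1 : inL2C Omega (node (ln delta +i* psi)).
    exact: (node_inL2 t rP (on_contour_arc hdelta pt)).
  have n2 : inL2C Omega (node (ln delta +i* x j)).
    exact: (node_inL2 t rP (on_contour_arc hdelta xt)).
  have -> : (fun y => 'i * node (ln delta +i* psi) y - 'i * node (ln delta +i* x j) y) =
     (fun y => 'i * (1%:C * node (ln delta +i* psi) y - 1%:C * node (ln delta +i* x j) y)).
    by apply/funext => y; rewrite !mul1r mulrBr.
  rewrite normL2CZ; last by apply: inL2CB; exact: inL2CZ.
  rewrite nrm_i mul1r.
  apply: (node_scaled_difference hOmega hgamma halpha htheta vL rP).
  - exact: on_contour_arc.
  - exact: on_contour_arc.
  move=> l l0; rewrite !mul1r; apply: le_trans (HB l _ _ l0 xt pt) _.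
  by rewrite ler_wpM2l // ger0_norm ?subr_ge0 //; move: (ltW px); rewrite xS; lra.
- by move=> s; rewrite mulr_ge0 // indicE.
- move=> psi /=; rewrite in_itv /= => /andP[p1 p2].
  rewrite x0 xN p1 /= -leNgt => p3.
  have -> : psi = theta by apply/eqP; rewrite eq_le p2 p3.
  by rewrite indicE mem_set // mul1r ler_norm.
- rewrite Eq0 addr0 xN x0; apply: lerD.
    rewrite mulr_sumr; apply: ler_sum => j _; rewrite intE ?xb ?(ltnW (ltn_ord j)) //.
    by rewrite xS addrAC subrr add0r.
  rewrite le_eqVlt; apply/orP; left; apply/eqP; ring.
Qed.

End contour_pieces.

Section operator_bound.
Context {R : realType} {d : nat}.
Variables (Omega : set 'rV[R]_d) (gamma alpha theta delta t : R).
Hypotheses (hOmega : convex_polytopal_domain Omega).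
Hypotheses (hgamma : 0 < gamma) (halpha : 0 < alpha < 1).
Hypotheses (htheta : pi / 2 < theta < pi) (hdelta : 0 < delta) (ht : 0 < t).
Local Notation norm := (normL2C Omega).
Local Notation ire := (innerC_re Omega).

Lemma innerC_reD u w phi : inL2C Omega u -> inL2C Omega w -> inL2C Omega phi ->
  ire (fun x => u x + w x) phi = ire u phi + ire w phi.
Proof.
move=> uL wL pL; have := innerC_re_linear 1 uL wL pL; rewrite mul1r => <-.
by congr (ire _ phi); apply/funext => x; rewrite mul1r.
Qed.

Lemma innerC_reZ (a : R) u phi : inL2C Omega u -> inL2C Omega phi ->
  ire (fun x => a%:C * u x) phi = a * ire u phi.
Proof.
move=> uL pL; have := innerC_re_linear a uL (inL2C_0 Omega) pL.
have -> : ire (fun=> 0) phi = 0 by rewrite /innerC_re /reL2 /imL2 /= !inner0 addr0.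
by rewrite addr0 => <-; congr (ire _ phi); apply/funext => x; rewrite addr0.
Qed.

Lemma tail_small (eps : R) : 0 < eps ->
  exists2 M : R, 0 < M & forall M1, M <= M1 -> tail theta delta t M1 <= eps.
Proof.
move=> e0; have c0 := decay_gt0 htheta ht; rewrite /tail.
set c := decay theta t in c0 *.
have thpi : theta < pi by case/andP: htheta.
have th0 : 0 < theta by case/andP: htheta => h _; have := @pi_gt0 R; lra.
have k0 : 0 < cos (theta / 2) by apply: cos_half_gt0 => //; exact: ltW.
set A := 2 / c * _; have A0 : 0 < A by rewrite !mulr_gt0 ?invr_gt0.
have c20 : 0 < c / 2 by lra.
exists (A / eps / (c / 2)); first by rewrite !divr_gt0.
move=> M1 AM.
have x0 : 0 < c / 2 * M1.
  by rewrite mulr_gt0 // (lt_le_trans _ AM) // !divr_gt0.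
have ex : expR (- (c / 2 * M1)) <= (c / 2 * M1)^-1.
  by rewrite expRN lef_pV2 ?posrE ?expR_gt0 // (le_trans _ (expR_ge1Dx _)) // lerDr.
apply: le_trans (ler_wpM2l (ltW A0) ex) _.
by move: AM; rewrite !ler_pdivrMr //; lra.
Qed.

Section one_vector.
Variables (v : 'rV[R]_d -> R[i]) (r : R[i] -> 'rV[R]_d -> R[i]).
Hypothesis vL : inL2C Omega v.
Hypothesis rP : forall z, contour theta delta z ->
  is_resolvent Omega (gfun gamma alpha z) v (r z).
Local Notation node := (contour_node gamma alpha t r).

Let F (z : R[i]) (x : 'rV[R]_d) : R[i] :=
  cexp (z * t%:C) * (gfun gamma alpha z / z) * r z x.

(** The three sums form one combination of resolvents, indexed by a disjoint union:
    the cancellation between them, which [contour_sum_bound] expresses, would be lost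
    by bounding them one at a time. *)
Lemma contour_nodes_bound phi (h C : R) n N :
  inL2C Omega phi -> 0 < h -> N%:R * h = 2 * theta ->
  (forall l : R, 0 <= l ->
    nrm (contour_sum (contour_kernel gamma alpha t l) (ln delta) theta h n N) <= C) ->
  h * (\sum_(k < n) ire (node ((ln delta + k%:R * ln (1 + h)) +i* theta)) phi) -
  h * (\sum_(k < n) ire (node ((ln delta + k%:R * ln (1 + h)) +i* (- theta))) phi) +
  h * (\sum_(j < N) ire (fun x => 'i * node (ln delta +i* (- theta + j%:R * h)) x) phi) <=
  C * (norm v * norm phi).
Proof.
move=> pL h0 hN HC.
pose x k := delta * (1 + h) ^+ k.
have h10 : 0 < 1 + h by lra.
have dx k : delta <= x k.
  by rewrite /x ler_peMr ?(ltW hdelta) // exprn_ege1 //; lra.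
have lnx k : ln delta + k%:R * ln (1 + h) = ln (x k).
  by rewrite lnM ?posrE ?exprn_gt0 // lnXn // mulr_natl.
have arcb (j : 'I_N) : `|- theta + j%:R * h| <= theta.
  have j0 := mulr_ge0 (ler0n R j) (ltW h0).
  have jN2 : j%:R * h <= N%:R * h by rewrite ler_wpM2r ?ler_nat ?(ltnW (ltn_ord j)) // ltW.
  by rewrite ler_norml; apply/andP; split; lra.
pose I := ('I_n + 'I_n + 'I_N)%type.
pose z (i : I) : R[i] := match i with
  | inl (inl k) => (ln delta + k%:R * ln (1 + h)) +i* theta
  | inl (inr k) => (ln delta + k%:R * ln (1 + h)) +i* (- theta)
  | inr j => ln delta +i* (- theta + j%:R * h) end.
pose c (i : I) : R[i] := match i with
  | inl (inl k) => h%:C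
  | inl (inr k) => - h%:C
  | inr j => h%:C * 'i end.
have zc i : on_contour theta delta (z i).
  case: i => [[k|k]|j] /=.
  - by rewrite lnx; apply: on_contour_up.
  - by rewrite lnx; apply: on_contour_low.
  - exact: on_contour_arc.
have nL i : inL2C Omega (node (z i)) by exact: (node_inL2 t rP (zc i)).
have S (G : R[i] -> R[i]) : \sum_i c i * G (z i) =
    h%:C * (\sum_(k < n) G ((ln delta + k%:R * ln (1 + h)) +i* theta)) -
    h%:C * (\sum_(k < n) G ((ln delta + k%:R * ln (1 + h)) +i* (- theta))) +
    h%:C * ('i * \sum_(j < N) G (ln delta +i* (- theta + j%:R * h))).
  rewrite !big_sumType /= !mulr_sumr -sumrN; congr (_ + _ + _).
    by apply: eq_bigr => k _; rewrite mulNr.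
  by apply: eq_bigr => j _; rewrite mulrA.
have nb : norm (fun x => \sum_i c i * node (z i) x) <= C * norm v.
  apply: (node_combination hOmega hgamma halpha htheta vL rP) => // l l0.
  apply: le_trans _ (HC l l0); rewrite S le_eqVlt; apply/orP; left; apply/eqP.
  by congr nrm; rewrite /contour_sum /ray_sum /arc_sum; ring.
pose Z1 x := \sum_(k < n) h%:C * node ((ln delta + k%:R * ln (1 + h)) +i* theta) x.
pose Z2 x := \sum_(k < n) (- h)%:C * node ((ln delta + k%:R * ln (1 + h)) +i* (- theta)) x.
pose Z3 x := \sum_(j < N) h%:C * ('i * node (ln delta +i* (- theta + j%:R * h)) x).
have Z1L : inL2C Omega Z1.
  by apply: inL2C_sum => k; apply: inL2CZ; exact: (nL (inl (inl k))).
have Z2L : inL2C Omega Z2.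
  by apply: inL2C_sum => k; apply: inL2CZ; exact: (nL (inl (inr k))).
have Z3L : inL2C Omega Z3.
  by apply: inL2C_sum => j; apply: inL2CZ; apply: inL2CZ; exact: (nL (inr j)).
have ZE : (fun x => \sum_i c i * node (z i) x) = (fun x => Z1 x + Z2 x + Z3 x).
  apply/funext => y; rewrite !big_sumType /=; congr (_ + _ + _).
    by apply: eq_bigr => k _; rewrite rmorphN.
  by apply: eq_bigr => j _; rewrite -[LHS]mulrA.
have E1 : ire Z1 phi = h * (\sum_(k < n) ire (node ((ln delta + k%:R * ln (1 + h)) +i* theta)) phi).
  rewrite /Z1 (innerC_re_sum (fun=> h)) ?mulr_sumr // => k; exact: (nL (inl (inl k))).
have E2 : ire Z2 phi = - (h * (\sum_(k < n) ire (node ((ln delta + k%:R * ln (1 + h)) +i* (- theta))) phi)).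
  rewrite /Z2 (innerC_re_sum (fun=> - h)) // ?mulr_sumr -?sumrN.
    by apply: eq_bigr => k _; rewrite mulNr.
  by move=> k; exact: (nL (inl (inr k))).
have E3 : ire Z3 phi = h * (\sum_(j < N) ire (fun x => 'i * node (ln delta +i* (- theta + j%:R * h)) x) phi).
  rewrite /Z3 (innerC_re_sum (fun=> h) (v := fun (j : 'I_N) x => 'i * node (ln delta +i* (- theta + j%:R * h)) x)) ?mulr_sumr // => j.
  by apply: inL2CZ; exact: (nL (inr j)).
rewrite -E1 -E2 -E3 -innerC_reD // -innerC_reD //; last exact: inL2CD.
have ZL : inL2C Omega (fun x => Z1 x + Z2 x + Z3 x) by apply: inL2CD => //; exact: inL2CD.
apply: le_trans (ler_norm _) _; apply: le_trans (innerC_re_cauchy_schwarz ZL pL) _.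
by rewrite mulrA ler_wpM2r ?normL2C_ge0 // -ZE.
Qed.

(** The outer radius is chosen first, to make the tails of the rays small and
    [contour_sum_bound] applicable; then the mesh [h], of the form [2 * theta / N],
    is taken small enough for the oscillations. *)
Lemma contour_integral_bound wup wlow warc phi :
  is_Bochner_integral Omega `[delta, +oo[
    (fun rho x => polar 1 theta * F (polar rho theta) x) wup ->
  is_Bochner_integral Omega `[delta, +oo[
    (fun rho x => polar 1 (- theta) * F (polar rho (- theta)) x) wlow ->
  is_Bochner_integral Omega `[- theta, theta]
    (fun psi x => 'i * polar delta psi * F (polar delta psi) x) warc ->
  inL2C Omega phi ->
  ire (fun x => wup x - wlow x + warc x) phi <= contour_const * (norm v * norm phi).
Proof.
move=> Bup Blow Barc pL.
have thpi : theta < pi by case/andP: htheta.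
have th0 : 0 < theta by case/andP: htheta => h _; have := @pi_gt0 R; lra.
have [upL _ _] := Bup; have [lowL _ _] := Blow; have [arcL _ _] := Barc.
set np := norm v * norm phi.
have np0 : 0 <= np by rewrite mulr_ge0 // normL2C_ge0.
suff H eps : 0 < eps ->
    ire (fun x => wup x - wlow x + warc x) phi <= (contour_const + 6 * eps) * np.
  apply/ler_addgt0Pr => e e0.
  have e1 : 0 < e / (6 * (np + 1)) by rewrite divr_gt0 // mulr_gt0 //; lra.
  apply: le_trans (H _ e1) _; rewrite mulrDl lerD2l.
  rewrite (_ : 6 * (e / (6 * (np + 1))) * np = e * (np / (np + 1))); last first.
    by field; rewrite gt_eqF //; lra.
  by rewrite ler_piMr ?(ltW e0) // ler_pdivrMr; lra.
move=> e0.
have [M0 M00 HM] := contour_sum_bound hgamma halpha ht htheta hdelta e0.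
have [M' M'0 HT] := tail_small e0.
pose M1 := M0 + M' + delta.
have M1M0 : M0 <= M1 by rewrite /M1 -addrA lerDl addr_ge0 // ltW.
have M1M' : M' <= M1 by rewrite /M1 addrAC lerDr addr_ge0 // ltW.
have M1d : delta <= M1 by rewrite /M1 lerDr addr_ge0 // ltW.
have M10 : 0 < M1 by lra.
have [h0 h00 Hh] := HM M1 M1M0.
have [B [B0 HB]] := kernel_C2 hgamma halpha t (ln delta) (ln (2 * M1)) thpi.
pose Z := 2 * M1 * (2 * B / delta) + 2 * theta * B.
have Z0 : 0 <= Z.
  have Zb : 0 <= 2 * B / delta by rewrite divr_ge0 ?(ltW hdelta) ?mulr_ge0.
  have Zc : 0 <= 2 * theta * B by rewrite mulr_ge0 ?mulr_ge0 ?(ltW th0).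
  by apply: addr_ge0 => //; apply: mulr_ge0 => //; apply: mulr_ge0 => //; exact: ltW.
pose hm := Num.min h0 (Num.min 1 (eps / (Z + 1))).
have hm0 : 0 < hm by rewrite !lt_min h00 ltr01 divr_gt0 //; lra.
pose N := (Num.truncn (2 * theta / hm)).+1.
pose h := 2 * theta / N%:R.
have N0 : 0 < N%:R :> R by [].
have hpos : 0 < h by rewrite divr_gt0 // mulr_gt0.
have hhm : h < hm.
  rewrite /h ltr_pdivrMr // [ltRHS]mulrC -ltr_pdivrMr //; exact: Num.Theory.truncnS_gt.
have hN : N%:R * h = 2 * theta by rewrite /h mulrC divfK // gt_eqF.
have hh0 : h <= h0 by apply: le_trans (ltW hhm) _; rewrite ge_min lexx.
have h1 : h <= 1 by apply: le_trans (ltW hhm) _; rewrite !ge_min lexx orbT.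
have hZ : Z * h <= eps.
  have : h <= eps / (Z + 1) by apply: le_trans (ltW hhm) _; rewrite !ge_min lexx !orbT.
  by rewrite ler_pdivlMr; lra.
have M1d1 : 1 <= M1 / delta by rewrite ler_pdivlMr // mul1r.
have [m /andP[m1 m2]] := geometric_bracket hpos M1d1.
(* [1 + h <= 2] keeps the first grid radius above [M1] below [2 * M1] *)
pose n := m.+1.
have n1 : M1 <= delta * (1 + h) ^+ n.
  by move: (ltW m2); rewrite ler_pdivrMr // mulrC.
have n2 : delta * (1 + h) ^+ n <= 2 * M1.
  rewrite /n exprS; move: m1; rewrite ler_pdivlMr // => m1.
  have : (1 + h) * ((1 + h) ^+ m * delta) <= 2 * M1.
    by apply: ler_pM => //; rewrite ?mulr_ge0 ?exprn_ge0 ?(ltW hdelta) //; lra.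
  lra.
have Kb l : 0 <= l -> exists2 f', taylor_bound (rectangle (ln delta) (ln (2 * M1)) theta)
     B (contour_kernel gamma alpha t l) f' & forall z w,
     rectangle (ln delta) (ln (2 * M1)) theta z -> rectangle (ln delta) (ln (2 * M1)) theta w ->
     nrm (contour_kernel gamma alpha t l w - contour_kernel gamma alpha t l z) <= B * nrm (w - z).
  exact: HB.
have rect rho psi : delta <= rho <= delta * (1 + h) ^+ n -> `|psi| <= theta ->
    rectangle (ln delta) (ln (2 * M1)) theta (ln rho +i* psi).
  move=> /andP[dr rn] pt; split => //=.
  have r0 := lt_le_trans hdelta dr.
  by rewrite !ler_ln ?posrE ?dr //= ?(le_trans rn) // mulr_gt0.
have rayK psi : `|psi| <= theta -> forall l rho rho', 0 <= l ->
     delta <= rho <= delta * (1 + h) ^+ n -> delta <= rho' <= delta * (1 + h) ^+ n ->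
     nrm (contour_kernel gamma alpha t l (ln rho +i* psi)) <= B /\
     nrm (contour_kernel gamma alpha t l (ln rho' +i* psi) - contour_kernel gamma alpha t l (ln rho +i* psi))
       <= B * `|ln rho' - ln rho|.
  move=> pt l rho rho' l0 r1 r2; have [f' tf lf] := Kb l l0.
  have R1 := rect rho psi r1 pt; have R2 := rect rho' psi r2 pt.
  split; first by have [] := tf _ _ R1 R1.
  apply: le_trans (lf _ _ R1 R2) _.
  rewrite (_ : _ - _ = (ln rho' - ln rho)%:C) ?nrm_real //.
  by apply/eqP; rewrite eq_complex /= subrr !eqxx.
have eq_refl_le (a b : R) : a = b -> a <= b by move=> ->.
have thn : `|theta| = theta by rewrite gtr0_norm.
have thnN : `|- theta| = theta by rewrite normrN.
(* [ray_bound] is an upper bound; the lower ray, which is subtracted, is paired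
   with [- phi] *)
have pmL : inL2C Omega (fun x => (-1)%:C * phi x) by exact: inL2CZ.
have np' : norm (fun x => (-1)%:C * phi x) = norm phi.
  by rewrite normL2CZ // nrm_real normrN1 mul1r.
have irem u : inL2C Omega u -> ire u (fun x => (-1)%:C * phi x) = - ire u phi.
  by move=> uL; rewrite innerC_reC innerC_reZ // mulN1r innerC_reC.
have R1 := ray_bound hOmega hgamma halpha htheta hdelta ht vL rP thn Bup pL hpos B0 n1
  (on_contour_up htheta hdelta) (rayK theta (eq_refl_le _ _ thn)).
have R2 := ray_bound hOmega hgamma halpha htheta hdelta ht vL rP thnN Blow pmL hpos B0 n1
  (on_contour_low htheta hdelta) (rayK (- theta) (eq_refl_le _ _ thnN)).
have arcK (l psi psi' : R) : 0 <= l -> `|psi| <= theta -> `|psi'| <= theta ->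
     nrm (contour_kernel gamma alpha t l (ln delta +i* psi') -
          contour_kernel gamma alpha t l (ln delta +i* psi)) <= B * `|psi' - psi|.
  move=> l0 pt pt'; have [f' tf lf] := Kb l l0.
  have dr : delta <= delta <= delta * (1 + h) ^+ n by rewrite lexx (le_trans M1d).
  apply: le_trans (lf _ _ (rect _ _ dr pt) (rect _ _ dr pt')) _.
  rewrite (_ : _ - _ = 'i * (psi' - psi)%:C) ?nrmM ?nrm_i ?mul1r ?nrm_real //.
  by apply/eqP; rewrite eq_complex /=; apply/andP; split; apply/eqP; ring.
have R3 := arc_bound hOmega hgamma halpha htheta hdelta vL rP Barc pL hpos hN B0 arcK.
have hp : 0 < h <= h0 by rewrite hpos.
have n12 : M1 <= delta * (1 + h) ^+ n <= 2 * M1 by rewrite n1.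
have CN := contour_nodes_bound pL hpos hN (fun l l0 => Hh h N n hp hN n12 l l0).
have T1 := HT M1 M1M'.
have e1 : delta * (1 + h) ^+ n * (2 * B * h / delta) <= eps.
  have e2 : delta * (1 + h) ^+ n * (2 * B * h / delta) <= 2 * M1 * (2 * B * h / delta).
    apply: ler_wpM2r => //; apply: divr_ge0; last exact: ltW.
    by apply: mulr_ge0; [apply: mulr_ge0|exact: ltW].
  have e3 : 0 <= 2 * theta * B * h.
    by apply: mulr_ge0; [apply: mulr_ge0 => //; apply: mulr_ge0 => //; exact: ltW|exact: ltW].
  apply: le_trans e2 _; apply: le_trans _ hZ; rewrite /Z mulrDl; lra.
have e4 : 2 * theta * (B * h) <= eps.
  have e3 : 0 <= 2 * M1 * (2 * B / delta) * h.
    apply: mulr_ge0; last exact: ltW.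
    apply: mulr_ge0; first by apply: mulr_ge0 => //; exact: ltW.
    by apply: divr_ge0; [apply: mulr_ge0|exact: ltW].
  apply: le_trans _ hZ; rewrite /Z mulrDl; lra.
have -> : ire (fun x => wup x - wlow x + warc x) phi =
    ire wup phi + ire wlow (fun x => (-1)%:C * phi x) + ire warc phi.
  rewrite irem // innerC_reD //; last exact: inL2CB.
  congr (_ + _); rewrite -(irem _ lowL) innerC_reC.
  have -> : (fun x => wup x - wlow x) = (fun x => wup x + (-1)%:C * wlow x).
    by apply/funext => x; rewrite rmorphN1 mulN1r.
  rewrite innerC_reC innerC_reD ?innerC_reZ ?irem ?mulN1r //; exact: inL2CZ.
rewrite np' in R2.
have sumN : \sum_(k < n) ire (node ((ln delta + k%:R * ln (1 + h)) +i* (- theta)))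
      (fun x => (-1)%:C * phi x) =
    - \sum_(k < n) ire (node ((ln delta + k%:R * ln (1 + h)) +i* (- theta))) phi.
  rewrite -sumrN; apply: eq_bigr => k _; rewrite irem //.
  have lnx : ln delta + k%:R * ln (1 + h) = ln (delta * (1 + h) ^+ k).
    have h10 : 0 < 1 + h by lra.
    by rewrite lnM ?posrE ?exprn_gt0 // lnXn // mulr_natl.
  rewrite lnx; apply: (node_inL2 t rP); apply: (on_contour_low htheta hdelta).
  by rewrite ler_peMr ?(ltW hdelta) // exprn_ege1 //; lra.
rewrite sumN mulrN in R2.
rewrite -/np in R1 R2 R3 CN.
have q1 := ler_wpM2r np0 e1; have q2 := ler_wpM2r np0 T1; have q3 := ler_wpM2r np0 e4.
apply: le_trans (lerD (lerD R1 R2) R3) _.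
rewrite !mulrDl in CN *; lra.
Qed.

End one_vector.

(** The contour integral is paired with itself.  The representative [w'] is
    introduced because [w] is known up to a null set only. *)
Theorem solution_operator_bound v w :
  is_solution_operator Omega gamma alpha theta delta t v w ->
  exists w', [/\ inL2C Omega w', eqL2 Omega w w' &
    norm w' <= contour_const / (2 * pi) * norm v].
Proof.
move=> [r [W [rP [wup [wlow [warc [Bup Blow Barc WE]]]] wE]]].
have p0 := @pi_gt0 R.
have vL : inL2C Omega v.
  have cd : contour theta delta (polar delta theta) by left; exists delta => //; left.
  by have [] := rP _ cd.
have [upL _ _] := Bup; have [lowL _ _] := Blow; have [arcL _ _] := Barc.
pose W' x := wup x - wlow x + warc x.
have WL : inL2C Omega W' by apply: inL2CD => //; exact: inL2CB.
have WB := contour_integral_bound vL rP Bup Blow Barc WL.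
have Wn : norm W' <= contour_const * norm v.
  have [->|W0] := eqVneq (norm W') 0.
    by rewrite mulr_ge0 ?contour_const_ge0 ?normL2C_ge0.
  have W1 : 0 < norm W' by rewrite lt_neqAle eq_sym W0 normL2C_ge0.
  rewrite -(ler_pM2r W1) -expr2 normL2C_sq // -mulrA; exact: WB.
pose a : R[i] := (0 +i* (2 * pi))^-1.
exists (fun x => a * W' x); split.
- exact: inL2CZ.
- move: WE wE; apply: filterS2 => x H1 H2 Ox.
  by rewrite H2 // H1 // mulrC.
- rewrite normL2CZ // nrmV.
  have -> : nrm (0 +i* (2 * pi)) = 2 * pi :> R.
    have -> : 0 +i* (2 * pi) = 'i * (2 * pi)%:C :> R[i].
      by apply/eqP; rewrite eq_complex /=; apply/andP; split; apply/eqP; ring.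
    by rewrite nrmM nrm_i mul1r nrm_real gtr0_norm // mulr_gt0.
  rewrite mulrC ler_pdivrMr ?mulr_gt0 // mulrAC divfK //.
  by rewrite gt_eqF // mulr_gt0.
Qed.

End operator_bound.

(** * Gronwall's lemma and the nonlinear equation *)

Section gronwall.
Context {R : realType}.
Local Notation leb := (@lebesgue_measure R).

Lemma affine_expR_derive (a b c x : R) : 0 < c ->
  is_derive x 1 (fun s => a * s + b / c * expR (c * s)) (a + b * expR (c * x)).
Proof.
move=> c0.
have h1 (k : R) : is_derive x 1 (fun s : R => k * s) k.
  by have := is_deriveZ k (is_derive_id x (1 : R)); rewrite /GRing.scale /= mulr1.
have h2 : is_derive x 1 (expR \o (fun s : R => c * s)) (expR (c * x) * c).
  exact: is_derive1_comp.
have h3 : is_derive x 1 (fun s => b / c * expR (c * s)) (b / c * (expR (c * x) * c)).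
  exact: is_deriveZ h2.
have := is_deriveD (h1 a) h3; congr (is_derive _ _ _ _); field.
by rewrite gt_eqF.
Qed.

Lemma affine_expR_integral (a b c t : R) : 0 < c -> 0 < t ->
  leb.-integrable `]0, t[ (EFin \o (fun s => a + b * expR (c * s))) /\
  \int[leb]_(s in `]0, t[) (a + b * expR (c * s)) = a * t + b * ((expR (c * t) - 1) / c).
Proof.
move=> c0 t0; pose f s := a + b * expR (c * s).
pose G s := a * s + b / c * expR (c * s).
have dG (x : R) : is_derive x 1 G (f x) by exact: affine_expR_derive.
have cG : continuous G.
  by move=> x; apply/differentiable_continuous/derivable1_diffP; case: (dG x).
have cf : continuous f.
  move=> x; apply: cvgD; first exact: cvg_cst.
  apply: cvgM; first exact: cvg_cst.
  apply: continuous_comp; last exact: continuous_expR.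
  by apply: cvgM; [exact: cvg_cst|exact: cvg_id].
have iI : leb.-integrable `[0, t] (EFin \o f).
  by apply: continuous_compact_integrable; [exact: segment_compact|exact: continuous_subspaceT].
have sub (I : interval R) : [set` I] `<=` `[0, t] -> leb.-integrable [set` I] (EFin \o f).
  by move=> s; apply: integrableS iI => //; exact: measurable_itv.
have i1 : leb.-integrable `]0, t[ (EFin \o f).
  by apply: sub => x /=; rewrite !in_itv /= => /andP[? ?]; apply/andP; split; exact: ltW.
have i2 : leb.-integrable `[0, t[ (EFin \o f).
  by apply: sub => x /=; rewrite !in_itv /= => /andP[-> ?]; exact: ltW.
split; first exact: i1.
rewrite (Rintegral_itv_obnd_cbnd i1) (Rintegral_itv_bndo_bndc i2) /Rintegral.
rewrite (@continuous_FTC2 R f G 0 t t0).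
- rewrite /= /G !mulr0 expR0 add0r; field; by rewrite gt_eqF.
- exact: continuous_subspaceT.
- split.
  + by move=> x _; case: (dG x).
  + exact/cvg_at_right_filter/cG.
  + exact/cvg_at_left_filter/cG.
- by move=> x _; rewrite derive1E; case: (dG x).
Qed.

(** Integrating [K * exp (2 * B * s)] against the rate [B] returns at most
    [K * exp (2 * B * t) / 2], so each use of [step] halves the excess of the
    majorant over [2 * A * exp (2 * B * t)].  Only exponential majorants of [m] are
    integrated, never [m] itself. *)
Lemma gronwall (m : R -> R) (t1 A B M : R) :
  0 < B -> 0 <= A -> 0 <= M -> (forall s, 0 < s <= t1 -> m s <= M) ->
  (forall K t, 0 <= K -> 0 < t <= t1 ->
    (forall s, 0 < s < t -> m s <= K * expR (2 * B * s)) ->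
    m t <= A + K * expR (2 * B * t) / 2) ->
  0 < t1 -> m t1 <= 2 * A * expR (2 * B * t1).
Proof.
move=> B0 A0 M0 mM step t10.
have e1 s : 0 < s -> 1 <= expR (2 * B * s).
  by move=> s0; rewrite -expR0 ler_expR !mulr_ge0 // ltW.
have iter j : forall s, 0 < s <= t1 -> m s <= (2 * A + M / 2 ^+ j) * expR (2 * B * s).
  elim: j => [|j IH] s st.
    have s0 : 0 < s by case/andP: st.
    apply: le_trans (mM s st) _; rewrite expr0 divr1.
    apply: le_trans (_ : 2 * A + M <= _); first lra.
    by rewrite ler_peMr ?e1 //; lra.
  have s0 : 0 < s by case/andP: st.
  have K0 : 0 <= 2 * A + M / 2 ^+ j by rewrite addr_ge0 ?mulr_ge0 ?invr_ge0 ?exprn_ge0.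
  apply: le_trans (step _ s K0 st _) _.
    move=> s' /andP[s'0 s's]; apply: IH; rewrite s'0 /=.
    by case/andP: st => _; apply: le_trans; exact: ltW.
  have -> : M / 2 ^+ j.+1 = M / 2 ^+ j / 2 by rewrite exprS invfM mulrCA mulrC.
  have := ler_wpM2l A0 (e1 s s0); lra.
apply/ler_addgt0Pr => e e0.
have E0 := expR_gt0 (2 * B * t1).
pose j := Num.truncn (M * expR (2 * B * t1) / e).
apply: le_trans (iter j t1 _) _; first by rewrite t10 lexx.
rewrite mulrDl lerD2l mulrAC ler_pdivrMr ?exprn_gt0 //.
have := @bernoulli_le R 1 j ler01; rewrite mulr1 => bj.
have : M * expR (2 * B * t1) / e < j.+1%:R by exact: Num.Theory.truncnS_gt.
rewrite ltr_pdivrMr // => /ltW h; apply: le_trans h _.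
by rewrite mulrC ler_pM2l // (_ : 2 = 1 + 1) // (le_trans _ bj) // -natr1 addrC.
Qed.

End gronwall.

Section real_norms.
Context {R : realType} {d : nat}.
Variable Omega : set 'rV[R]_d.
Implicit Types (f g : 'rV[R]_d -> R).

Lemma inL2C_real f : inL2 Omega f -> inL2C Omega (fun x => (f x)%:C).
Proof. by move=> fL; split => //; exact: inL2_0. Qed.

Lemma normL2C_real f : inL2 Omega f -> normL2C Omega (fun x => (f x)%:C) = normL2 Omega f.
Proof.
move=> fL; rewrite normL2C_sqrt; last exact: inL2C_real.
by rewrite normL2E // /innerC_re /reL2 /imL2 /= inner0 addr0.
Qed.

Lemma normL2_le f g : inL2 Omega f -> inL2 Omega g -> (forall x, `|f x| <= `|g x|) ->
  normL2 Omega f <= normL2 Omega g.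
Proof.
move=> fL gL fg; rewrite !normL2E //; apply: ler_wsqrtr.
apply: le_Rintegral => //; [exact: inner_integrable|exact: inner_integrable|].
move=> x _; rewrite /patch; case: ifPn => // _.
rewrite -!expr2 -(real_normK (num_real (f x))) -(real_normK (num_real (g x))).
by rewrite lerXn2r // nnegrE.
Qed.

Lemma normL2_reverse_triangle f g : inL2 Omega f -> inL2 Omega g ->
  `|normL2 Omega f - normL2 Omega g| <= normL2 Omega (fun x => f x - g x).
Proof.
move=> fL gL; have dL := inL2B fL gL.
have h1 : normL2 Omega f <= normL2 Omega (fun x => f x - g x) + normL2 Omega g.
  have := normL2D dL gL; congr (normL2 _ _ <= _); apply/funext => x; ring.
have dL' := inL2Z (-1) dL.
have h2 : normL2 Omega g <= normL2 Omega (fun x => -1 * (f x - g x)) + normL2 Omega f.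
  have := normL2D dL' fL; congr (normL2 _ _ <= _); apply/funext => x; ring.
have := normL2Z (-1) dL; rewrite normrN1 mul1r => h3.
by rewrite ler_norml; apply/andP; split; lra.
Qed.

End real_norms.

Theorem mainTheorem2 (R : realType) (d : nat) (Omega : set 'rV[R]_d)
    (T gamma alpha L : R)
    (hd : (1 <= d <= 3)%N) (hOmega : convex_polytopal_domain Omega)
    (hT : 0 < T) (hgamma : 0 < gamma) (halpha : 0 < alpha < 1) (hL : 0 < L) :
  exists c : R,
    forall (theta delta : R) (f : R -> R)
           (u0 : 'rV[R]_d -> R) (u : R -> 'rV[R]_d -> R),
      pi / 2 < theta < pi -> 0 < delta ->
      (forall (n : nat) (x : R), derivable (derive1n n f) x 1) ->
      (forall s t : R, `|f t - f s| <= L * `|t - s|) ->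
      inL2 Omega u0 ->
      mild_solution Omega gamma alpha theta delta T f u0 u ->
      forall t : R, 0 < t <= T ->
        normL2 Omega (u t) <=
          c * (normL2 Omega u0 + t * normL2 Omega (fun=> f 0)).
Proof.
pose C : R := contour_const / (2 * pi) + 1.
have pi0 := @pi_gt0 R.
have C0 : 0 < C.
  by rewrite ltr_wpDl // divr_ge0 ?contour_const_ge0 ?mulr_ge0 // ltW.
have CC : contour_const / (2 * pi) <= C by rewrite lerDl.
(* [gronwall] with [A = C * (n0 + t1 * nf)] and [B = C * L] *)
exists (2 * C * expR (2 * (C * L) * T)).
move=> theta delta f u0 u hth hdel _ fL u0L [uL ucont _ umild] t1 /andP[t10 t1T].
pose m s := normL2 Omega (u s); pose n0 := normL2 Omega u0.
pose nf := normL2 Omega (fun=> f 0).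
have n00 : 0 <= n0 by exact: normL2_ge0.
have nf0 : 0 <= nf by exact: normL2_ge0.
have f0L : inL2 Omega (fun=> f 0).
  by apply: (bounded_inL2 hOmega (M := `|f 0|)) => //; exact: measurable_cst.
have Eop t v w : 0 < t -> is_solution_operator Omega gamma alpha theta delta t v w ->
    exists w', [/\ inL2C Omega w', eqL2 Omega w w' & normL2C Omega w' <= C * normL2C Omega v].
  move=> t0 H; have [w' [w1 w2 w3]] := solution_operator_bound hOmega hgamma halpha hth hdel t0 H.
  exists w'; split => //; apply: le_trans w3 _; rewrite ler_wpM2r //.
  exact: normL2C_ge0.
(* the norm of [u] is continuous on the compact interval, hence bounded *)
have [M M0 mM] : exists2 M : R, 0 <= M & forall s, 0 <= s <= T -> m s <= M.
  have cm : {within `[0, T], continuous m}.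
    apply/subspace_continuousP => x /=; rewrite in_itv /= => xT.
    have cx := ucont x xT.
    have lo : m x - normL2 Omega (fun y => u s y - u x y)
        @[s --> within `[0, T] (nbhs x)] --> m x.
      by rewrite -[X in _ --> X]subr0; apply: cvgB => //; exact: cvg_cst.
    have hi : m x + normL2 Omega (fun y => u s y - u x y)
        @[s --> within `[0, T] (nbhs x)] --> m x.
      by rewrite -[X in _ --> X]addr0; apply: cvgD => //; exact: cvg_cst.
    apply: (squeeze_cvgr _ lo hi).
    near=> s.
    have sT : 0 <= s <= T.
      have : (`[0, T]%classic : set R) s by near: s; exact: withinT.
      by rewrite /= in_itv.
    have : `|m s - m x| <= normL2 Omega (fun y => u s y - u x y).
      exact: normL2_reverse_triangle (uL s sT) (uL x xT).
    by rewrite ler_distl => /andP[h1 h2]; apply/andP; split.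
  have [c cT cmax] := EVT_max (ltW hT) cm.
  exists (m c); first exact: normL2_ge0.
  by move=> s sT; apply: cmax; rewrite in_itv.
pose A := C * (n0 + t1 * nf).
have A0 : 0 <= A.
  by rewrite mulr_ge0 ?(ltW C0) // addr_ge0 // mulr_ge0 // ltW.
have B0 : 0 < C * L by exact: mulr_gt0.
have G := @gronwall R m t1 A (C * L) M B0 A0 M0 _ _ t10.
apply: le_trans (G _ _) _.
- by move=> s /andP[s0 st]; apply: mM; rewrite (ltW s0) (le_trans st).
- move=> K t K0 /andP[t0 tt1] Km.
  have tT : t <= T by exact: le_trans tt1 t1T.
  have [w [Gs [W [Hw HG BW uE]]]] := umild t (introT andP (conj t0 tT)).
  have [w' [w'L ww' w'n]] := Eop t _ _ t0 Hw.
  have [WL GL _] := BW.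
  have utL : inL2 Omega (u t) by apply: uL; rewrite (ltW t0).
  have mt : m t <= C * n0 + normL2C Omega W.
    have wW := inL2CD w'L WL.
    rewrite /m -normL2C_real // (_ : normL2C _ _ = normL2C Omega (fun x => w' x + W x)).
      apply: le_trans (normL2CD w'L WL) _; rewrite lerD2r.
      by apply: le_trans w'n _; rewrite normL2C_real.
    apply: normL2C_eq => //; last exact: inL2C_real.
    move: uE ww'; apply: filterS2 => x H1 H2 Ox.
    by rewrite H1 // H2.
  have Wn : normL2C Omega W <= C * (t * nf) + K * expR (2 * (C * L) * t) / 2.
    (* the integral term is paired with itself *)
    set X := (X in _ <= X).
    have X0 : 0 <= X.
      rewrite addr_ge0 ?mulr_ge0 ?(ltW C0) ?(ltW t0) ?invr_ge0 ?expR_ge0 //.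
    have [->//|W0] := eqVneq (normL2C Omega W) 0.
    have W1 : 0 < normL2C Omega W by rewrite lt_neqAle eq_sym W0 normL2C_ge0.
    rewrite -(ler_pM2r W1) -expr2 normL2C_sq //.
    have cpos : 0 < 2 * (C * L) by rewrite mulr_gt0.
    have [iE EE] := affine_expR_integral (C * nf * normL2C Omega W)
      (C * L * K * normL2C Omega W) cpos t0.
    have mD : measurable (`]0, t[%classic : set (measurableTypeR R)).
      exact: measurable_itv.
    apply: le_trans (bochner_upper_bound BW mD WL iE _) _.
      move=> s /=; rewrite in_itv /= => /andP[s0 st].
      have sT : 0 <= s <= T by rewrite (ltW s0) (le_trans (ltW st)).
      have Gs' := HG s (introT andP (conj s0 st)).
      have ts0 : 0 < t - s by rewrite subr_gt0.
      have [g' [g'L gg' g'n]] := Eop (t - s) _ _ ts0 Gs'.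
      have GsL : inL2C Omega (Gs s) by apply: GL; rewrite /= in_itv /= s0.
      have usL := uL s sT.
      have fuL : inL2 Omega (fun x => f (u s x)).
        (* [f (u s)] is the right-hand side of a resolvent equation *)
        have [rr [_ [rP _ _]]] := Gs'.
        have cd : contour theta delta (polar delta theta) by left; exists delta => //; left.
        by have [[]] := rP _ cd.
      have fn : normL2 Omega (fun x => f (u s x)) <= nf + L * m s.
        have dL := inL2B fuL f0L.
        have -> : (fun x => f (u s x)) = (fun x => (f (u s x) - f 0) + f 0).
          by apply/funext => x; rewrite subrK.
        apply: le_trans (normL2D dL f0L) _; rewrite addrC lerD2l.
        apply: le_trans (_ : normL2 Omega (fun x => L * u s x) <= _).
          apply: normL2_le => //; first exact: inL2Z.
          by move=> x; rewrite normrM (gtr0_norm hL); have := fL 0 (u s x); rewrite subr0.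
        by apply: le_trans (normL2Z L usL) _; rewrite gtr0_norm.
      have ms : m s <= K * expR (2 * (C * L) * s) by apply: Km; rewrite s0.
      apply: le_trans (ler_norm _) _.
      apply: le_trans (innerC_re_cauchy_schwarz GsL WL) _.
      have -> : C * nf * normL2C Omega W + C * L * K * normL2C Omega W * expR (2 * (C * L) * s) =
        (C * (nf + L * (K * expR (2 * (C * L) * s)))) * normL2C Omega W by ring.
      rewrite ler_wpM2r ?normL2C_ge0 // (normL2C_eq gg' GsL g'L).
      apply: le_trans g'n _; rewrite ler_wpM2l ?(ltW C0) // normL2C_real //.
      by apply: le_trans fn _; rewrite lerD2l ler_wpM2l // ltW.
    rewrite EE.
    have -> : C * nf * normL2C Omega W * t + C * L * K * normL2C Omega W *
        ((expR (2 * (C * L) * t) - 1) / (2 * (C * L))) =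
      (C * (t * nf) + K * (expR (2 * (C * L) * t) - 1) / 2) * normL2C Omega W.
      by field; rewrite !gt_eqF.
    rewrite ler_wpM2r ?normL2C_ge0 // lerD2l.
    have := K0; lra.
  apply: le_trans mt _; apply: le_trans (lerD (lexx _) Wn) _.
  have : C * (t * nf) <= C * (t1 * nf).
    by rewrite ler_wpM2l ?(ltW C0) // ler_wpM2r.
  rewrite /A; lra.
- have -> : 2 * C * expR (2 * (C * L) * T) * (n0 + t1 * nf) = 2 * A * expR (2 * (C * L) * T).
    by rewrite /A; ring.
  apply: ler_wpM2l; first by rewrite mulr_ge0.
  rewrite ler_expR; apply: ler_wpM2l => //.
  by rewrite mulr_ge0 // ltW.
Unshelve. all: by end_near.
Qed.
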